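(* Let $k\ge 1$ and $d>1$ be integers and let $j_1,\dots,j_d$ be integers with $0\le j_i<k$ for all $i$. Let $f$ be a meromorphic solution of $$f^{(k)}=f^{(j_1)}\cdots f^{(j_d)}$$ with at least one pole, of multiplicity $m$, and let $p$ be the associated polynomial $$p(x)=(x-m)_k-\sum_{i=1}^d(-1)^{k-j_i}(k+m-1)_{k-j_i}(x-m)_{j_i}.$$ (1) If $p$ has no positive integer root, then $f$ is rational. (2) If $f$ is transcendental, then the greatest common divisor $q$ of the positive integer roots of $p$ is either $1,2,3,4$ or $6$, and moreover: - if $q=2$, then $f$ is either elliptic or of the form $f(z)=g(e^{cz})$ with $g$ rational and $c$ constant; - if $q=4$, then $f$ is elliptic with a period ratio $i$; - if $q=3$ or $q=6$, then $f$ is elliptic with a period ratio $e^{2\pi i/6}$.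
   Context: ''Meromorphic solution'' means a solution meromorphic in all of $\mathbb{C}$; ''transcendental'' means not rational. $f^{(j)}$ is the $j$-th derivative, $f^{(0)}=f$. Falling factorial: $(x)_j=x(x-1)\cdots(x-j+1)$ for $j>0$ and $(x)_0=1$. An elliptic function has a period ratio $\tau$ if it has nonzero periods $\omega_1,\omega_2$ with $\omega_2/\omega_1=\tau$. *)

(* Defs.v *)
From HB Require Import structures.
From mathcomp Require Import all_boot all_order all_algebra.
From mathcomp Require Import complex.
From mathcomp Require Import all_classical all_reals all_analysis.

Set Implicit Arguments.
Unset Strict Implicit.
Unset Printing Implicit Defensive.

Import Order.TTheory GRing.Theory Num.Theory.
Import numFieldNormedType.Exports.

Local Open Scope classical_set_scope.
Local Open Scope ring_scope.

(* Naming the [numClosedFieldType] structure gives access to the norm topology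
   of a [numFieldType]; over it, [derivable f z 1] and [f^`(n)] are complex
   differentiability and the complex derivatives. *)
Definition Cplx (R : realType) : numClosedFieldType := R[i].

Section ComplexFunctions.
Variable R : realType.
Local Notation C := (Cplx R).
Implicit Types (f g : C -> C) (a z w c tau : C).

Definition cexp z : C :=
  ((expR (complex.Re z))%:C * (cos (complex.Im z) +i* sin (complex.Im z)))%C.

Definition holomorphic_at f z : Prop := \forall w \near z, derivable f w 1.

Definition pole_of_order f a (m : nat) : Prop :=
  (0 < m)%N /\
  exists g, [/\ holomorphic_at g a, g a != 0
    & \forall w \near a^', f w = g w / (w - a) ^+ m].

(* A meromorphic function is a total function whose values at its poles are
   arbitrary; removable singularities are not allowed. *)
Definition meromorphic f : Prop :=
  forall z, holomorphic_at f z \/ exists m, pole_of_order f z m.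

(* Equality of meromorphic functions: since values at the poles are
   irrelevant, [f] and [g] are compared off a closed discrete set. *)
Definition mero_eq f g : Prop := forall z, \forall w \near z^', f w = g w.

Definition rational_fun f : Prop :=
  exists P Q : {poly C}, Q != 0 /\ mero_eq f (fun z => P.[z] / Q.[z]).

Definition transcendental_fun f : Prop := ~ rational_fun f.

Definition rational_in_exp f : Prop :=
  exists c, exists P Q : {poly C},
    Q != 0 /\ mero_eq f (fun z => P.[cexp (c * z)] / Q.[cexp (c * z)]).

Definition is_period f w : Prop := mero_eq (fun z => f (z + w)) f.

(* For [w1 != 0], [w1] and [w2] are linearly independent over the reals iff
   [w2 / w1] is not real. *)
Definition elliptic f : Prop :=
  meromorphic f /\
  exists w1 w2, [/\ is_period f w1, is_period f w2, w1 != 0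
    & w2 / w1 \isn't Num.real].

Definition has_period_ratio f tau : Prop :=
  exists w1 w2, [/\ is_period f w1, is_period f w2, w1 != 0, w2 != 0
    & w2 / w1 = tau].

Definition is_ode_solution (k d : nat) (j : 'I_d -> nat) f : Prop :=
  mero_eq (f^`(k))%classic (fun z => \prod_(i < d) (f^`(j i))%classic z).

End ComplexFunctions.

(* The falling factorial x (x - 1) ... (x - n + 1). *)
Definition ffall (A : comNzRingType) (x : A) (n : nat) : A :=
  \prod_(i < n) (x - i%:R).

Definition assoc_poly (k d : nat) (j : 'I_d -> nat) (m : nat) : {poly int} :=
  ffall ('X - m%:R%:P) k
  - \sum_(i < d)
      ((-1) ^+ (k - j i) * ffall (k%:R + m%:R - 1 : int) (k - j i))%:P
      * ffall ('X - m%:R%:P) (j i).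

Definition pos_int_root (p : {poly int}) (n : nat) : Prop :=
  (0 < n)%N /\ root p n%:Z.

(* By this definition the gcd of the empty set is 0. *)
Definition is_gcd_of (S : set nat) (q : nat) : Prop :=
  (forall n, S n -> (q %| n)%N) /\
  (forall e, (forall n, S n -> (e %| n)%N) -> (e %| q)%N).

(* Main.v *)
Require Import Defs.
From HB Require Import structures.
From mathcomp Require Import all_boot all_order all_algebra.
From mathcomp Require Import complex.
From mathcomp Require Import all_classical all_reals all_analysis.
From mathcomp Require Import zify ring lra.
Import Order.TTheory GRing.Theory Num.Theory.
Import numFieldNormedType.Exports.
Local Open Scope ring_scope.

(** Why the theorem holds.

    Near a pole [b] of order [m] write [f z = g z / (z - b)^m].  Comparing orders
    in the equation gives [m + k = \sum_i (m + j_i)], and [d > 1] then forces all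
    poles to have the same order.  Let [c != 0] and suppose that the germ of [g]
    at [b] is not invariant under the dilation of ratio [c]:
    [g (b + z) - g (b + c z) = z^n s z] with [s 0 != 0].  Subtracting the equations
    satisfied by the two germs and comparing leading terms shows that [n] is a
    root of the associated polynomial ([resonance]).  When [c^q = 1] and [c^n = 1]
    for every positive integer root [n], the sum of these differences over the
    orbit of [z] telescopes to zero while its leading coefficient is [q * s 0]; so
    there is no such [n], and the identity theorem makes
    [f (b + c z) = c^-m f (b + z)] a global symmetry ([rotation]).  Without
    positive integer roots [c = 2] is allowed as well, [g] is constant near [b],
    and [f] is a constant times [(z - b)^-m] ([no_root_rational]).

    The symmetries about two poles [b] and [b'] differ by a translation, so that
    [(1 - eps) (b - b')] is a period for [eps = e^(2 pi i / q)], and multiplication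
    by [eps] preserves the periods.  For [q > 2] this makes [f] elliptic with period
    ratio [eps], and for [q = 3] also with the ratio [1 + eps], a sixth root of
    unity.  Since the poles are isolated, the periods cannot be contracted by a
    number built from [eps]; this is the crystallographic restriction, which leaves
    only 3, 4 and 6.  For [q = 2] either two differences of poles are independent
    over the reals, or all poles lie on one line of direction [om], a period.

    What remains is of a different nature: a transcendental solution has a second
    pole, and in the last case it is rational in an exponential.  Both follow from
    a growth estimate.  Suppose that on a disc [|f (a + lam w)|] is at most about
    [|f a| e^(Re w)], [|w| <= 1].  Then the quotient [f (a + lam w) / (f a e^w)] has
    modulus almost at most 1, with the value 1 at the centre, hence is almost
    constant near the centre.  All derivatives of [f] at [a] are then comparable to
    [|f a| |lam|^-i], and the equation bounds [|f a| |lam|^m] ([growth_core]).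
    Applied where [|f|] times a high power of the distance to an outer boundary
    is nearly maximal, this shows that [f] grows like a power of [z] if [b] is its
    only pole ([plane_growth]) and exponentially if it is periodic with all poles on
    a line ([strip_growth]).  In the first case [(z - b)^m f] is a polynomial by
    Liouville's theorem ([one_pole_rational]).  In the second case the product of
    [f] with a polynomial in [w = e^(c z)] that cancels the poles is entire and
    periodic, hence a function of [w] in the punctured plane, where its growth
    makes it a Laurent polynomial ([periodic_laurent], [cylinder_rational]).

    The underlying function theory is derived from Cauchy's formula on squares.
    Integrals along segments are limits of midpoint sums over dyadic subdivisions,
    for which halving a segment, a triangle or a square is the basic operation;
    compactness is always used in the form of nested cells ([nested_cells]). *)

Set Implicit Arguments.
Unset Strict Implicit.
Unset Printing Implicit Defensive.

(** * Real error bounds for complex limits and derivatives *)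
Section Basics.
Variable R : realType.
Notation C := (Cplx R).
Implicit Types (f g : C -> C) (z w a b c l : C) (e d : R).

(** The order and the norm of the complex numbers are complex valued; [nm], [rc],
    [Rez] and [Imz] move estimates to the ordered field of real numbers. *)
Definition nm (z : C) : R := Normc.normc z.
Definition rc (r : R) : C := (r%:C)%C.
Definition Rez (z : C) : R := complex.Re z.
Definition Imz (z : C) : R := complex.Im z.

Lemma rcD x y : rc (x + y) = rc x + rc y. Proof. exact: (rmorphD (real_complex R)). Qed.
Lemma rcN x : rc (- x) = - rc x. Proof. exact: (rmorphN (real_complex R)). Qed.
Lemma rcB x y : rc (x - y) = rc x - rc y. Proof. exact: (rmorphB (real_complex R)). Qed.
Lemma rcM x y : rc (x * y) = rc x * rc y. Proof. exact: (rmorphM (real_complex R)). Qed.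
Lemma rcX x n : rc (x ^+ n) = rc x ^+ n. Proof. exact: (rmorphXn (real_complex R)). Qed.
Lemma rcV x : rc x^-1 = (rc x)^-1. Proof. exact: (fmorphV (real_complex R)). Qed.
Lemma rc0 : rc 0 = 0. Proof. by []. Qed.
Lemma rc1 : rc 1 = 1. Proof. by []. Qed.
Lemma rc_nat n : rc n%:R = n%:R. Proof. exact: (rmorph_nat (real_complex R)). Qed.
Lemma rc_lt x y : (rc x < rc y) = (x < y). Proof. exact: ltcR. Qed.
Lemma rc_le x y : (rc x <= rc y) = (x <= y). Proof. exact: lecR. Qed.
Lemma CE z : z = rc (Rez z) + 'i * rc (Imz z).
Proof. by rewrite {1}[z]complexE complexiE. Qed.
Lemma Rez_rc x y : Rez (rc x + 'i * rc y) = x.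
Proof. by rewrite -complexiE /Rez /rc /=; ring. Qed.
Lemma Imz_rc x y : Imz (rc x + 'i * rc y) = y.
Proof. by rewrite -complexiE /Imz /rc /=; ring. Qed.
Lemma RezD x y : Rez (x + y) = Rez x + Rez y. Proof. by case: x; case: y. Qed.
Lemma ImzD x y : Imz (x + y) = Imz x + Imz y. Proof. by case: x; case: y. Qed.
Lemma RezN x : Rez (- x) = - Rez x. Proof. by case: x. Qed.
Lemma ImzN x : Imz (- x) = - Imz x. Proof. by case: x. Qed.
Lemma RezM x y : Rez (x * y) = Rez x * Rez y - Imz x * Imz y. Proof. by case: x; case: y. Qed.
Lemma ImzM x y : Imz (x * y) = Rez x * Imz y + Imz x * Rez y. Proof. by case: x; case: y. Qed.
Lemma Rez_r x : Rez (rc x) = x. Proof. by []. Qed.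
Lemma Imz_r x : Imz (rc x) = 0. Proof. by []. Qed.
Lemma Rezi : Rez 'i = 0. Proof. by rewrite -complexiE. Qed.
Lemma Imzi : Imz 'i = 1. Proof. by rewrite -complexiE. Qed.
Lemma rc_real z : z \is Num.real -> z = rc (Rez z).
Proof. by move=> h; rewrite /rc /Rez RRe_real. Qed.
Lemma real_Imz z : (z \is Num.real) = (Imz z == 0).
Proof. by case: z => x y; exact: complex_real. Qed.
Lemma nm_sqr z : nm z ^+ 2 = Rez z ^+ 2 + Imz z ^+ 2.
Proof. by case: z => x y; rewrite /nm /= sqr_sqrtr // addr_ge0 ?sqr_ge0. Qed.

Lemma nmE z : `|z| = rc (nm z) :> C.
Proof. by []. Qed.
Lemma nm0 : nm 0 = 0. Proof. exact: Normc.normc0. Qed.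
Lemma nm1 : nm 1 = 1. Proof. exact: Normc.normc1. Qed.
Lemma nmM x y : nm (x * y) = nm x * nm y.
Proof. exact: Normc.normcM. Qed.
Lemma nmV x : nm x^-1 = (nm x)^-1.
Proof. exact: Normc.normcV. Qed.
Lemma nmN x : nm (- x) = nm x.
Proof. exact: normcN. Qed.
Lemma nmD x y : nm (x + y) <= nm x + nm y.
Proof. exact: le_normcD. Qed.
Lemma nm_eq0 x : (nm x == 0) = (x == 0).
Proof. by apply/eqP/eqP => [/Normc.eq0_normc|->]; last exact: nm0. Qed.
Lemma nm_ge0 x : 0 <= nm x.
Proof. by have := normr_ge0 (x : C); rewrite nmE ler0c. Qed.
Lemma nm_gt0 x : (0 < nm x) = (x != 0).
Proof. by rewrite lt_def nm_ge0 andbT nm_eq0. Qed.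
Lemma nmB x y : nm (x - y) = nm (y - x).
Proof. by rewrite -nmN opprB. Qed.
Lemma nmX x n : nm (x ^+ n) = nm x ^+ n.
Proof. by elim: n => [|n IH]; rewrite ?nm1 // !exprS nmM IH. Qed.
Lemma nm_tri y x z : nm (x - z) <= nm (x - y) + nm (y - z).
Proof. by apply: le_trans (nmD _ _); rewrite addrA subrK. Qed.
Lemma nm_subr x y : nm x - nm y <= nm (x - y).
Proof. by rewrite lerBlDr; apply: le_trans (nmD _ _); rewrite subrK. Qed.
Lemma nm_real (r : R) : nm (rc r) = `|r|.
Proof. by rewrite /nm /rc /= expr0n addr0 sqrtr_sqr. Qed.
Lemma nm_nat n : nm n%:R = n%:R.
Proof. by rewrite -rc_nat nm_real ger0_norm. Qed.
Lemma nm_prod (I : Type) (s : seq I) (P : pred I) (F : I -> C) :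
  nm (\prod_(i <- s | P i) F i) = \prod_(i <- s | P i) nm (F i).
Proof.
by elim: s => [|i s IH]; rewrite ?big_nil ?nm1 // !big_cons; case: ifP => // _; rewrite nmM IH.
Qed.
Lemma Re_le_nm z : `|Rez z| <= nm z.
Proof. by have := normc_ge_Re z; rewrite lecR. Qed.
Lemma Im_le_nm z : `|Imz z| <= nm z.
Proof.
case: z => x y; rewrite /nm /= -sqrtr_sqr ler_wsqrtr // lerDr sqr_ge0 //.
Qed.
Lemma nm_le_ReIm z : nm z <= `|Rez z| + `|Imz z|.
Proof.
rewrite {1}[z]CE; apply: le_trans (nmD _ _) _; rewrite nmM !nm_real.
by have -> : nm 'i = 1; rewrite ?mul1r // -complexiE /nm /= expr0n expr1n add0r sqrtr1.
Qed.

Lemma ltr0c e : (0 < rc e) = (0 < e).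
Proof. exact: (ltcR 0 e). Qed.
Lemma pos_rc (e : C) : 0 < e -> e = rc (Rez e) /\ 0 < Rez e.
Proof.
move=> e0; have h : e = rc (Rez e) by apply: rc_real; rewrite ger0_real // ltW.
by split=> //; move: e0; rewrite h ltr0c.
Qed.

Lemma near_nm z (P : C -> Prop) :
  (\forall w \near z, P w) <-> exists2 e, 0 < e & forall w, nm (w - z) < e -> P w.
Proof.
split=> [/nbhs_ballP [e /= /pos_rc [-> e0] H]|[e e0 H]].
- exists (Rez e) => // w wz.
  by apply: H; rewrite /ball /= nmE rc_lt nmB.
- apply/nbhs_ballP; exists (rc e) => /=; first by rewrite ltr0c.
  by move=> w; rewrite /ball /= nmE rc_lt nmB => /H.
Qed.

End Basics.

(* Left transparent, these make unification compare complex numbers by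
   coordinates. *)
Opaque Cplx nm rc Rez Imz.

Section Basics2.
Variable R : realType.
Notation C := (Cplx R).
Implicit Types (f g : C -> C) (z w a b c l : C) (e d : R).
Lemma pnear_nm z (P : C -> Prop) :
  (\forall w \near z^', P w)%classic <->
  exists2 e, 0 < e & forall w, w != z -> nm (w - z) < e -> P w.
Proof.
split=> [/near_nm [e e0 H]|[e e0 H]]; last apply/near_nm; exists e => // w.
  by move=> wz we; exact: H.
by move=> we wz; exact: H.
Qed.

Variant is_cder f z l : Prop := IsCder of forall e, 0 < e -> exists2 d, 0 < d &
  forall h, nm h < d -> nm (f (z + h) - f z - h * l) <= e * nm h.


Lemma is_cder_cvg f z l :
  is_cder f z l <-> ((fun h => h^-1 *: (f (h + z) - f z)) @ 0^' --> (l : C))%classic.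
Proof.
split.
- move=> [H]; apply/cvgrPdist_lt => e /pos_rc [-> e0].
  have [d d0 Hd] := H (Rez e / 2) (divr_gt0 e0 (ltr0Sn _ 1)).
  apply/pnear_nm; exists d => // h h0; rewrite subr0 => hd.
  have := Hd h hd; rewrite nmE rc_lt addrC [z + h]addrC.
  have -> : - (h * l) + (f (h + z) - f z) = - (h * (l - h^-1 *: (f (h + z) - f z))).
    by rewrite /GRing.scale /=; field.
  rewrite nmN nmM mulrC ler_pM2r ?nm_gt0 // => /le_lt_trans; apply.
  by rewrite ltr_pdivrMr // ltr_pMr // ltr1n.
- move=> /cvgrPdist_le H; split=> e e0.
  have := H (rc e); rewrite ltr0c => /(_ e0) /pnear_nm [d d0 Hd].
  exists d => // h hd; have [->|h0] := eqVneq h 0.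
    by rewrite addr0 subrr mul0r subrr nm0 mulr0.
  have := Hd h h0; rewrite subr0 => /(_ hd); rewrite nmE rc_le.
  have -> : f (z + h) - f z - h * l = - (h * (l - h^-1 *: (f (h + z) - f z))).
    by rewrite /GRing.scale /= [h + z]addrC; field.
  by rewrite nmN nmM mulrC ler_pM2r ?nm_gt0.
Qed.

Lemma is_cder_derivable f z l : is_cder f z l -> derivable f z 1.
Proof.
move=> /is_cder_cvg H; apply/cvg_ex; exists l.
by under eq_fun do rewrite [_ *: 1]mulr1.
Qed.

Lemma derivable_cder f z : derivable f z 1 -> is_cder f z (f^`()%classic z).
Proof.
rewrite /derivable; under eq_fun do rewrite /= [_ *: 1]mulr1.
by move=> H; apply/is_cder_cvg; exact: H.
Qed.

Lemma derivableP_cder f z : derivable f z 1 <-> exists l, is_cder f z l.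
Proof. by split=> [/derivable_cder|[l /is_cder_derivable//]]; eexists; eauto. Qed.

Lemma is_cder_derive1 f z l : is_cder f z l -> f^`()%classic z = l.
Proof. by move=> /is_cder_cvg H; apply/cvg_lim. Qed.

Lemma is_cder_uniq f z l l' : is_cder f z l -> is_cder f z l' -> l = l'.
Proof. by move=> /is_cder_derive1 <- /is_cder_derive1 <-. Qed.


Variant ccont f z : Prop := CCont of forall e, 0 < e ->
  exists2 d, 0 < d & forall w, nm (w - z) < d -> nm (f w - f z) < e.

Lemma ccontE f z : ccont f z <-> ((f x @[x --> z]) --> (f z : C))%classic.
Proof.
split=> [[H]|/cvgrPdist_lt H].
  apply/(cvgrPdist_lt (FF := nbhs_filter z)) => e /pos_rc [-> e0]; have [d d0 Hd] := H _ e0.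
  by apply/near_nm; exists d => // w /Hd; rewrite nmE rc_lt nmB.
split=> e e0; have := H (rc e); rewrite ltr0c => /(_ e0) /near_nm [d d0 Hd].
by exists d => // w /Hd; rewrite nmE rc_lt nmB.
Qed.

Lemma ccontP f z : ccont f z <->
  forall e, 0 < e -> exists2 d, 0 < d & forall w, nm (w - z) < d -> nm (f w - f z) < e.
Proof. by split=> [[]|]. Qed.

Lemma ccont_cst c z : ccont (fun=> c) z.
Proof. by split=> e e0; exists 1 => // w _; rewrite subrr nm0. Qed.
Lemma ccont_id z : ccont id z.
Proof. by split=> e e0; exists e. Qed.
Lemma ccontD f g z : ccont f z -> ccont g z -> ccont (fun w => f w + g w) z.
Proof. by move=> /ccontE hf /ccontE hg; apply/ccontE; exact: (cvgD hf hg). Qed.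
Lemma ccontM f g z : ccont f z -> ccont g z -> ccont (fun w => f w * g w) z.
Proof. by move=> /ccontE hf /ccontE hg; apply/ccontE; exact: (cvgM hf hg). Qed.
Lemma ccontN f z : ccont f z -> ccont (fun w => - f w) z.
Proof. by move=> /ccontE hf; apply/ccontE; exact: (cvgN hf). Qed.
Lemma ccontV f z : f z != 0 -> ccont f z -> ccont (fun w => (f w)^-1) z.
Proof. by move=> h0 /ccontE hf; apply/ccontE; exact: (cvgV h0 hf). Qed.
Lemma ccont_comp f g z : ccont f z -> ccont g (f z) -> ccont (fun w => g (f w)) z.
Proof.
move=> [hf] [hg]; split=> e /hg [d d0 Hd]; have [x x0 Hx] := hf _ d0.
by exists x => // w /Hx /Hd.
Qed.
Lemma ccont_prod n (F : 'I_n -> C -> C) z :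
  (forall i, ccont (F i) z) -> ccont (fun w => \prod_(i < n) F i w) z.
Proof.
elim: n F => [|n IH] F H.
  by under [X in ccont X]eq_fun do rewrite big_ord0; exact: ccont_cst.
by under [X in ccont X]eq_fun do rewrite big_ord_recr; apply: ccontM => //; apply: IH.
Qed.
Lemma ccont_ext f g z :
  (exists2 e, 0 < e & forall w, nm (w - z) < e -> f w = g w) -> ccont f z -> ccont g z.
Proof.
move=> [e e0 H] /ccontP hf; apply/ccontP => x x0; have [d d0 Hd] := hf _ x0.
exists (Num.min d e); rewrite ?lt_min ?d0 // => w; rewrite lt_min => /andP[wd we].
by rewrite -!H ?Hd // subrr nm0.
Qed.
Lemma ccont_neq0 f z : ccont f z -> f z != 0 ->
  exists2 e, 0 < e & forall w, nm (w - z) < e -> f w != 0.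
Proof.
move=> /ccontP H f0; have [d d0 Hd] := H (nm (f z)) ltac:(by rewrite nm_gt0).
exists d => // w /Hd; apply: contraTneq => ->; by rewrite sub0r nmN ltxx.
Qed.

Lemma ccont_eq f g z : ccont f z -> ccont g z ->
  (exists2 e, 0 < e & forall w, w != z -> nm (w - z) < e -> f w = g w) -> f z = g z.
Proof.
move=> hf hg [e e0 H]; apply/eqP; rewrite -subr_eq0; apply/negP => /negP fg.
have hfg : ccont (fun w => f w - g w) z by apply: ccontD => //; exact: ccontN.
have [d d0 Hd] := ccont_neq0 hfg fg.
have m0 : 0 < Num.min d e / 2 by rewrite divr_gt0 // lt_min d0.
pose w := z + rc (Num.min d e / 2).
have wz : nm (w - z) < Num.min d e.
  by rewrite /w addrC addKr nm_real ger0_norm ?ltW // ltr_pdivrMr // ltr_pMr ?ltr1n // lt_min d0.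
move: wz; rewrite lt_min => /andP[w1 w2].
have := Hd w w1; rewrite H ?subrr ?eqxx //.
by rewrite -subr_eq0 /w addrC addKr -nm_eq0 nm_real ger0_norm ?gt_eqF // ltW.
Qed.

(** Caratheodory's form of differentiability: the difference quotient extends
    continuously.  The rules of differentiation become algebraic identities. *)
Lemma is_cder_car f z l : is_cder f z l <->
  exists p, [/\ ccont p z, p z = l & forall w, f w = f z + (w - z) * p w].
Proof.
split=> [[H]|[p [/ccontP cp pz fE]]].
- pose p w := if w == z then l else (f w - f z) / (w - z).
  exists p; split; rewrite /p ?eqxx //.
    apply/ccontP => e e0; have [d d0 Hd] := H (e / 2) (divr_gt0 e0 (ltr0Sn _ 1)).
    exists d => // w wd; rewrite eqxx; case: eqVneq => wz; first by rewrite subrr nm0.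
    have wz' : w - z != 0 by rewrite subr_eq0.
    have := Hd _ wd; rewrite [z + _]addrC subrK.
    have -> : f w - f z - (w - z) * l = (w - z) * ((f w - f z) / (w - z) - l) by field.
    rewrite nmM mulrC ler_pM2r ?nm_gt0 // => /le_lt_trans; apply.
    by rewrite ltr_pdivrMr // ltr_pMr // ltr1n.
  move=> w; case: eqVneq => [->|wz]; first by rewrite subrr mul0r addr0.
  by field; rewrite subr_eq0.
- split=> e e0; have [d d0 Hd] := cp _ e0; exists d => // h hd.
  rewrite fE.
  have -> : f z + (z + h - z) * p (z + h) - f z - h * l = h * (p (z + h) - p z) by rewrite pz; ring.
  by rewrite nmM mulrC ler_wpM2r ?nm_ge0 // ltW // Hd // addrC addKr.
Qed.

Lemma is_cder_cont f z l : is_cder f z l -> ccont f z.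
Proof.
move=> /is_cder_car [p [cp _ fE]].
rewrite (_ : f = fun w => f z + (w - z) * p w); last exact/funext.
apply: ccontD; first exact: ccont_cst.
by apply: ccontM => //; apply: ccontD; [exact: ccont_id|exact: ccont_cst].
Qed.
Lemma is_cder_cst c z : is_cder (fun=> c) z 0.
Proof. by apply/is_cder_car; exists (fun=> 0); split=> // [|w]; [exact: ccont_cst|rewrite mulr0 addr0]. Qed.
Lemma is_cder_id z : is_cder id z 1.
Proof. by apply/is_cder_car; exists (fun=> 1); split=> // [|w]; [exact: ccont_cst|rewrite mulr1 addrC subrK]. Qed.
Lemma is_cderD f g z l l' : is_cder f z l -> is_cder g z l' ->
  is_cder (fun w => f w + g w) z (l + l').
Proof.
move=> /is_cder_car [p [cp <- fE]] /is_cder_car [q [cq <- gE]]; apply/is_cder_car.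
exists (fun w => p w + q w); split=> [||w] //; first exact: ccontD.
by rewrite [in LHS]fE [in LHS]gE; ring.
Qed.
Lemma is_cderM f g z l l' : is_cder f z l -> is_cder g z l' ->
  is_cder (fun w => f w * g w) z (l * g z + f z * l').
Proof.
move=> hf hg; have cg := is_cder_cont hg.
move: hf hg => /is_cder_car [p [cp <- fE]] /is_cder_car [q [cq <- gE]]; apply/is_cder_car.
exists (fun w => p w * g w + f z * q w); split=> [||w] //.
  by apply: ccontD; apply: ccontM => //; exact: ccont_cst.
by rewrite [in LHS]fE mulrDl [in f z * g w]gE; ring.
Qed.
Lemma is_cderN f z l : is_cder f z l -> is_cder (fun w => - f w) z (- l).
Proof.
move=> /is_cder_car [p [cp <- fE]]; apply/is_cder_car; exists (fun w => - p w).
split=> // [|w]; first exact: ccontN. by rewrite fE; ring.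
Qed.
Lemma is_cderV f z l : f z != 0 -> is_cder f z l ->
  is_cder (fun w => (f w)^-1) z (- l / f z ^+ 2).
Proof.
move=> f0 hf; have cf := is_cder_cont hf; have [e e0 ne0] := ccont_neq0 cf f0.
move: hf => /is_cder_car [p [cp <- fE]]; apply/is_cder_car.
pose q w := if f w == 0 then ((f w)^-1 - (f z)^-1) / (w - z) else - p w / (f w * f z).
exists q; split; rewrite /q.
- apply: (@ccont_ext (fun w => - p w / (f w * f z))).
    by exists e => // w /ne0 /negbTE ->.
  apply: ccontM; first exact: ccontN.
  have ff0 : f z * f z != 0 by rewrite mulf_neq0.
  by apply: (@ccontV (fun w => f w * f z) z ff0); apply: (ccontM cf); exact: ccont_cst.
- by rewrite (negbTE f0); field.
- move=> w; case: eqVneq => fw.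
    have wz : w - z != 0 by rewrite subr_eq0; apply: contraNneq f0 => <-; rewrite fw.
    by rewrite mulrC divfK // addrC subrK.
  have -> : (w - z) * (- p w / (f w * f z)) = - (f w - f z) / (f w * f z) by have -> : f w - f z = (w - z) * p w; [rewrite [in LHS]fE; ring|ring].
  by field; rewrite ?fw ?f0.
Qed.
Lemma is_cder_comp f g z l l' : is_cder f z l -> is_cder g (f z) l' ->
  is_cder (fun w => g (f w)) z (l' * l).
Proof.
move=> hf; have cf := is_cder_cont hf; move: hf.
move=> /is_cder_car [p [cp <- fE]] /is_cder_car [q [cq <- gE]]; apply/is_cder_car.
exists (fun w => q (f w) * p w); split=> [||w] //.
  by apply: ccontM => //; exact: ccont_comp.
by rewrite [in LHS]gE [in (f w - f z)]fE; ring.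
Qed.
Lemma is_cderX f z l n : is_cder f z l ->
  is_cder (fun w => f w ^+ n) z (n%:R * f z ^+ n.-1 * l).
Proof.
move=> hf; elim: n => [|n IH]; first by rewrite !mul0r; exact: is_cder_cst.
under [X in is_cder X]eq_fun do rewrite exprS.
have := is_cderM hf IH; congr is_cder; rewrite /= mulrA (mulrC (f z)) -mulrA -natr1.
by case: n {IH} => [|n] /=; rewrite ?exprS; ring.
Qed.
Lemma is_cder_ext f g z l :
  (exists2 e, 0 < e & forall w, nm (w - z) < e -> f w = g w) -> is_cder f z l -> is_cder g z l.
Proof.
move=> [e e0 H] [hf]; split=> x x0; have [d d0 Hd] := hf _ x0.
exists (Num.min d e); rewrite ?lt_min ?d0 // => h; rewrite lt_min => /andP[hd he].
by rewrite -!H ?Hd // ?subrr ?nm0 // addrC addKr.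
Qed.
End Basics2.

(** * Integration along segments *)
Section Goursat.
Variable R : realType.
Notation C := (Cplx R).
Implicit Types (f g : C -> C) (z w a b c l p q : C) (e d r : R) (D : C -> Prop).

Lemma geo_small (A e : R) : 0 < e -> exists n, A / 2 ^+ n < e.
Proof.
move=> e0; have [A0|A0] := ltP A 0.
  by exists 0%N; rewrite expr0 divr1; lra.
exists (Num.bound (A / e)).
rewrite ltr_pdivrMr ?exprn_gt0 // mulrC -ltr_pdivrMr //.
apply: lt_le_trans (archi_boundP _) _; first by rewrite divr_ge0 // ltW.
by rewrite -natrX ler_nat ltnW // ltn_expl.
Qed.

Lemma real_geo_complete (u : nat -> R) r :
  (forall n, `|u n.+1 - u n| <= r / 2 ^+ n) ->
  exists x, forall n, `|u n - x| <= 2 * r / 2 ^+ n.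
Proof.
move=> H.
have r0 : 0 <= r by apply: le_trans (normr_ge0 _) _; have := H 0%N; rewrite expr0 divr1; exact.
have pw n : 0 < 2 ^+ n :> R by rewrite exprn_gt0.
have st n : r / 2 ^+ n.+1 = (r / 2 ^+ n) / 2 by rewrite exprS; field; rewrite gt_eqF.
pose lo n := u n - 2 * (r / 2 ^+ n); pose hi n := u n + 2 * (r / 2 ^+ n).
have lo1 n : lo n <= lo n.+1.
  by have := H n; rewrite /lo st ler_norml; lra.
have hi1 n : hi n.+1 <= hi n.
  by have := H n; rewrite /hi st ler_norml; lra.
have lom n k : lo n <= lo (n + k)%N by elim: k => [|k IH]; rewrite ?addn0 // addnS (le_trans IH).
have him n k : hi (n + k)%N <= hi n by elim: k => [|k IH]; rewrite ?addn0 // addnS (le_trans _ IH).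
have lohi n k : lo n <= hi k.
  apply: le_trans (lom n k) _; apply: le_trans _ (him k n); rewrite addnC /lo /hi.
  have : 0 <= r / 2 ^+ (k + n) by rewrite divr_ge0 // ltW.
  by lra.
pose A := [set lo n | n in setT]%classic.
have ubA k : ubound A (hi k) by move=> _ [n _ <-].
have supA : has_sup A by split; [exists (lo 0%N); exists 0%N|exists (hi 0%N)].
exists (sup A) => n.
have h1 : lo n <= sup A by apply: ub_le_sup; [exists (hi 0%N)|exists n].
have h2 : sup A <= hi n by apply: ge_sup; [exists (lo 0%N); exists 0%N|].
by rewrite -mulrA; move: h1 h2; rewrite /lo /hi ler_norml; lra.
Qed.

Lemma geo_complete (u : nat -> C) r :
  (forall n, nm (u n.+1 - u n) <= r / 2 ^+ n) ->
  exists z, forall n, nm (u n - z) <= 4 * r / 2 ^+ n.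
Proof.
move=> H.
have [x Hx] := @real_geo_complete (fun n => Rez (u n)) r
  (fun n => le_trans (le_trans (y := `|Rez (u n.+1 - u n)|) ltac:(by rewrite RezD RezN) (Re_le_nm _)) (H n)).
have [y Hy] := @real_geo_complete (fun n => Imz (u n)) r
  (fun n => le_trans (le_trans (y := `|Imz (u n.+1 - u n)|) ltac:(by rewrite ImzD ImzN) (Im_le_nm _)) (H n)).
exists (rc x + 'i * rc y) => n; apply: le_trans (nm_le_ReIm _) _.
rewrite RezD RezN ImzD ImzN Rez_rc Imz_rc.
have := Hx n; have := Hy n; rewrite -!mulrA; lra.
Qed.

(** Compactness by subdivision.  A cell is any object with a centre and a radius;
    if a property of cells is inherited by one part of half the radius, the
    chosen cells shrink to a point. *)
Lemma nested_cells (X : Type) (P : X -> Prop) (ctr : X -> C) (rad : X -> R) (T0 : X) :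
  P T0 ->
  (forall T, P T -> exists T', [/\ P T', rad T' = rad T / 2 & nm (ctr T' - ctr T) <= rad T]) ->
  exists z, forall e, 0 < e -> exists T, [/\ P T, rad T < e & nm (ctr T - z) <= 4 * rad T].
Proof.
move=> P0 H.
have /boolp.choice [nx Hnx] : forall T, exists T',
    P T -> [/\ P T', rad T' = rad T / 2 & nm (ctr T' - ctr T) <= rad T].
  by move=> T; have [PT|nPT] := pselect (P T); [have [T' ?] := H T PT; exists T'|exists T].
pose t n := iter n nx T0.
have Pt n : P (t n) by elim: n => [|n IH] //=; have [] := Hnx _ IH.
have rt n : rad (t n) = rad T0 / 2 ^+ n.
  elim: n => [|n IH] /=; first by rewrite expr0 divr1.
  by have [_ -> _] := Hnx _ (Pt n); rewrite IH exprSr invfM mulrA.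
have [z Hz] := @geo_complete (fun n => ctr (t n)) (rad T0)
  ltac:(by move=> n; rewrite -rt; have [] := Hnx _ (Pt n)).
exists z => e e0; have [n hn] := geo_small (rad T0) e0.
by exists (t n); split; rewrite ?rt // mulrA.
Qed.

Lemma nm2 : nm (2 : C) = 2. Proof. exact: nm_nat. Qed.
Lemma nm_half z : nm (z / 2) = nm z / 2.
Proof. by rewrite nmM nmV nm2. Qed.
Lemma midB1 p q : (p + q) / 2 - p = (q - p) / 2. Proof. by field. Qed.
Lemma midB2 p q : q - (p + q) / 2 = (q - p) / 2. Proof. by field. Qed.

(** The case of segments halved at their midpoints. *)
Lemma bisection (P : C -> C -> Prop) p q : P p q ->
  (forall x y, P x y -> P x ((x + y) / 2) \/ P ((x + y) / 2) y) ->
  exists z, forall e, 0 < e ->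
    exists u v, [/\ P u v, nm (v - u) < e & nm (u - z) <= 4 * nm (v - u)].
Proof.
move=> Ppq H; have [|z Hz] := @nested_cells (C * C)%type (fun x => P x.1 x.2) fst
    (fun x => nm (x.2 - x.1)) (p, q) Ppq; last first.
  by exists z => e /Hz [[u v] h]; exists u, v.
move=> [x y] /= /H [h|h].
  exists (x, (x + y) / 2); split=> //=; first by rewrite midB1 nm_half.
  by rewrite subrr nm0 nm_ge0.
exists ((x + y) / 2, y); split=> //=; first by rewrite midB2 nm_half.
by rewrite midB1 nm_half; have := nm_ge0 (y - x); lra.
Qed.

(** Convexity for midpoints, the only points that dyadic sums sample. *)
Definition midconvex D := forall p q, D p -> D q -> D ((p + q) / 2).
Definition cclosed D := forall z, (forall e, 0 < e -> exists2 w, D w & nm (w - z) < e) -> D z.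
Definition region D := midconvex D /\ cclosed D.

Lemma midconvexI D D' : midconvex D -> midconvex D' -> midconvex (fun z => D z /\ D' z).
Proof. by move=> h h' p q [? ?] [? ?]; split; [exact: h|exact: h']. Qed.
Lemma regionI D D' : region D -> region D' -> region (fun z => D z /\ D' z).
Proof.
move=> [m c] [m' c']; split; first exact: midconvexI.
by move=> z H; split; [apply: c|apply: c'] => e /H [w [? ?] ?]; exists w.
Qed.
Lemma midconvex_ball a r : midconvex (fun z => nm (z - a) <= r).
Proof.
move=> p q hp hq; have -> : (p + q) / 2 - a = (p - a) / 2 + (q - a) / 2 by field.
apply: le_trans (nmD _ _) _; rewrite !nm_half; lra.
Qed.
Lemma region_ball a r : region (fun z => nm (z - a) <= r).
Proof.
split; first exact: midconvex_ball.
move=> z H; rewrite leNgt; apply/negP => h.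
have [w wr wz] := H (nm (z - a) - r) ltac:(by rewrite subr_gt0).
have := nm_tri w z a; rewrite nmB in wz; lra.
Qed.
Lemma midconvex_half u r : midconvex (fun z => r <= Rez (u * z)).
Proof.
move=> p q hp hq; have -> : u * ((p + q) / 2) = rc (1 / 2) * (u * p + u * q).
  by rewrite rcM rcV rc_nat rc1; field.
by rewrite RezM Rez_r Imz_r RezD; lra.
Qed.
Lemma region_half u r : region (fun z => r <= Rez (u * z)).
Proof.
split; first exact: midconvex_half.
move=> z H; rewrite leNgt; apply/negP => h.
have u0 : 0 < nm u + 1 by have := nm_ge0 u; lra.
have [w wr wz] := H ((r - Rez (u * z)) / (nm u + 1)) ltac:(by rewrite divr_gt0 // subr_gt0).
have := Re_le_nm (u * (w - z)); rewrite nmM mulrBr RezD RezN ler_norml => /andP[_ h1].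
move: wz; rewrite ltr_pdivlMr // => h2.
have : nm u * nm (w - z) <= nm (w - z) * (nm u + 1) by rewrite mulrDr mulrC mulr1 lerDl nm_ge0.
lra.
Qed.

(** Midpoint Riemann sums of [f dz] over the [2^n] equal parts of a segment. *)
Fixpoint dsum f n p q : C := if n is n'.+1 then
    dsum f n' p ((p + q) / 2) + dsum f n' ((p + q) / 2) q
  else f ((p + q) / 2) * (q - p).
(** The sample points of [dsum f n p q]. *)
Fixpoint dpoint n p q z : Prop := if n is n'.+1 then
    dpoint n' p ((p + q) / 2) z \/ dpoint n' ((p + q) / 2) q z
  else z = (p + q) / 2.

Lemma dpoint_in n p q z D : midconvex D -> D p -> D q -> dpoint n p q z -> D z.
Proof.
move=> mD; elim: n p q => [|n IH] p q Dp Dq /=; first by move=> ->; exact: mD.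
by have Dm := mD _ _ Dp Dq; case; exact: IH.
Qed.

Lemma dsum_near f c e n p q : (forall z, dpoint n p q z -> nm (f z - c) <= e) ->
  nm (dsum f n p q - c * (q - p)) <= e * nm (q - p).
Proof.
elim: n p q => [|n IH] p q H /=.
  by rewrite -mulrBl nmM ler_wpM2r ?nm_ge0 // H.
have h1 := IH p ((p + q) / 2) (fun z h => H z (or_introl h)).
have h2 := IH ((p + q) / 2) q (fun z h => H z (or_intror h)).
set m := (p + q) / 2 in h1 h2 *.
have -> : dsum f n p m + dsum f n m q - c * (q - p) =
  (dsum f n p m - c * (m - p)) + (dsum f n m q - c * (q - m)) by ring.
apply: le_trans (nmD _ _) _; move: h1 h2; rewrite midB1 midB2 nm_half; lra.
Qed.

Lemma dsum_rev f n p q : dsum f n q p = - dsum f n p q.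
Proof.
elim: n p q => [|n IH] p q /=; rewrite (addrC q p); first by ring.
by rewrite (IH _ q) (IH p); ring.
Qed.
Lemma dsum_aff a b n p q : dsum (fun z => a + b * z) n p q = a * (q - p) + b * (q ^+ 2 - p ^+ 2) / 2.
Proof. by elim: n p q => [|n IH] p q /=; rewrite ?IH; field. Qed.
Lemma dsum_lin f g a b n p q :
  dsum (fun z => a * f z + b * g z) n p q = a * dsum f n p q + b * dsum g n p q.
Proof. by elim: n p q => [|n IH] p q /=; rewrite ?IH; ring. Qed.
Lemma dsum_ext f g n p q : (forall z, dpoint n p q z -> f z = g z) -> dsum f n p q = dsum g n p q.
Proof.
elim: n p q => [|n IH] p q H /=; first by rewrite H.
by rewrite !IH // => z h; apply: H => /=; [right|left].
Qed.
Lemma dsum_scale f a c n p q :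
  dsum f n (a + c * p) (a + c * q) = c * dsum (fun z => f (a + c * z)) n p q.
Proof.
have mE x y : (a + c * x + (a + c * y)) / 2 = a + c * ((x + y) / 2) by field.
elim: n p q => [|n IH] p q /=; rewrite mE; last by rewrite !IH; ring.
by rewrite /=; ring.
Qed.

Definition dlim f p q l := forall e, 0 < e ->
  exists n0, forall n, (n0 <= n)%N -> nm (dsum f n p q - l) <= e.
Definition sint f p q : C := xget 0 [set l | dlim f p q l]%classic.
Definition has_sint f p q := exists l, dlim f p q l.

Lemma le_eps0 (x : R) : (forall e, 0 < e -> x <= e) -> x <= 0.
Proof. by move=> H; rewrite leNgt; apply/negP => h; have := H _ (divr_gt0 h (ltr0Sn _ 1)); lra. Qed.
Lemma nm_eps0 z : (forall e, 0 < e -> nm z <= e) -> z = 0.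
Proof.
move=> /le_eps0 h; apply/eqP; rewrite -nm_eq0 eq_le h; exact: nm_ge0.
Qed.

Lemma dlim_uniq f p q l l' : dlim f p q l -> dlim f p q l' -> l = l'.
Proof.
move=> H H'; apply/eqP; rewrite -subr_eq0; apply/eqP/nm_eps0 => e e0.
have [n0 h0] := H _ (divr_gt0 e0 (ltr0Sn _ 1)).
have [n1 h1] := H' _ (divr_gt0 e0 (ltr0Sn _ 1)).
have := h0 (maxn n0 n1) (leq_maxl _ _); have := h1 (maxn n0 n1) (leq_maxr _ _).
have := nm_tri (dsum f (maxn n0 n1) p q) l l'; rewrite [nm (l - dsum _ _ _ _)]nmB; lra.
Qed.
Lemma sintP f p q : has_sint f p q -> dlim f p q (sint f p q).
Proof. by move=> [l hl]; rewrite /sint; exact: (@xgetPex _ 0 [set l | dlim f p q l]%classic (ex_intro _ l hl)). Qed.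
Lemma dlim_sint f p q l : dlim f p q l -> sint f p q = l.
Proof. by move=> h; apply: (@dlim_uniq f p q) => //; apply: sintP; exists l. Qed.

Lemma dlim_lin f g a b p q l l' : dlim f p q l -> dlim g p q l' ->
  dlim (fun z => a * f z + b * g z) p q (a * l + b * l').
Proof.
move=> H H' e e0; have A0 : 0 < nm a + nm b + 1 by have := nm_ge0 a; have := nm_ge0 b; lra.
have e1 : 0 < e / (nm a + nm b + 1) by rewrite divr_gt0.
have [n0 h0] := H _ e1; have [n1 h1] := H' _ e1.
exists (maxn n0 n1) => n; rewrite geq_max => /andP[k0 k1].
rewrite dsum_lin; have -> : a * dsum f n p q + b * dsum g n p q - (a * l + b * l') =
  a * (dsum f n p q - l) + b * (dsum g n p q - l') by ring.
apply: le_trans (nmD _ _) _; rewrite !nmM.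
have i0 := ler_wpM2l (nm_ge0 a) (h0 n k0); have i1 := ler_wpM2l (nm_ge0 b) (h1 n k1).
set x := e / _ in e1 i0 i1; have xE : e = x * (nm a + nm b + 1) by rewrite /x divfK // gt_eqF.
rewrite {h0 h1} xE; lra.
Qed.
Lemma dlim_rev f p q l : dlim f p q l -> dlim f q p (- l).
Proof.
move=> H e /H [n0 h]; exists n0 => n /h; rewrite (dsum_rev _ _ p q).
by have -> : - dsum f n p q - - l = - (dsum f n p q - l); [ring|rewrite nmN].
Qed.
Lemma dlim_mid f p q l l' : dlim f p ((p + q) / 2) l -> dlim f ((p + q) / 2) q l' ->
  dlim f p q (l + l').
Proof.
move=> H H' e e0.
have [n0 h0] := H _ (divr_gt0 e0 (ltr0Sn _ 1)).
have [n1 h1] := H' _ (divr_gt0 e0 (ltr0Sn _ 1)).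
exists (maxn n0 n1).+1 => -[//|n]; rewrite ltnS geq_max => /andP[k0 k1] /=.
set m := (p + q) / 2 in h0 h1 *.
have -> : dsum f n p m + dsum f n m q - (l + l') = (dsum f n p m - l) + (dsum f n m q - l') by ring.
apply: le_trans (nmD _ _) _; have := h0 n k0; have := h1 n k1; lra.
Qed.
Lemma dlim_aff a b p q : dlim (fun z => a + b * z) p q (a * (q - p) + b * (q ^+ 2 - p ^+ 2) / 2).
Proof. by move=> e e0; exists 0%N => n _; rewrite dsum_aff subrr nm0 ltW. Qed.
Lemma dlim_ext f g p q l : (forall n z, dpoint n p q z -> f z = g z) -> dlim f p q l -> dlim g p q l.
Proof. by move=> H h e /h [n0 k]; exists n0 => n /k; rewrite (dsum_ext (H n)). Qed.
Lemma dlim_near f c e p q l : (forall n z, dpoint n p q z -> nm (f z - c) <= e) -> dlim f p q l ->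
  nm (l - c * (q - p)) <= e * nm (q - p).
Proof.
move=> H h; rewrite -subr_le0; apply: le_eps0 => x x0; have [n k] := h _ x0.
have := k n (leqnn n); have := dsum_near (H n); have := nm_tri (dsum f n p q) l (c * (q - p)).
rewrite [nm (l - dsum _ _ _ _)]nmB; lra.
Qed.

Definition contD D f := forall z, D z -> ccont f z.

(** Near a point the continuous [f] is almost constant, and every dyadic sum of a
    constant is exact; where the estimate fails, it fails on one half. *)
Lemma dsum_cauchy D f p q e : region D -> contD D f -> D p -> D q -> 0 < e ->
  exists n0, forall n k, (n0 <= n)%N -> (n0 <= k)%N -> nm (dsum f n p q - dsum f k p q) <= e * nm (q - p).
Proof.
move=> [mD cD] cf Dp Dq e0; apply: contrapT => bad.
pose good x y := exists n0, forall n k, (n0 <= n)%N -> (n0 <= k)%N ->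
  nm (dsum f n x y - dsum f k x y) <= e * nm (y - x).
have [||z Hz] := @bisection (fun x y => [/\ D x, D y & ~ good x y]) p q.
- by split.
- move=> x y [Dx Dy nG]; set m := (x + y) / 2.
  have Dm : D m by exact: mD.
  have [[n0 g0]|g0] := pselect (good x m); last by left.
  have [[n1 g1]|g1] := pselect (good m y); last by right.
  case: nG; exists (maxn n0 n1).+1 => -[//|n] [//|k].
  rewrite !ltnS !geq_max => /andP[a0 a1] /andP[b0 b1] /=; rewrite -/m.
  have := g0 n k a0 b0; have := g1 n k a1 b1; rewrite /= midB1 midB2 nm_half => h1 h2.
  have -> : dsum f n x m + dsum f n m y - (dsum f k x m + dsum f k m y) =
    (dsum f n x m - dsum f k x m) + (dsum f n m y - dsum f k m y) by ring.
  by apply: le_trans (nmD _ _) _; lra.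
- have Dz : D z.
    apply: cD => x x0; have [u [v [[Du _ _] h1 h2]]] := Hz (x / 4) (divr_gt0 x0 (ltr0Sn _ 3)).
    by exists u => //; apply: le_lt_trans h2 _; lra.
  have [/(_ (e / 2) (divr_gt0 e0 (ltr0Sn _ 1))) [d d0 Hd]] := cf _ Dz.
  have [u [v [[Du Dv nG] h1 h2]]] := Hz (d / 6) (divr_gt0 d0 (ltr0Sn _ 5)).
  case: nG; exists 0%N => n k _ _ /=.
  have near_ j : nm (dsum f j u v - f z * (v - u)) <= e / 2 * nm (v - u).
    apply: dsum_near => w /(dpoint_in (@midconvex_ball z (5 * (d / 6)))) hw.
    apply/ltW/Hd; apply: le_lt_trans (hw _ _) _; [lra| |lra].
    by have := nm_tri u v z; lra.
  have := near_ n; have := near_ k; have := nm_tri (f z * (v - u)) (dsum f n u v) (dsum f k u v).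
  by rewrite [nm (f z * _ - dsum f k u v)]nmB; lra.
Qed.

Lemma cauchy_complete (u : nat -> C) :
  (forall e, 0 < e -> exists n0, forall n k, (n0 <= n)%N -> (n0 <= k)%N -> nm (u n - u k) <= e) ->
  exists l, forall e, 0 < e -> exists n0, forall n, (n0 <= n)%N -> nm (u n - l) <= e.
Proof.
move=> H.
have /boolp.choice [N HN] : forall i, exists n0, forall n k,
    (n0 <= n)%N -> (n0 <= k)%N -> nm (u n - u k) <= 1 / 2 ^+ i.
  by move=> i; apply: H; rewrite divr_gt0 // exprn_gt0.
pose M k := (\sum_(i < k.+1) N i)%N.
have NM k : (N k <= M k)%N by rewrite /M big_ord_recr leq_addl.
have MM k : (M k <= M k.+1)%N by rewrite /M [in leqRHS]big_ord_recr leq_addr.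
have [l Hl] := @geo_complete (fun k => u (M k)) 1
  (fun k => HN k _ _ (leq_trans (NM k) (MM k)) (NM k)).
exists l => e e0; have [i hi] := geo_small 5 e0.
exists (M i) => n hn; have := Hl i; have := HN i n (M i) (leq_trans (NM i) hn) (NM i).
have := nm_tri (u (M i)) (u n) l; rewrite mulr1; move: hi; set x := 2 ^+ i.
by have -> : 5 / x = 4 / x + 1 / x; [rewrite -mulrDl; congr (_ / _); ring|lra].
Qed.

Lemma cont_has_sint D f p q : region D -> contD D f -> D p -> D q -> has_sint f p q.
Proof.
move=> rD cf Dp Dq; apply: (@cauchy_complete (fun n => dsum f n p q)) => e e0.
have h0 : 0 < nm (q - p) + 1 by have := nm_ge0 (q - p); lra.
have [n0 H] := dsum_cauchy rD cf Dp Dq (divr_gt0 e0 h0).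
exists n0 => n k hn hk; apply: le_trans (H n k hn hk) _.
by rewrite mulrAC ler_pdivrMr // ler_pM2l // lerDl.
Qed.

Lemma cont_bounded D f p q : region D -> contD D f -> D p -> D q ->
  exists M, forall n z, dpoint n p q z -> nm (f z) <= M.
Proof.
move=> [mD cD] cf Dp Dq; apply: contrapT => bad.
pose good x y := exists M, forall n z, dpoint n x y z -> nm (f z) <= M.
have [||z Hz] := @bisection (fun x y => [/\ D x, D y & ~ good x y]) p q.
- by split.
- move=> x y [Dx Dy nG]; set m := (x + y) / 2.
  have Dm : D m by exact: mD.
  have [[n0 g0]|g0] := pselect (good x m); last by left.
  have [[n1 g1]|g1] := pselect (good m y); last by right.
  case: nG; exists (`|n0| + `|n1| + nm (f m)) => -[|n] w /=.
    by move=> ->; have := normr_ge0 n0; have := normr_ge0 n1; rewrite -/m; lra.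
  have := ler_norm n0; have := ler_norm n1; have := normr_ge0 n0; have := normr_ge0 n1; have := nm_ge0 (f m).
  by move=> ? ? ? ? ? [/g0|/g1]; lra.
- have Dz : D z.
    apply: cD => x x0; have [u [v [[Du _ _] h1 h2]]] := Hz (x / 4) (divr_gt0 x0 (ltr0Sn _ 3)).
    by exists u => //; apply: le_lt_trans h2 _; lra.
  have [/(_ 1 ltr01) [d d0 Hd]] := cf _ Dz.
  have [u [v [[Du Dv nG] h1 h2]]] := Hz (d / 6) (divr_gt0 d0 (ltr0Sn _ 5)).
  case: nG; exists (nm (f z) + 1) => n w /= /(dpoint_in (@midconvex_ball z (5 * (d / 6)))) hw.
  have : nm (f w - f z) < 1.
    apply/Hd; apply: le_lt_trans (hw _ _) _; [lra| |lra].
    by have := nm_tri u v z; lra.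
  by have := nm_subr (f w) (f z); lra.
Qed.

Lemma sint_lin f g a b p q : has_sint f p q -> has_sint g p q ->
  sint (fun z => a * f z + b * g z) p q = a * sint f p q + b * sint g p q.
Proof. by move=> /sintP h /sintP h'; apply/dlim_sint/dlim_lin. Qed.
Lemma sint_rev f p q : has_sint f p q -> sint f q p = - sint f p q.
Proof. by move=> /sintP h; apply/dlim_sint/dlim_rev. Qed.
Lemma sint_mid f p q : has_sint f p ((p + q) / 2) -> has_sint f ((p + q) / 2) q ->
  sint f p q = sint f p ((p + q) / 2) + sint f ((p + q) / 2) q.
Proof. by move=> /sintP h /sintP h'; apply/dlim_sint/dlim_mid. Qed.
Lemma sint_ext f g p q : (forall n z, dpoint n p q z -> f z = g z) -> sint f p q = sint g p q.
Proof.
move=> H; congr xget; apply/seteqP; split=> l /= h; by apply: dlim_ext h => n z /H.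
Qed.
Lemma sint_near f c e p q : has_sint f p q -> (forall n z, dpoint n p q z -> nm (f z - c) <= e) ->
  nm (sint f p q - c * (q - p)) <= e * nm (q - p).
Proof. by move=> /sintP h H; exact: dlim_near h. Qed.
Lemma sint_le f e p q : has_sint f p q -> (forall n z, dpoint n p q z -> nm (f z) <= e) ->
  nm (sint f p q) <= e * nm (q - p).
Proof.
move=> h H; rewrite -[sint _ _ _]subr0 -(mul0r (q - p)); apply: sint_near => // n z /H.
by rewrite subr0.
Qed.
Lemma sint_aff a b p q : sint (fun z => a + b * z) p q = a * (q - p) + b * (q ^+ 2 - p ^+ 2) / 2.
Proof. exact/dlim_sint/dlim_aff. Qed.

Definition tri f a b c : C := sint f a b + sint f b c + sint f c a.
Definition cdiff f z := exists l, is_cder f z l.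

Lemma cdiff_cont f z : cdiff f z -> ccont f z.
Proof. by move=> [l] /is_cder_cont. Qed.

Lemma tri_split D f a b c : region D -> contD D f -> D a -> D b -> D c ->
  tri f a b c = tri f a ((a + b) / 2) ((c + a) / 2) + tri f ((a + b) / 2) b ((b + c) / 2)
    + tri f ((c + a) / 2) ((b + c) / 2) c + tri f ((b + c) / 2) ((c + a) / 2) ((a + b) / 2).
Proof.
move=> rD cf Da Db Dc.
have ok p q : D p -> D q -> has_sint f p q by exact: cont_has_sint.
have [mD _] := rD.
have [Dab Dbc Dca] : [/\ D ((a + b) / 2), D ((b + c) / 2) & D ((c + a) / 2)] by split; apply: mD.
rewrite /tri (sint_mid (ok _ _ Da Dab) (ok _ _ Dab Db)) (sint_mid (ok _ _ Db Dbc) (ok _ _ Dbc Dc))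
  (sint_mid (ok _ _ Dc Dca) (ok _ _ Dca Da)).
rewrite (sint_rev (ok _ _ Dca Dbc)) (sint_rev (ok _ _ Dab Dca)) (sint_rev (ok _ _ Dbc Dab)).
ring.
Qed.

Lemma tri_aff a b p q (r : C) : tri (fun z => a + b * z) p q r = 0.
Proof. by rewrite /tri !sint_aff; field. Qed.

Lemma tri_lin f g a b p q (r : C) : has_sint f p q -> has_sint f q r -> has_sint f r p ->
  has_sint g p q -> has_sint g q r -> has_sint g r p ->
  tri (fun z => a * f z + b * g z) p q r = a * tri f p q r + b * tri g p q r.
Proof. by move=> *; rewrite /tri !sint_lin //; ring. Qed.

Definition perim a b c : R := nm (b - a) + nm (c - b) + nm (a - c).

Lemma perim_half a b c a' b' c' : b' - a' = (b - a) / 2 -> c' - b' = (c - b) / 2 ->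
  a' - c' = (a - c) / 2 -> perim a' b' c' = perim a b c / 2.
Proof. by rewrite /perim => -> -> ->; rewrite !nm_half; field. Qed.

(** Goursat's argument: midpoint subdivision, and affine functions integrate to
    zero over triangles. *)
Lemma goursat D f a b c : region D -> (forall z, D z -> cdiff f z) ->
  D a -> D b -> D c -> tri f a b c = 0.
Proof.
move=> rD df Da Db Dc; have [mD cD] := rD.
have cf : contD D f by move=> z /df /cdiff_cont.
have ok p q : D p -> D q -> has_sint f p q by exact: cont_has_sint.
apply: nm_eps0 => e0 e0_gt; rewrite leNgt; apply/negP => bad0.
have perim_ge x y z : 0 <= perim x y z by rewrite /perim !addr_ge0 ?nm_ge0.
(* The defect is measured against the squared perimeter, which is divided by
   four at each step. *)
pose e := e0 / (perim a b c ^+ 2 + 1).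
have P0 : 0 < perim a b c ^+ 2 + 1 by have := sqr_ge0 (perim a b c); lra.
have e_gt : 0 < e by rewrite divr_gt0.
have bad : e * perim a b c ^+ 2 < nm (tri f a b c).
  by apply: le_lt_trans bad0; rewrite /e mulrAC ler_pdivrMr // ler_pM2l // lerDl.
pose T3 := (C * C * C)%type.
have [||z Hz] := @nested_cells T3 (fun x => [/\ D x.1.1, D x.1.2, D x.2 &
     e * perim x.1.1 x.1.2 x.2 ^+ 2 < nm (tri f x.1.1 x.1.2 x.2)])
   (fun x => x.1.1) (fun x => perim x.1.1 x.1.2 x.2) (a, b, c).
- by split.
- move=> [[x y] z] [/= Dx Dy Dz].
  have [Dab Dbc Dca] : [/\ D ((x + y) / 2), D ((y + z) / 2) & D ((z + x) / 2)] by split; apply: mD.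
  rewrite (tri_split rD cf Dx Dy Dz).
  set p := (x + y) / 2 in Dab *; set q := (y + z) / 2 in Dbc *; set r := (z + x) / 2 in Dca *.
  have Pxy : nm (y - x) / 2 <= perim x y z.
    by rewrite /perim; have := nm_ge0 (y - x); have := nm_ge0 (z - y); have := nm_ge0 (x - z); lra.
  have Pxz : nm (x - z) / 2 <= perim x y z.
    by rewrite /perim; have := nm_ge0 (y - x); have := nm_ge0 (z - y); have := nm_ge0 (x - z); lra.
  have e1 : perim x p r = perim x y z / 2 by apply: perim_half; rewrite /p /q /r; field.
  have e2 : perim p y q = perim x y z / 2 by apply: perim_half; rewrite /p /q /r; field.
  have e3 : perim r q z = perim x y z / 2 by apply: perim_half; rewrite /p /q /r; field.
  have e4 : perim q r p = perim x y z / 2.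
    rewrite /perim (nmB r) (nmB p) (nmB q p).
    have -> : q - r = (y - x) / 2 by rewrite /q /r; field.
    have -> : r - p = (z - y) / 2 by rewrite /p /r; field.
    have -> : p - q = (x - z) / 2 by rewrite /p /q; field.
    by rewrite !nm_half; field.
  have [h1|h1] := ltP (e * perim x p r ^+ 2) (nm (tri f x p r)).
    by exists (x, p, r); split=> //=; rewrite subrr nm0.
  have [h2|h2] := ltP (e * perim p y q ^+ 2) (nm (tri f p y q)).
    by exists (p, y, q); split=> //=; rewrite /p midB1 nm_half.
  have [h3|h3] := ltP (e * perim r q z ^+ 2) (nm (tri f r q z)).
    exists (r, q, z); split=> //=; rewrite /r.
    by have -> : (z + x) / 2 - x = - ((x - z) / 2); [field|rewrite nmN nm_half].
  have [h4|h4] := ltP (e * perim q r p ^+ 2) (nm (tri f q r p)).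
    exists (q, r, p); split=> //=; rewrite /q.
    have -> : (y + z) / 2 - x = (y - x) / 2 - (x - z) / 2 by field.
    by apply: le_trans (nmD _ _) _; rewrite nmN !nm_half /perim;
      have := nm_ge0 (y - x); have := nm_ge0 (z - y); have := nm_ge0 (x - z); lra.
  move=> h; exfalso; move: h1 h2 h3 h4; rewrite e1 e2 e3 e4.
  have := nmD (tri f x p r + tri f p y q + tri f r q z) (tri f q r p).
  have := nmD (tri f x p r + tri f p y q) (tri f r q z).
  have := nmD (tri f x p r) (tri f p y q).
  rewrite expr_div_n; set P := perim x y z ^+ 2 in h *.
  by have -> : P / 2 ^+ 2 = P / 4; [congr (_ / _); ring|lra].
have Dz : D z.
  apply: cD => x x0; have [[[u v] t] [[/= Du _ _ _] h1 h2]] := Hz (x / 4) (divr_gt0 x0 (ltr0Sn _ 3)).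
  by exists u => //; move: h1 h2; rewrite /=; lra.
have [l [Hl]] := df _ Dz.
have e6 : 0 < e / 6 by rewrite divr_gt0.
have [d d0 Hd] := Hl _ e6.
have [[[u v] t] [[/= Du Dv Dt nG] h1 h2]] := Hz (d / 6) (divr_gt0 d0 (ltr0Sn _ 5)).
set P := perim u v t in nG h1 h2.
have sides : [/\ nm (v - u) <= P, nm (t - v) <= P & nm (u - t) <= P].
  by rewrite /P /perim; have := nm_ge0 (v - u); have := nm_ge0 (t - v); have := nm_ge0 (u - t); split; lra.
have [s1 s2 s3] := sides.
have Bu : nm (u - z) <= 5 * P by have := perim_ge u v t; rewrite -/P; lra.
have Bv : nm (v - z) <= 5 * P by have := nm_tri u v z; lra.
have Bt : nm (t - z) <= 5 * P by have := nm_tri u t z; rewrite [nm (t - u)]nmB; lra.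
(* Subtract from [f] its tangent at the limit point. *)
pose g := fun w => 1 * f w + (-1) * ((f z - l * z) + l * w).
have gE : tri g u v t = tri f u v t.
  have aff p q : has_sint (fun w => (f z - l * z) + l * w) p q by eexists; exact: dlim_aff.
  by rewrite /g tri_lin ?tri_aff //; [ring|apply: ok..].
have okg p q : D p -> D q -> has_sint g p q.
  move=> Dp Dq; apply: (@cont_has_sint D) => // w Dw; rewrite /g.
  apply: ccontD; apply: ccontM; first exact: ccont_cst.
  - exact: cf.
  - exact: ccont_cst.
  - apply: ccontD; first exact: ccont_cst.
    by apply: ccontM; [exact: ccont_cst|exact: ccont_id].
have bnd p q : D p -> D q -> nm (p - z) <= 5 * P -> nm (q - z) <= 5 * P ->
    nm (sint g p q) <= e / 6 * (5 * P) * nm (q - p).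
  move=> Dp Dq Bp Bq; apply: sint_le; first exact: okg.
  move=> n w /(dpoint_in (@midconvex_ball z (5 * P)) Bp Bq) hw.
  have := Hd (w - z) ltac:(by move: h1; rewrite /=; lra).
  rewrite [z + _]addrC subrK => h; have -> : g w = f w - f z - (w - z) * l by rewrite /g; ring.
  by apply: le_trans h _; rewrite ler_pM2l.
suff : nm (tri g u v t) <= e * P ^+ 2 by rewrite gE; lra.
rewrite /tri; have := nmD (sint g u v + sint g v t) (sint g t u); have := nmD (sint g u v) (sint g v t).
have := bnd u v Du Dv Bu Bv; have := bnd v t Dv Dt Bv Bt; have := bnd t u Dt Du Bt Bu.
have PE : e / 6 * (5 * P) * nm (v - u) + e / 6 * (5 * P) * nm (t - v) + e / 6 * (5 * P) * nm (u - t) = 5 / 6 * (e * P ^+ 2).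
  by rewrite -!mulrDr -/(perim u v t) -/P; field.
have : 0 <= e * P ^+ 2 by rewrite mulr_ge0 ?sqr_ge0 // ltW.
lra.
Qed.

(** One exceptional vertex [w] is harmless: three of the four triangles of the
    midpoint subdivision avoid it, and the fourth shrinks to it.  The half-plane
    given by [u] separates [w] from these three triangles. *)
Lemma tri_vertex D f w p q u : region D -> contD D f ->
  (forall z, D z -> z != w -> cdiff f z) ->
  D w -> D p -> D q -> 0 < Rez (u * (p - w)) -> 0 < Rez (u * (q - w)) -> tri f w p q = 0.
Proof.
move=> rD cf df Dw Dp Dq up uq; have [mD cD] := rD.
have step x y : D x -> D y -> 0 < Rez (u * (x - w)) -> 0 < Rez (u * (y - w)) ->
    tri f w x y = tri f w ((w + x) / 2) ((w + y) / 2).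
  move=> Dx Dy ux uy; rewrite (tri_split rD cf Dw Dx Dy).
  pose m := Num.min (Rez (u * (x - w))) (Rez (u * (y - w))).
  have m0 : 0 < m by rewrite lt_min ux.
  have [mx my] : m <= Rez (u * (x - w)) /\ m <= Rez (u * (y - w)) by rewrite !ge_min !lexx orbT.
  pose D' z := D z /\ m / 2 + Rez (u * w) <= Rez (u * z).
  have rD' : region D' by apply: regionI => //; exact: region_half.
  have df' z : D' z -> cdiff f z.
    by move=> [Dz hz]; apply: df => //; apply/negP => /eqP zw; rewrite zw in hz; lra.
  have R2 s t : Rez (u * ((s + t) / 2)) = (Rez (u * s) + Rez (u * t)) / 2.
    have -> : u * ((s + t) / 2) = rc (1 / 2) * (u * s + u * t).
      by rewrite rcM rcV rc_nat rc1; field.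
    by rewrite RezM Rez_r Imz_r RezD; field.
  have RB s : Rez (u * (s - w)) = Rez (u * s) - Rez (u * w) by rewrite mulrBr RezD RezN.
  rewrite !RB in mx my.
  have Dx' : D' x by split => //; lra.
  have Dy' : D' y by split => //; lra.
  have Dwx : D' ((w + x) / 2) by split; [exact: mD|rewrite R2; lra].
  have Dxy : D' ((x + y) / 2) by split; [exact: mD|rewrite R2; lra].
  have Dyw : D' ((y + w) / 2) by split; [exact: mD|rewrite R2; lra].
  rewrite (goursat rD' df' Dwx Dx' Dxy) (goursat rD' df' Dyw Dxy Dy') (goursat rD' df' Dxy Dyw Dwx).
  by rewrite !addr0 (addrC y w).
pose pn n := w + (p - w) / 2 ^+ n; pose qn n := w + (q - w) / 2 ^+ n.
have p2 n : (2 ^+ n : C) != 0 by rewrite expf_neq0.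
have stn (x : C) n : w + (x - w) / 2 ^+ n.+1 = (w + (w + (x - w) / 2 ^+ n)) / 2.
  by rewrite exprS; field.
have pn_pos (x : C) n : D x -> 0 < Rez (u * (x - w)) ->
    D (w + (x - w) / 2 ^+ n) /\ 0 < Rez (u * (w + (x - w) / 2 ^+ n - w)).
  move=> Dx ux; split.
    elim: n => [|n IH]; first by rewrite expr0 divr1 addrC subrK.
    by rewrite stn; exact: mD.
  have -> : u * (w + (x - w) / 2 ^+ n - w) = rc (2 ^+ n)^-1 * (u * (x - w)).
    by rewrite rcV rcX rc_nat; field.
  by rewrite RezM Rez_r Imz_r mul0r subr0 mulr_gt0 // invr_gt0 exprn_gt0.
have triE n : tri f w p q = tri f w (pn n) (qn n).
  elim: n => [|n ->]; first by rewrite /pn /qn !expr0 !divr1 !(addrC w) !subrK.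
  have [Dpn upn] := pn_pos p n Dp up; have [Dqn uqn] := pn_pos q n Dq uq.
  by rewrite step // /pn /qn !stn.
have [/(_ 1 ltr01) [d d0 Hd]] := cf _ Dw.
pose P := perim w p q; have P0 : 0 <= P by rewrite /P /perim !addr_ge0 ?nm_ge0.
apply: nm_eps0 => e e0.
pose M := nm (f w) + 1; have M0 : 0 < M by rewrite /M; have := nm_ge0 (f w); lra.
have [n hn] := @geo_small P (Num.min d (e / M)) ltac:(by rewrite lt_min d0 divr_gt0).
move: hn; rewrite lt_min => /andP[hn1 hn2].
have [Dpn _] := pn_pos p n Dp up; have [Dqn _] := pn_pos q n Dq uq.
have n2 : nm (2 ^+ n : C) = 2 ^+ n by rewrite nmX nm2.
have pw : nm (pn n - w) = nm (p - w) / 2 ^+ n by rewrite /pn addrC addKr nmM nmV n2.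
have qw : nm (qn n - w) = nm (q - w) / 2 ^+ n by rewrite /qn addrC addKr nmM nmV n2.
have qp : nm (qn n - pn n) = nm (q - p) / 2 ^+ n.
  by have -> : qn n - pn n = (q - p) / 2 ^+ n; [rewrite /pn /qn; field|rewrite nmM nmV n2].
have g2 : 0 < 2 ^+ n :> R by rewrite exprn_gt0.
have lp : nm (pn n - w) < d.
  rewrite pw; apply: le_lt_trans hn1; rewrite ler_pdivrMr // divfK ?gt_eqF //.
  by rewrite /P /perim; have := nm_ge0 (q - p); have := nm_ge0 (w - q); lra.
have lq : nm (qn n - w) < d.
  rewrite qw; apply: le_lt_trans hn1; rewrite ler_pdivrMr // divfK ?gt_eqF //.
  by rewrite /P /perim; have := nm_ge0 (q - p); have := nm_ge0 (p - w); rewrite (nmB w q); lra.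
have d' : exists2 d', d' < d & nm (pn n - w) <= d' /\ nm (qn n - w) <= d'.
  exists (Num.max (nm (pn n - w)) (nm (qn n - w))); first by rewrite gt_max lp.
  by rewrite !le_max !lexx orbT.
have [d1 d1d [lp1 lq1]] := d'.
have lw1 : nm (w - w) <= d1 by rewrite subrr nm0 (le_trans _ lp1) // nm_ge0.
have ok x y : D x -> D y -> nm (x - w) <= d1 -> nm (y - w) <= d1 -> nm (sint f x y) <= M * nm (y - x).
  move=> Dx Dy hx hy; apply: sint_le; first exact: (cont_has_sint rD).
  move=> k z /(dpoint_in (@midconvex_ball w d1) hx hy) hz.
  by have := Hd z (le_lt_trans hz d1d); have := nm_subr (f z) (f w); rewrite /M; lra.
rewrite (triE n) /tri.
have := nmD (sint f w (pn n) + sint f (pn n) (qn n)) (sint f (qn n) w); have := nmD (sint f w (pn n)) (sint f (pn n) (qn n)).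
have := ok w (pn n) Dw Dpn lw1 lp1; have := ok _ _ Dpn Dqn lp1 lq1; have := ok _ _ Dqn Dw lq1 lw1.
rewrite (nmB w) pw qw qp.
have : M * (P / 2 ^+ n) <= e by rewrite mulrC -ler_pdivlMr // ltW.
have -> : M * (P / 2 ^+ n) = M * (nm (q - w) / 2 ^+ n) + M * (nm (q - p) / 2 ^+ n) + M * (nm (p - w) / 2 ^+ n).
  by rewrite /P /perim (nmB w q); field; rewrite gt_eqF.
lra.
Qed.
End Goursat.

(** * Cauchy's formula on a square and its consequences *)
Section Square.
Variable R : realType.
Notation C := (Cplx R).
Implicit Types (f g h : C -> C) (z w a b c l p q : C) (e d r s : R) (D : C -> Prop).

(** The square with sides at distance [s] from its centre [a], its corners being
    numbered cyclically by powers of ['i].  [side] is a convex region that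
    contains one side and not the centre, [bdry] an annulus that contains the whole
    contour; both stand for the points of the contour in estimates. *)
Definition corner a s k : C := a + rc s * ('i ^+ k * (1 - 'i)).
Definition oint f a s : C := \sum_(k < 4) sint f (corner a s k) (corner a s k.+1).
Definition bdry a s z := s <= nm (z - a) /\ nm (z - a) <= 2 * s.
Definition side a s (k : nat) z :=
  s + Rez ((- 'i) ^+ k * a) <= Rez ((- 'i) ^+ k * z) /\ nm (z - a) <= 2 * s.

Lemma nmi : nm ('i : C) = 1.
Proof. by apply/eqP; rewrite -(@eqrXn2 _ 2) ?nm_ge0 // nm_sqr Rezi Imzi expr0n add0r. Qed.
Lemma iNi k : ((- 'i) ^+ k * 'i ^+ k : C) = 1.
Proof. by rewrite -exprMn mulNr -expr2 sqrCi opprK expr1n. Qed.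

Lemma side_region a s k : region (side a s k).
Proof. by apply: regionI; [exact: region_half|exact: region_ball]. Qed.
Lemma side_bdry a s k z : side a s k z -> bdry a s z.
Proof.
move=> [h1 h2]; split=> //; have := Re_le_nm ((- 'i) ^+ k * (z - a)).
rewrite nmM nmX nmN nmi expr1n mul1r mulrBr RezD RezN ler_norml; lra.
Qed.
Lemma side_corner0 a s k : 0 < s -> side a s k (corner a s k).
Proof.
move=> s0; rewrite /corner; split.
  have -> : (- 'i) ^+ k * (a + rc s * ('i ^+ k * (1 - 'i))) = (- 'i) ^+ k * a + rc s * (1 - 'i) * ((- 'i) ^+ k * 'i ^+ k) by ring.
  by rewrite iNi mulr1 RezD RezM RezD RezN Rezi Rez_r Imz_r -rc1 Rez_r; lra.
rewrite addrC addKr !nmM nmX nmi expr1n mul1r nm_real gtr0_norm // mulrC ler_pM2r //.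
by apply: le_trans (nmD _ _) _; rewrite nmN nmi nm1.
Qed.
Lemma side_corner1 a s k : 0 < s -> side a s k (corner a s k.+1).
Proof.
move=> s0; rewrite /corner; split.
  have -> : (- 'i) ^+ k * (a + rc s * ('i ^+ k.+1 * (1 - 'i))) = (- 'i) ^+ k * a + rc s * ('i - 'i ^+ 2) * ((- 'i) ^+ k * 'i ^+ k) by rewrite !exprS; ring.
  rewrite iNi mulr1 sqrCi RezD RezM RezD RezN Rezi Rez_r Imz_r RezN -rc1 Rez_r; lra.
rewrite addrC addKr !nmM nmX nmi expr1n mul1r nm_real gtr0_norm // mulrC ler_pM2r //.
by apply: le_trans (nmD _ _) _; rewrite nmN nmi nm1.
Qed.
Lemma corner_len a s k : 0 < s -> nm (corner a s k.+1 - corner a s k) = 2 * s.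
Proof.
move=> s0; have -> : corner a s k.+1 - corner a s k = rc s * 'i ^+ k * (2 * 'i - (1 + 'i ^+ 2)).
  by rewrite /corner exprS; ring.
rewrite sqrCi subrr subr0 !nmM nmX nmi expr1n nm_real gtr0_norm // nm2; ring.
Qed.
Lemma corner4 a s : corner a s 4 = corner a s 0.
Proof. by rewrite /corner (_ : 4%N = (2 * 2)%N) // exprM sqrCi expr0 expr2 mulrNN mulr1. Qed.

Definition bcont g a s := forall z, bdry a s z -> ccont g z.

Lemma side_ok g a s k : 0 < s -> bcont g a s -> has_sint g (corner a s k) (corner a s k.+1).
Proof.
move=> s0 H; apply: (cont_has_sint (@side_region a s k)); last 2 first.
- exact: side_corner0.
- exact: side_corner1.
by move=> z /side_bdry /H.
Qed.
Lemma side_dpoint a s k n z : 0 < s -> dpoint n (corner a s k) (corner a s k.+1) z -> bdry a s z.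
Proof.
move=> s0 /(dpoint_in (proj1 (@side_region a s k)) (side_corner0 a k s0) (side_corner1 a k s0)).
exact: side_bdry.
Qed.

Lemma oint_lin g h b c a s : 0 < s -> bcont g a s -> bcont h a s ->
  oint (fun z => b * g z + c * h z) a s = b * oint g a s + c * oint h a s.
Proof.
move=> s0 cg ch; rewrite /oint !mulr_sumr -big_split /=; apply: eq_bigr => k _.
by rewrite sint_lin //; exact: side_ok.
Qed.
Lemma oint_ext g h a s : 0 < s -> (forall z, bdry a s z -> g z = h z) -> oint g a s = oint h a s.
Proof. by move=> s0 H; apply: eq_bigr => k _; apply: sint_ext => n z /side_dpoint -/(_ s0) /H. Qed.

(** The constant depends on [g] only, so that it serves for all integrands
    dominated by [g]. *)
Lemma oint_dom g a s : 0 < s -> bcont g a s -> exists2 M, 0 <= M &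
  forall h (K : R), 0 <= K -> bcont h a s -> (forall z, bdry a s z -> nm (h z) <= K * nm (g z)) ->
  nm (oint h a s) <= K * M.
Proof.
move=> s0 cg.
have /boolp.choice [M HM] : forall k : 'I_4, exists M, forall n z,
    dpoint n (corner a s k) (corner a s k.+1) z -> nm (g z) <= M.
  move=> k; apply: (cont_bounded (@side_region a s k)); last 2 first.
  - exact: side_corner0.
  - exact: side_corner1.
  by move=> z /side_bdry /cg.
exists (\sum_(k < 4) `|M k| * (2 * s)).
  by apply: sumr_ge0 => k _; rewrite !mulr_ge0 // ltW.
move=> h K K0 ch H; rewrite /oint mulr_sumr.
have nms (I : Type) (t : seq I) (F : I -> C) : nm (\sum_(i <- t) F i) <= \sum_(i <- t) nm (F i).
  elim: t => [|x t IH]; first by rewrite !big_nil nm0.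
  by rewrite !big_cons; apply: le_trans (nmD _ _) _; rewrite lerD2l.
apply: le_trans (nms _ _ _) _; apply: ler_sum => k _.
rewrite mulrA -(corner_len a k s0); apply: sint_le; first exact: side_ok.
move=> n z hz; apply: le_trans (H z (side_dpoint s0 hz)) _; rewrite ler_wpM2l //.
by apply: le_trans (HM k n z hz) _; exact: ler_norm.
Qed.

Lemma oint_le h e a s : 0 < s -> bcont h a s -> (forall z, bdry a s z -> nm (h z) <= e) ->
  nm (oint h a s) <= 8 * s * e.
Proof.
move=> s0 ch H; rewrite /oint !big_ord_recr big_ord0 /= add0r.
have B k : nm (sint h (corner a s k) (corner a s k.+1)) <= e * (2 * s).
  rewrite -(corner_len a k s0); apply: sint_le; first exact: side_ok.
  by move=> n z /(side_dpoint s0) /H.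
have := B 0%N; have := B 1%N; have := B 2%N; have := B 3%N.
set x0 := sint _ _ _; set x1 := sint _ _ _; set x2 := sint _ _ _; set x3 := sint _ _ _ => b0 b1 b2 b3.
have := nmD (x3 + x2 + x1) x0; have := nmD (x3 + x2) x1; have := nmD x3 x2.
have -> : 8 * s * e = 4 * (e * (2 * s)) by ring.
lra.
Qed.

Lemma sint_ext_dsum f g p q p' q' : (forall n, dsum f n p q = dsum g n p' q') -> sint f p q = sint g p' q'.
Proof.
move=> H; congr xget; apply/seteqP; split=> l /= h e /h [n0 k]; exists n0 => n /k.
  by rewrite H.
by rewrite -H.
Qed.

(** A lower bound replaces the value of the winding integral.  By rotation and
    scaling the four sides contribute equally, and on the side from [1 - 'i] to
    [1 + 'i] the function [z^-1] stays within [5/8] of [3/4]. *)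
Lemma winding_ge1 a s : 0 < s -> 1 <= nm (oint (fun z => (z - a)^-1) a s).
Proof.
move=> s0.
have E k : sint (fun z => (z - a)^-1) (corner a s k) (corner a s k.+1) = sint (fun z => z^-1) (1 - 'i) (1 + 'i).
  apply: sint_ext_dsum => n.
  have -> : corner a s k.+1 = a + (rc s * 'i ^+ k) * (1 + 'i).
    have -> : (1 + 'i : C) = 'i - 'i ^+ 2 by rewrite sqrCi; ring.
    by rewrite /corner exprS; ring.
  have -> : corner a s k = a + (rc s * 'i ^+ k) * (1 - 'i) by rewrite /corner; ring.
  rewrite dsum_scale; set c := rc s * _.
  have c0 : c != 0.
    by rewrite -nm_eq0 nmM nmX nmi expr1n mulr1 nm_real gtr0_norm // gt_eqF.
  have -> : dsum (fun z => (a + c * z - a)^-1) n (1 - 'i) (1 + 'i)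
     = dsum (fun z => c^-1 * z^-1 + 0 * z^-1) n (1 - 'i) (1 + 'i).
    by apply: dsum_ext => z _; rewrite mul0r addr0 -invfM; congr (_^-1); ring.
  by rewrite dsum_lin mul0r addr0 mulrA divff // mul1r.
rewrite /oint (eq_bigr (fun=> sint (fun z => z^-1) (1 - 'i) (1 + 'i))) // sumr_const card_ord.
rewrite -mulr_natl nmM nm_nat.
pose D (z : C) := Rez z = 1 /\ -1 <= Imz z <= 1.
have mD : midconvex D.
  move=> p q [p1 p2] [q1 q2]; have -> : (p + q) / 2 = rc (1 / 2) * (p + q).
    by rewrite rcM rcV rc_nat rc1; field.
  by rewrite /D RezM ImzM Rez_r Imz_r RezD ImzD p1 q1; lra.
have D0 : D (1 - 'i) by rewrite /D -rc1 RezD ImzD RezN ImzN Rez_r Imz_r Rezi Imzi; lra.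
have D1 : D (1 + 'i) by rewrite /D -rc1 RezD ImzD Rez_r Imz_r Rezi Imzi; lra.
have Dn z : D z -> z != 0.
  by move=> [h _]; apply/negP => /eqP z0; move: h; rewrite z0 -rc0 Rez_r => /esym/eqP; rewrite oner_eq0.
have ok : has_sint (fun z : C => z^-1) (1 - 'i) (1 + 'i).
  pose u1 : C := 1.
  have rH : region (fun z : C => 1 <= Rez (u1 * z)) by exact: region_half.
  apply: (cont_has_sint rH).
  - move=> z; rewrite /u1 mul1r => hz; apply: (@ccontV _ id); last exact: ccont_id.
    by apply/negP => /eqP z0; move: hz; rewrite z0 -rc0 Rez_r; lra.
  - by rewrite /u1 mul1r (proj1 D0).
  - by rewrite /u1 mul1r (proj1 D1).
have := @sint_near _ (fun z => z^-1) (rc (3 / 4)) (5 / 8) (1 - 'i) (1 + 'i) ok.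
have -> : (1 + 'i - (1 - 'i) : C) = 2 * 'i by ring.
rewrite nmM nm2 nmi mulr1 => H.
have {}H : nm (sint (fun z => z^-1) (1 - 'i) (1 + 'i) - rc (3 / 4) * (2 * 'i)) <= 5 / 8 * 2.
  apply: H => n z /(dpoint_in mD D0 D1) Dz; have z0 := Dn _ Dz.
  have -> : z^-1 - rc (3 / 4) = (1 - rc (3 / 4) * z) / z by field.
  rewrite nmM nmV ler_pdivrMr ?nm_gt0 //.
  rewrite -(@ler_pXn2r _ 2) ?nnegrE ?nm_ge0 ?mulr_ge0 ?nm_ge0 // exprMn !nm_sqr.
  have [h1 /andP[h2 h3]] := Dz.
  rewrite RezD RezN ImzD ImzN RezM ImzM Rez_r Imz_r h1 -rc1 Rez_r Imz_r.
  have : Imz z ^+ 2 <= 1 by rewrite expr2; nra.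
  nra.
have := nm_subr (rc (3 / 4) * (2 * 'i)) (sint (fun z => z^-1) (1 - 'i) (1 + 'i)).
rewrite nmB nmM nmM nm2 nmi nm_real ger0_norm; lra.
Qed.

Lemma bdry_neq a s w z : nm (w - a) < s -> bdry a s z -> z - w != 0.
Proof. by move=> h [h1 _]; rewrite subr_eq0; apply/negP => /eqP zw; rewrite zw in h1; lra. Qed.
Lemma bcont_quot g a s w : nm (w - a) < s -> bcont g a s -> bcont (fun z => g z / (z - w)) a s.
Proof.
move=> h cg z hz; apply: ccontM; first exact: cg.
apply: (@ccontV _ (fun z => z - w)); first exact: bdry_neq hz.
by apply: ccontD; [exact: ccont_id|exact: ccont_cst].
Qed.
Lemma bcont1 a s : bcont (fun=> 1) a s.
Proof. by move=> z _; exact: ccont_cst. Qed.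

Definition Phi g a s w := oint (fun z => g z / (z - w)) a s.

Definition cdiff_ball f a r := forall z, nm (z - a) <= r -> cdiff f z.

Lemma is_cder_subid a z : is_cder (fun w => w - a) z 1.
Proof.
by have := is_cderD (is_cder_id z) (is_cder_cst (- a) z); rewrite addr0.
Qed.

Lemma quot_diff f a z b : z != a -> cdiff f z -> cdiff (fun w => (f w - b) / (w - a)) z.
Proof.
move=> za [l hl]; eexists; apply: is_cderM.
  by apply: (is_cderD hl); exact: is_cder_cst.
by apply: is_cderV; [rewrite subr_eq0|exact: is_cder_subid].
Qed.

Lemma cdiff_near f g z : (exists2 e, 0 < e & forall w, nm (w - z) < e -> f w = g w) ->
  cdiff f z -> cdiff g z.
Proof. by move=> H [l hl]; exists l; exact: is_cder_ext hl. Qed.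

Lemma car_quot f a (p : C -> C) : (forall z, f z = f a + (z - a) * p z) ->
  forall z, z != a -> p z = (f z - f a) / (z - a).
Proof.
move=> H z za; have z0 : z - a != 0 by rewrite subr_eq0.
rewrite [in RHS]H; have -> : f a + (z - a) * p z - f a = p z * (z - a) by ring.
by rewrite mulfK.
Qed.

Lemma car_diff f a (p : C -> C) z : (forall z, f z = f a + (z - a) * p z) ->
  z != a -> cdiff f z -> cdiff p z.
Proof.
move=> H za hf; apply: cdiff_near (quot_diff (f a) za hf).
exists (nm (z - a)); first by rewrite nm_gt0 subr_eq0.
move=> w hw; rewrite (car_quot H) //; apply/negP => /eqP wa; move: hw.
by rewrite wa nmB ltxx.
Qed.

(** The difference quotient of [f] at [w] is differentiable except at [w], hence
    integrates to zero over each triangle formed by [w] and a side.  The winding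
    integral [Phi (fun=> 1) a s w] is kept as an unevaluated factor. *)
Lemma cauchy_formula f a s w : 0 < s -> cdiff_ball f a (2 * s) -> nm (w - a) < s ->
  f w * Phi (fun=> 1) a s w = Phi f a s w.
Proof.
move=> s0 hf hw.
have [l hl] := hf w ltac:(lra).
have /is_cder_car [p [cp pw fE]] := hl.
pose D z := nm (z - a) <= 2 * s.
have rD : region D by exact: region_ball.
have dp z : D z -> z != w -> cdiff p z by move=> Dz zw; exact: (car_diff fE zw (hf z Dz)).
have cpD : contD D p.
  by move=> z Dz; have [->//|zw] := eqVneq z w; exact: cdiff_cont (dp z Dz zw).
have Dc k : D (corner a s k) by have [] := side_corner0 a k s0.
have Dw : D w by rewrite /D; lra.
have T k : tri p w (corner a s k) (corner a s k.+1) = 0.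
  have RB u z : Rez (u * (z - w)) = Rez (u * z) - Rez (u * a) - Rez (u * (w - a)).
    by rewrite !mulrBr !RezD !RezN; ring.
  have Rw : Rez ((- 'i) ^+ k * (w - a)) < s.
    apply: le_lt_trans hw; have := Re_le_nm ((- 'i) ^+ k * (w - a)).
    by rewrite nmM nmX nmN nmi expr1n mul1r ler_norml => /andP[].
  apply: (tri_vertex (u := (- 'i) ^+ k) rD cpD dp) => //; rewrite RB.
    by have [h _] := side_corner0 a k s0; lra.
  by have [h _] := side_corner1 a k s0; lra.
have ok x y : D x -> D y -> has_sint p x y by exact: (cont_has_sint rD cpD).
have O : oint p a s = 0.
  have Jk k : sint p (corner a s k) (corner a s k.+1) = sint p w (corner a s k.+1) - sint p w (corner a s k).
    have := T k; rewrite /tri (sint_rev (ok _ _ Dw (Dc k.+1))) => h.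
    by apply/eqP; rewrite -subr_eq0 -h; apply/eqP; ring.
  by rewrite /oint !big_ord_recr big_ord0 /= !Jk corner4; ring.
have E : oint p a s = 1 * Phi f a s w + (- f w) * Phi (fun=> 1) a s w.
  have cf : bcont f a s by move=> z [_ hz]; apply: cdiff_cont; exact: hf.
  rewrite -oint_lin //; [|exact: bcont_quot|by apply: bcont_quot => //; exact: bcont1].
  apply: oint_ext => // z hz; have zw := bdry_neq hw hz.
  rewrite (car_quot fE); first by field.
  by rewrite -subr_eq0.
by apply/eqP; rewrite -subr_eq0; move: O; rewrite E mul1r mulNr => /eqP; rewrite addrC -oppr_eq0 opprD opprK.
Qed.

(** A maximum principle up to a constant: Cauchy's formula at the centre, with the
    winding integral bounded below. *)
Lemma center_bound f a s M : 0 < s -> cdiff_ball f a (2 * s) ->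
  (forall z, bdry a s z -> nm (f z) <= M) -> nm (f a) <= 8 * M.
Proof.
move=> s0 hf H.
have aa : nm (a - a) < s by rewrite subrr nm0.
have := cauchy_formula s0 hf aa => E.
have W : 1 <= nm (Phi (fun=> 1) a s a).
  have -> : Phi (fun=> 1) a s a = oint (fun z => (z - a)^-1) a s.
    by apply: oint_ext => // z _; rewrite mul1r.
  exact: winding_ge1.
have cf : bcont f a s by move=> z [_ hz]; apply: cdiff_cont; exact: hf.
have B : nm (Phi f a s a) <= 8 * s * (M / s).
  apply: oint_le => //; first exact: bcont_quot.
  move=> z hz; rewrite nmM nmV; have [h1 _] := hz.
  have z0 : 0 < nm (z - a) by lra.
  apply: ler_pM; rewrite ?nm_ge0 ?invr_ge0 ?nm_ge0 ?H // lef_pV2 // posrE.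
have EM : 8 * s * (M / s) = 8 * M by field; rewrite gt_eqF.
by rewrite -EM; apply: le_trans B; rewrite -E nmM ler_peMr // nm_ge0.
Qed.

(** The algebraic identity behind the differentiability of Cauchy integrals: their
    difference quotients are again Cauchy integrals. *)
Lemma Phi_sub g a s w v : 0 < s -> bcont g a s -> nm (w - a) < s -> nm (v - a) < s ->
  Phi g a s w = Phi g a s v + (w - v) * Phi (fun z => g z / (z - v)) a s w.
Proof.
move=> s0 cg hw hv; have cgv := bcont_quot hv cg.
have E : Phi (fun z => g z / (z - v)) a s w * (w - v) = 1 * Phi g a s w + (-1) * Phi g a s v.
  have -> : Phi (fun z => g z / (z - v)) a s w * (w - v) =
     (w - v) * Phi (fun z => g z / (z - v)) a s w + 0 * Phi (fun z => g z / (z - v)) a s w by ring.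
  rewrite -!oint_lin //; try exact: bcont_quot.
  by apply: oint_ext => // z hz; have zw := bdry_neq hw hz; have zv := bdry_neq hv hz; field; rewrite zw zv.
by rewrite mulrC E; ring.
Qed.

Lemma Phi_cont g a s w : 0 < s -> bcont g a s -> nm (w - a) < s -> ccont (Phi g a s) w.
Proof.
move=> s0 cg hw; have [M M0 HM] := oint_dom s0 cg.
pose dl := s - nm (w - a); have dl0 : 0 < dl by rewrite /dl; lra.
split=> e e0.
pose K := (dl * (dl / 2))^-1.
have K0 : 0 < K by rewrite invr_gt0 !mulr_gt0 // invr_gt0.
have KM : 0 < K * M + 1 by have : 0 <= K * M by [rewrite mulr_ge0 // ltW]; lra.
exists (Num.min (dl / 2) (e / (K * M + 1))); first by rewrite lt_min !divr_gt0.
move=> v; rewrite lt_min => /andP[v1 v2].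
have hv : nm (v - a) < s by have := nm_tri w v a; rewrite /dl in v1 *; lra.
rewrite (Phi_sub s0 cg hv hw) addrC addKr nmM.
have h : nm (Phi (fun z => g z / (z - w)) a s v) <= K * M.
  apply: HM; first exact: ltW.
    by apply: bcont_quot => //; exact: bcont_quot.
  move=> z hz; have [h1 _] := hz.
  have zw : dl <= nm (z - w) by have := nm_tri w z a; rewrite /dl; lra.
  have zv : dl / 2 <= nm (z - v) by have := nm_tri v z w; lra.
  rewrite !nmM !nmV -mulrA -invfM mulrC ler_wpM2r ?nm_ge0 //.
  rewrite /K lef_pV2 ?posrE; [|by rewrite mulr_gt0 //; lra..].
  by apply: ler_pM => //; lra.
apply: le_lt_trans (ler_wpM2l (nm_ge0 _) h) _.
have : 0 <= K * M by rewrite mulr_ge0 // ltW.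
move: v2; rewrite ltr_pdivlMr // => v2 h0; apply: le_lt_trans v2.
by rewrite ler_wpM2l ?nm_ge0 // lerDl.
Qed.

Lemma Phi_diff g a s w : 0 < s -> bcont g a s -> nm (w - a) < s -> cdiff (Phi g a s) w.
Proof.
move=> s0 cg hw.
have cgw := bcont_quot hw cg.
pose p v := if nm (v - a) < s then Phi (fun z => g z / (z - w)) a s v
  else (Phi g a s v - Phi g a s w) / (v - w).
exists (p w); apply/is_cder_car; exists p; split=> //.
- apply: ccont_ext (Phi_cont s0 cgw hw).
  exists (s - nm (w - a)); first by lra.
  by move=> v hv; rewrite /p; have -> : nm (v - a) < s by have := nm_tri w v a; lra.
- move=> v; rewrite /p; case: ifP => hv; first exact: Phi_sub.
  rewrite mulrC divfK; first by ring.
  by rewrite subr_eq0; apply/negP => /eqP vw; move: hv; rewrite vw hw.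
Qed.

(** A difference quotient of a differentiable function is differentiable at the
    point itself: there it is a quotient of Cauchy integrals. *)
Lemma division f a r : 0 < r -> cdiff_ball f a r ->
  exists p : C -> C, [/\ cdiff_ball p a r, forall z, f z = f a + (z - a) * p z & is_cder f a (p a)].
Proof.
move=> r0 hf; have [l hl] := hf a ltac:(by rewrite subrr nm0 ltW).
have /is_cder_car [p [cp pa fE]] := hl.
exists p; split=> //; last by rewrite pa.
move=> z hz; have [->|za] := eqVneq z a; last exact: (car_diff fE za (hf z hz)).
pose s := r / 2; have s0 : 0 < s by rewrite divr_gt0.
have hf' : cdiff_ball f a (2 * s) by move=> x hx; apply: hf; rewrite /s in hx; lra.
have aa : nm (a - a) < s by rewrite subrr nm0.
have cf : bcont f a s by move=> x [_ hx]; apply: cdiff_cont; exact: hf'.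
have c1 := @bcont1 a s.
pose N := Phi (fun=> 1) a s; pose A := Phi (fun z => f z / (z - a)) a s.
pose B := Phi (fun z => 1 / (z - a)) a s.
have N0 : N a != 0.
  rewrite -nm_gt0; apply: lt_le_trans ltr01 _; apply: le_trans (winding_ge1 a s0) _.
  rewrite le_eqVlt; apply/orP; left; apply/eqP; congr nm.
  by apply: oint_ext => // x _; rewrite mul1r.
have cN : ccont N a by exact: Phi_cont.
have [d d0 Nd] := ccont_neq0 cN N0.
have dA : cdiff A a by apply: Phi_diff => //; exact: bcont_quot.
have dB : cdiff B a by apply: Phi_diff => //; exact: bcont_quot.
have dN : cdiff N a by exact: Phi_diff.
pose h w := (A w - f a * B w) / N w.
have dh : cdiff h a.
  have [lA hA] := dA; have [lB hB] := dB; have [lN hN] := dN; eexists.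
  apply: is_cderM; last by apply: is_cderV hN.
  by apply: (is_cderD hA); apply: is_cderN; apply: is_cderM hB; exact: is_cder_cst.
have eqn w : w != a -> nm (w - a) < Num.min s d -> h w = p w.
  move=> wa; rewrite lt_min => /andP[ws wd].
  have := cauchy_formula s0 hf' ws; have := cauchy_formula s0 hf' aa.
  rewrite (Phi_sub s0 cf ws aa) (Phi_sub s0 c1 ws aa) -/N -/A -/B => Ea Ew.
  have Nw : N w = N a + (w - a) * B w by rewrite /N (Phi_sub s0 c1 ws aa).
  have wa0 : w - a != 0 by rewrite subr_eq0.
  have Nw0 := Nd w wd.
  rewrite (car_quot fE wa) /h.
  apply/eqP; rewrite eqr_div //; apply/eqP.
  have -> : (f w - f a) * N w = f w * (N a + (w - a) * B w) - f a * N a - (w - a) * (f a * B w).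
    by rewrite Nw; ring.
  by rewrite Ew Ea; ring.
apply: (cdiff_near _ dh); exists (Num.min s d); first by rewrite lt_min s0.
move=> w hw; have [->|wa] := eqVneq w a; last exact: eqn.
apply: ccont_eq (cdiff_cont dh) cp _; exists (Num.min s d); first by rewrite lt_min s0.
by move=> v; exact: eqn.
Qed.

Lemma cauchy_est f a s M l : 0 < s -> cdiff_ball f a (2 * s) ->
  (forall z, nm (z - a) <= 2 * s -> nm (f z) <= M) -> is_cder f a l -> nm l <= 16 * M / s.
Proof.
move=> s0 hf H hl; have [p [hp fE pa]] := division (mulr_gt0 (ltr0Sn _ 1) s0) hf.
rewrite (is_cder_uniq hl pa).
have -> : 16 * M / s = 8 * (2 * M / s) by field; rewrite gt_eqF.
apply: (center_bound s0 hp) => z [h1 h2].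
have za : z != a by apply/negP => /eqP za; rewrite za subrr nm0 in h1; lra.
rewrite (car_quot fE za) nmM nmV.
have M1 := H z h2; have M2 := H a ltac:(by rewrite subrr nm0; lra).
apply: ler_pM; rewrite ?nm_ge0 ?invr_ge0 ?nm_ge0 //; last by rewrite lef_pV2 // posrE; lra.
by apply: le_trans (nmD _ _) _; rewrite nmN; lra.
Qed.

(** Divide twice: [f z = f a + (z - a) (p a + (z - a) p2 z)].  The derivative is
    then explicit, and Cauchy's estimate bounds the derivative of [p2]. *)
Lemma derive_diff f a r : 0 < r -> cdiff_ball f a r -> cdiff (f^`()%classic) a.
Proof.
move=> r0 hf; have [p [hp fE _]] := division r0 hf.
have [p2 [hp2 pE _]] := division r0 hp.
have r2 : 0 < r / 2 by rewrite divr_gt0.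
have cp2 : ccont p2 a by apply/cdiff_cont/hp2; rewrite subrr nm0 ltW.
have [/(_ 1 ltr01) [d1 d10 Hd1]] := cp2.
pose t := Num.min d1 r / 4.
have t0 : 0 < t by rewrite divr_gt0 // lt_min d10.
have [t1 t2] : 4 * t <= d1 /\ 4 * t <= r.
  by rewrite /t mulrC divfK // !ge_min !lexx orbT.
pose M := nm (p2 a) + 1.
have D w l : nm (w - a) <= t -> is_cder p2 w l -> nm l <= 16 * M / t.
  move=> wt hl; apply: (cauchy_est (f := p2) (a := w) t0) hl.
    by move=> z hz; apply: hp2; have := nm_tri w z a; lra.
  move=> z hz; have : nm (p2 z - p2 a) < 1 by apply: Hd1; have := nm_tri w z a; lra.
  by have := nm_subr (p2 z) (p2 a); rewrite /M; lra.
have fd w l : is_cder p2 w l -> nm (w - a) <= t ->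
    is_cder f w (p a + (w - a) * (2 * p2 w + (w - a) * l)).
  move=> hl _.
  have -> : f = fun z => f a + (z - a) * (p a + (z - a) * p2 z).
    by apply/funext => z; rewrite fE pE.
  have hs := is_cder_subid a w.
  have h1 := is_cderD (is_cder_cst (p a) w) (is_cderM hs hl).
  have h2 := is_cderD (is_cder_cst (f a) w) (is_cderM hs h1).
  by move: h2; congr is_cder; ring.
exists (2 * p2 a); split=> e e0.
have e4 : 0 < e / 4 by rewrite divr_gt0.
have [d2 d20 Hd2] := (let: CCont H := cp2 in H) _ e4.
have M0 : 0 < M by rewrite /M; have := nm_ge0 (p2 a); lra.
pose K := 16 * M / t; have K0 : 0 < K by rewrite /K divr_gt0 // mulr_gt0.
have m0 : 0 < Num.min (Num.min d2 t) (e / (2 * K)) by rewrite !lt_min d20 t0 divr_gt0 // mulr_gt0.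
exists (Num.min (Num.min d2 t) (e / (2 * K))) => // h.
rewrite !lt_min => /andP[/andP[h1 h2] h3].
have hah : a + h - a = h by ring.
have [l hl] := hp2 (a + h) ltac:(rewrite hah; lra).
have [l0 hl0] := hp2 a ltac:(rewrite subrr nm0; lra).
have E1 := is_cder_derive1 (fd _ _ hl ltac:(rewrite hah; lra)).
have E0 := is_cder_derive1 (fd _ _ hl0 ltac:(rewrite subrr nm0; lra)).
rewrite E1 E0 hah.
have -> : p a + h * (2 * p2 (a + h) + h * l) - (p a + (a - a) * (2 * p2 a + (a - a) * l0)) - h * (2 * p2 a)
   = h * (2 * (p2 (a + h) - p2 a) + h * l) by ring.
rewrite nmM mulrC ler_wpM2r ?nm_ge0 //; apply: le_trans (nmD _ _) _.
have b1 := Hd2 (a + h) ltac:(by rewrite hah).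
have b2 := D (a + h) l ltac:(rewrite hah; lra) hl.
rewrite !nmM nm2.
have : nm h * nm l <= e / 2.
  apply: le_trans (ler_wpM2l (nm_ge0 h) b2) _; rewrite -/K.
  have K2 : 0 < 2 * K by rewrite mulr_gt0.
  by move: h3; rewrite ltr_pdivlMr // => h3; lra.
lra.
Qed.

Lemma mean_value D f K p q : region D ->
  (forall z, D z -> exists2 l, is_cder f z l & nm l <= K) -> D p -> D q ->
  nm (f q - f p) <= K * nm (q - p).
Proof.
move=> [mD cD] H Dp Dq.
rewrite -subr_le0; apply: le_eps0 => e1 e10; rewrite leNgt; apply/negP => bad0.
have N0 : 0 < nm (q - p) + 1 by have := nm_ge0 (q - p); lra.
pose e := e1 / (nm (q - p) + 1); have e0 : 0 < e by rewrite divr_gt0.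
have eE : e * nm (q - p) <= e1 by rewrite /e mulrAC ler_pdivrMr // ler_pM2l // lerDl.
have bad : (K + e) * nm (q - p) < nm (f q - f p) by rewrite mulrDl; lra.
(* If the inequality fails with [K + e], it fails on one half. *)
have [||z Hz] := @bisection R (fun x y => [/\ D x, D y &
     (K + e) * nm (y - x) < nm (f y - f x)]) p q.
- by split.
- move=> x y [Dx Dy nG]; set m := (x + y) / 2.
  have Dm : D m by exact: mD.
  have [h1|h1] := ltP ((K + e) * nm (m - x)) (nm (f m - f x)); first by left.
  have [h2|h2] := ltP ((K + e) * nm (y - m)) (nm (f y - f m)); first by right.
  exfalso; move: h1 h2; rewrite midB1 midB2 nm_half; have := nm_tri (f m) (f y) (f x); lra.
have Dz : D z.
  apply: cD => x x0; have [u [v [[Du _ _] h1 h2]]] := Hz (x / 4) (divr_gt0 x0 (ltr0Sn _ 3)).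
  by exists u => //; apply: le_lt_trans h2 _; lra.
have [l [Hl] lK] := H _ Dz.
have e9 : 0 < e / 10 by rewrite divr_gt0.
have [d d0 Hd] := Hl _ e9.
have [u [v [[Du Dv nG] h1 h2]]] := Hz (d / 6) (divr_gt0 d0 (ltr0Sn _ 5)).
have h3 : nm (v - z) <= 5 * nm (v - u) by have := nm_tri u v z; lra.
have hu := Hd (u - z) ltac:(by have := nm_ge0 (v - u); lra).
have hv := Hd (v - z) ltac:(by have := nm_ge0 (v - u); lra).
have sK x : z + (x - z) = x by ring.
rewrite !sK in hu hv.
have : nm (f v - f u) <= nm (l * (v - u)) + e * nm (v - u).
  have -> : f v - f u = (f v - f z - (v - z) * l) - (f u - f z - (u - z) * l) + l * (v - u) by ring.
  apply: le_trans (nmD _ _) _; rewrite addrC lerD2l; apply: le_trans (nmD _ _) _.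
  rewrite nmN; have := ler_wpM2l (ltW e9) h2; have := ler_wpM2l (ltW e9) h3.
  have : 0 <= e * nm (v - u) by rewrite mulr_ge0 ?nm_ge0 // ltW.
  lra.
rewrite nmM; have := ler_wpM2r (nm_ge0 (v - u)) lK; move: nG; rewrite mulrDl; lra.
Qed.
End Square.

(** * Germs of holomorphic functions and the identity theorem *)
Section Germs.
Variable R : realType.
Notation C := (Cplx R).
Implicit Types (f g h : C -> C) (z w a b c l p q : C) (e d r s : R) (P Q : C -> Prop).

(** The neighbourhood filters and punctured neighbourhood filters, given by real
    radii. *)
Definition nbh z P := exists2 e : R, 0 < e & forall w, nm (w - z) < e -> P w.
Definition pnbh z P := exists2 e : R, 0 < e & forall w, w != z -> nm (w - z) < e -> P w.

Lemma nbhP z P : (\forall w \near z, P w) <-> nbh z P.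
Proof. exact: near_nm. Qed.
Lemma pnbhP z P : (\forall w \near z^', P w)%classic <-> pnbh z P.
Proof. exact: pnear_nm. Qed.
Lemma nbhI z P Q : nbh z P -> nbh z Q -> nbh z (fun w => P w /\ Q w).
Proof.
move=> [e e0 He] [d d0 Hd]; exists (Num.min e d); first by rewrite lt_min e0.
by move=> w; rewrite lt_min => /andP[/He ? /Hd ?].
Qed.
Lemma pnbhI z P Q : pnbh z P -> pnbh z Q -> pnbh z (fun w => P w /\ Q w).
Proof.
move=> [e e0 He] [d d0 Hd]; exists (Num.min e d); first by rewrite lt_min e0.
by move=> w wz; rewrite lt_min => /andP[/(He _ wz) ? /(Hd _ wz) ?].
Qed.
Lemma nbh_mono z P Q : (forall w, P w -> Q w) -> nbh z P -> nbh z Q.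
Proof. by move=> H [e e0 He]; exists e => // w /He /H. Qed.
Lemma pnbh_mono z P Q : (forall w, w != z -> P w -> Q w) -> pnbh z P -> pnbh z Q.
Proof. by move=> H [e e0 He]; exists e => // w wz /(He _ wz); exact: H. Qed.
Lemma nbh_pnbh z P : nbh z P -> pnbh z P.
Proof. by move=> [e e0 He]; exists e => // w _ /He. Qed.
Lemma nbh_at z P : nbh z P -> P z.
Proof. by move=> [e e0 He]; apply: He; rewrite subrr nm0. Qed.
Lemma nbh_nbh z P : nbh z P -> nbh z (fun w => nbh w P).
Proof.
move=> [e e0 He]; exists (e / 2); first by rewrite divr_gt0.
move=> w hw; exists (e / 2); first by rewrite divr_gt0.
by move=> v hv; apply: He; have := nm_tri w v z; lra.
Qed.
Lemma pnbh_nbh z P : pnbh z P -> pnbh z (fun w => nbh w P).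
Proof.
move=> [e e0 He]; exists (e / 2); first by rewrite divr_gt0.
move=> w wz hw; have wz0 : 0 < nm (w - z) by rewrite nm_gt0 subr_eq0.
exists (nm (w - z)) => // v hv; apply: He; last by have := nm_tri w v z; lra.
by apply/negP => /eqP vz; move: hv; rewrite vz nmB ltxx.
Qed.
Lemma pnbh_ex z P : pnbh z P -> exists2 w, w != z & P w.
Proof.
move=> [e e0 He].
have h : nm (z + rc (e / 2) - z) = e / 2 by rewrite addrC addKr nm_real ger0_norm // divr_ge0 // ltW.
have wz : z + rc (e / 2) != z.
  by rewrite -subr_eq0 -nm_eq0 h gt_eqF // divr_gt0.
by exists (z + rc (e / 2)) => //; apply: He => //; rewrite h; lra.
Qed.
Lemma pnbh_nbh_at z P : pnbh z P -> P z -> nbh z P.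
Proof. by move=> [e e0 He] Pz; exists e => // w hw; have [->|/He] := eqVneq w z; last exact. Qed.

(** An inductive form of [holomorphic_at] (see [holE]): it does not unfold, so that
    lemmas about it apply by their head symbol alone. *)
Variant hol f z : Prop := Hol of nbh z (cdiff f).

Lemma holE f z : hol f z <-> holomorphic_at f z.
Proof.
rewrite /holomorphic_at nbhP; split=> [[]|] h; last split; apply: nbh_mono h => w.
  by move=> h; apply/derivableP_cder.
by move/derivableP_cder.
Qed.
Lemma poleP f a m : pole_of_order f a m <-> (0 < m)%N /\
  exists g, [/\ hol g a, g a != 0 & pnbh a (fun w => f w = g w / (w - a) ^+ m)].
Proof.
by split=> -[m0 [g [/holE hg g0 /pnbhP H]]]; split=> //; exists g.
Qed.
Lemma meroP f : meromorphic f <-> forall z, hol f z \/ exists m, pole_of_order f z m.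
Proof. by split=> H z; (case: (H z) => [/holE h|[m hm]]; [left|right; exists m]). Qed.
Lemma mero_eqP f g : mero_eq f g <-> forall z, pnbh z (fun w => f w = g w).
Proof. by split=> H z; have := H z => /pnbhP. Qed.
Opaque holomorphic_at pole_of_order meromorphic mero_eq.

Lemma holP f z : hol f z <-> nbh z (cdiff f).
Proof. by split=> [[]|]. Qed.
Lemma hol_cdiff_ball f z : hol f z -> exists2 r, 0 < r & cdiff_ball f z r.
Proof.
move=> /holP [e e0 He]; exists (e / 2); first by rewrite divr_gt0.
by move=> w hw; apply: He; lra.
Qed.
Lemma cdiff_ball_hol f z r : 0 < r -> cdiff_ball f z r -> hol f z.
Proof. by move=> r0 H; apply/holP; exists r => // w hw; apply: H; rewrite ltW. Qed.
Lemma hol_cdiff f z : hol f z -> cdiff f z.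
Proof. by move=> /holP /nbh_at. Qed.
Lemma hol_cont f z : hol f z -> ccont f z.
Proof. by move=> /hol_cdiff /cdiff_cont. Qed.
Lemma cdiff_cder f z : cdiff f z -> is_cder f z (f^`()%classic z).
Proof. by move=> [l hl]; rewrite (is_cder_derive1 hl). Qed.
Lemma hol_cder f z : hol f z -> is_cder f z (f^`()%classic z).
Proof. by move=> /hol_cdiff /cdiff_cder. Qed.
Lemma hol_nbh f z : hol f z -> nbh z (hol f).
Proof. by move=> /holP /nbh_nbh; apply: nbh_mono => w; move/holP. Qed.
Lemma hol_ext f g z : nbh z (fun w => f w = g w) -> hol f z -> hol g z.
Proof.
move=> /nbh_nbh h /holP /(nbhI h) {}h; apply/holP; move: h.
by apply: nbh_mono => w [fg]; exact: cdiff_near.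
Qed.
Lemma entire_hol f z : (forall w, cdiff f w) -> hol f z.
Proof. by move=> H; apply/holP; exists 1. Qed.

Lemma cdiff_cst c z : cdiff (fun=> c) z.
Proof. by exists 0; exact: is_cder_cst. Qed.
Lemma cdiff_id z : cdiff id z.
Proof. by exists 1; exact: is_cder_id. Qed.
Lemma cdiffD f g z : cdiff f z -> cdiff g z -> cdiff (fun w => f w + g w) z.
Proof. by move=> [l hl] [l' hl']; exists (l + l'); exact: is_cderD. Qed.
Lemma cdiffM f g z : cdiff f z -> cdiff g z -> cdiff (fun w => f w * g w) z.
Proof. by move=> [l hl] [l' hl']; eexists; apply: is_cderM; eassumption. Qed.
Lemma cdiffN f z : cdiff f z -> cdiff (fun w => - f w) z.
Proof. by move=> [l hl]; eexists; apply: is_cderN; eassumption. Qed.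
Lemma cdiffX f z n : cdiff f z -> cdiff (fun w => f w ^+ n) z.
Proof. by move=> [l hl]; eexists; apply: is_cderX; eassumption. Qed.
Lemma cdiffV f z : f z != 0 -> cdiff f z -> cdiff (fun w => (f w)^-1) z.
Proof. by move=> f0 [l hl]; eexists; apply: is_cderV; eassumption. Qed.
Lemma cdiff_comp f g z : cdiff f z -> cdiff g (f z) -> cdiff (fun w => g (f w)) z.
Proof. by move=> [l hl] [l' hl']; eexists; apply: is_cder_comp; eassumption. Qed.

Lemma hol_cst c z : hol (fun=> c) z.
Proof. by apply: entire_hol => w; exact: cdiff_cst. Qed.
Lemma hol_id z : hol id z.
Proof. by apply: entire_hol => w; exact: cdiff_id. Qed.
Lemma holD f g z : hol f z -> hol g z -> hol (fun w => f w + g w) z.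
Proof. by move=> /holP hf /holP /(nbhI hf) h; apply/holP; apply: nbh_mono h => w [? ?]; exact: cdiffD. Qed.
Lemma holM f g z : hol f z -> hol g z -> hol (fun w => f w * g w) z.
Proof. by move=> /holP hf /holP /(nbhI hf) h; apply/holP; apply: nbh_mono h => w [? ?]; exact: cdiffM. Qed.
Lemma holN f z : hol f z -> hol (fun w => - f w) z.
Proof. by move=> /holP h; apply/holP; apply: nbh_mono h => w; exact: cdiffN. Qed.
Lemma holB f g z : hol f z -> hol g z -> hol (fun w => f w - g w) z.
Proof. by move=> hf hg; apply: holD => //; exact: holN. Qed.
Lemma holX f z n : hol f z -> hol (fun w => f w ^+ n) z.
Proof. by move=> /holP h; apply/holP; apply: nbh_mono h => w; exact: cdiffX. Qed.
Lemma cont_neq0_nbh f z : ccont f z -> f z != 0 -> nbh z (fun w => f w != 0).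
Proof. by move=> cf f0; have [e e0 H] := ccont_neq0 cf f0; exists e. Qed.
Lemma hol_neq0 f z : hol f z -> f z != 0 -> nbh z (fun w => f w != 0).
Proof. by move=> /hol_cont; exact: cont_neq0_nbh. Qed.
Lemma holV f z : f z != 0 -> hol f z -> hol (fun w => (f w)^-1) z.
Proof.
move=> f0 hf; apply/holP; have := nbhI (hol_neq0 hf f0) (proj1 (holP _ _) hf).
by apply: nbh_mono => w [? ?]; exact: cdiffV.
Qed.
Lemma cont_nbh f z P : ccont f z -> nbh (f z) P -> nbh z (fun w => P (f w)).
Proof. by move=> [cf] [e e0 He]; have [d d0 Hd] := cf e e0; exists d => // w /Hd /He. Qed.
Lemma hol_comp f g z : hol f z -> hol g (f z) -> hol (fun w => g (f w)) z.
Proof.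
move=> hf /holP hg; have := nbhI (proj1 (holP _ _) hf) (cont_nbh (hol_cont hf) hg).
by move=> h; apply/holP; apply: nbh_mono h => w [? ?]; exact: cdiff_comp.
Qed.
Lemma hol_prod n (F : 'I_n -> C -> C) z : (forall i, hol (F i) z) ->
  hol (fun w => \prod_(i < n) F i w) z.
Proof.
elim: n F => [|n IH] F H.
  by under [X in hol X]eq_fun do rewrite big_ord0; exact: hol_cst.
under [X in hol X]eq_fun do rewrite big_ord_recr.
by apply: holM => //; exact: IH.
Qed.
Lemma hol_aff a b z : hol (fun w => a * w + b) z.
Proof. by apply: holD; [apply: holM; [exact: hol_cst|exact: hol_id]|exact: hol_cst]. Qed.
Lemma hol_sub a z : hol (fun w => w - a) z.
Proof. by apply: holB; [exact: hol_id|exact: hol_cst]. Qed.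
Lemma hol_derive f z : hol f z -> hol (f^`()%classic) z.
Proof.
move=> /hol_nbh h; apply/holP; apply: nbh_mono h => w /hol_cdiff_ball [r r0 hr].
exact: derive_diff hr.
Qed.
Lemma hol_division f a : hol f a ->
  exists p : C -> C, [/\ hol p a, forall z, f z = f a + (z - a) * p z & p a = f^`()%classic a].
Proof.
move=> /hol_cdiff_ball [r r0 /(division r0) [p [hp fE pa]]].
by exists p; split=> //; [exact: cdiff_ball_hol hp|rewrite (is_cder_derive1 pa)].
Qed.

(** If [f] can be divided by [w - a] for ever, then [f = (w - a)^n h_n] on a fixed
    disc, and the maximum bound [center_bound] for [h_n] on a larger circle shows
    that [f] vanishes close to [a]. *)
Lemma hol_order f a : hol f a ->
  nbh a (fun w => f w = 0) \/
  exists n, exists h, [/\ hol h a, h a != 0 & forall w, f w = (w - a) ^+ n * h w].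
Proof.
move=> hf; have [r0 r0_gt hr0] := hol_cdiff_ball hf.
have [/(_ 1 ltr01) [d d0 Hd]] := hol_cont hf.
pose r := Num.min r0 d / 2; have r_gt : 0 < r by rewrite divr_gt0 // lt_min r0_gt.
have [rr0 rd] : 2 * r <= r0 /\ 2 * r <= d.
  by rewrite /r mulrC divfK // !ge_min !lexx orbT.
have hr : cdiff_ball f a r by move=> z hz; apply: hr0; lra.
pose M := nm (f a) + 1.
have HM z : nm (z - a) <= r -> nm (f z) <= M.
  by move=> hz; have := Hd z ltac:(lra); have := nm_subr (f z) (f a); rewrite /M; lra.
have [fin|inf] := pselect (exists n h, [/\ hol h a, h a != 0 & forall w, f w = (w - a) ^+ n * h w]).
  by right.
left; have all_n n : exists2 h, cdiff_ball h a r & forall w, f w = (w - a) ^+ n * h w.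
  elim: n => [|n [h hh hE]]; first by exists f => // w; rewrite mul1r.
  have h0 : h a = 0.
    apply/eqP/negPn/negP => h0; apply: inf; exists n, h; split=> //; exact: cdiff_ball_hol hh.
  have [p [hp pE _]] := division r_gt hh.
  by exists p => // w; rewrite hE pE h0 add0r mulrA exprSr.
exists (r / 16); first by rewrite divr_gt0.
move=> w hw; apply: nm_eps0 => e e0.
have M0 : 0 < M by rewrite /M; have := nm_ge0 (f a); lra.
have [n hn] := geo_small (8 * M) e0; have [h hh hE] := all_n n.
pose s := r / 4; have s0 : 0 < s by rewrite divr_gt0.
have B : nm (h w) <= 8 * (M / (s / 2) ^+ n).
  apply: (center_bound (s := s) s0).
    by move=> z hz; apply: hh; have := nm_tri w z a; rewrite /s in hz; lra.
  move=> z [h1 h2].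
  have za : s / 2 <= nm (z - a) by have := nm_tri a z w; rewrite (nmB a w) /s in h1 *; lra.
  have za0 : 0 < nm (z - a) by apply: lt_le_trans za; rewrite divr_gt0.
  have zn : 0 < nm (z - a) ^+ n by rewrite exprn_gt0.
  have z2 : nm (z - a) <= r by have := nm_tri w z a; rewrite /s in h2; lra.
  have -> : nm (h z) = nm (f z) / nm (z - a) ^+ n.
    by rewrite hE nmM nmX [_ * nm (h z)]mulrC mulfK // gt_eqF.
  have zi : 0 <= (nm (z - a) ^+ n)^-1 by rewrite invr_ge0 ltW.
  apply: (ler_pM (nm_ge0 _) zi (HM z z2)).
  have s20 : 0 < s / 2 by rewrite divr_gt0.
  rewrite lef_pV2 ?posrE ?exprn_gt0 //.
  by apply: lerXn2r => //; rewrite nnegrE ltW.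
rewrite hE nmM nmX; apply: le_trans (ltW hn).
have s2 : 0 < s / 2 by rewrite divr_gt0.
apply: le_trans (ler_wpM2l (exprn_ge0 _ (nm_ge0 _)) B) _.
have -> : nm (w - a) ^+ n * (8 * (M / (s / 2) ^+ n)) = 8 * M * (nm (w - a) / (s / 2)) ^+ n.
  by rewrite (expr_div_n (nm (w - a))); set x := (s / 2) ^+ n; ring.
rewrite ler_pM2l ?mulr_gt0 // -exprVn; apply: lerXn2r.
- by rewrite nnegrE divr_ge0 ?nm_ge0 // ltW.
- by rewrite nnegrE invr_ge0.
- by rewrite ler_pdivrMr // /s; lra.
Qed.

(** Liouville's theorem for polynomial growth, by induction on the degree: the
    difference quotient at the origin is entire and grows one order less. *)
Lemma liouville f (K : R) N : (forall z, cdiff f z) ->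
  (forall z, nm (f z) <= K * (1 + nm z) ^+ N) -> exists P : {poly C}, forall z, f z = P.[z].
Proof.
elim: N f K => [|N IH] f K df bf.
- exists (f 0)%:P => w; rewrite hornerC.
  have K0 : 0 <= K by have := bf 0; have := nm_ge0 (f 0); rewrite expr0; lra.
  have [p [hp fE _]] := @division R f 0 1 ltr01 (fun z _ => df z).
  suff p0 : p w = 0 by rewrite fE p0 mulr0 addr0.
  have dp z : cdiff p z.
    have [->|z0] := eqVneq z 0; first by apply: hp; rewrite subrr nm0.
    exact: (car_diff fE z0 (df z)).
  apply: nm_eps0 => e e0.
  pose s := nm w + 1 + 16 * K / e.
  have s0 : 0 < s by rewrite /s; have := nm_ge0 w; have : 0 <= 16 * K / e by [rewrite divr_ge0 ?mulr_ge0 // ltW]; lra.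
  have := @center_bound R p w s (e / 8) s0 (fun z _ => dp z).
  have -> : 8 * (e / 8) = e by field.
  apply=> z [h1 h2].
  have zs : 1 + 16 * K / e <= nm z.
    by have := nm_tri 0 z w; rewrite subr0 sub0r nmN /s in h1 *; lra.
  have eK : 0 <= 16 * K / e by rewrite divr_ge0 ?mulr_ge0 // ltW.
  have z0 : z != 0 by rewrite -nm_gt0; lra.
  rewrite (car_quot fE z0) subr0 nmM nmV ler_pdivrMr ?nm_gt0 //.
  apply: le_trans (nmD _ _) _; rewrite nmN.
  have := bf z; have := bf 0; rewrite !expr0 !mulr1.
  have : 2 * K <= e / 8 * nm z.
    have := ler_wpM2l (ltW e0) zs; have -> : e * (1 + 16 * K / e) = e + 16 * K by field; rewrite gt_eqF.
    by lra.
  lra.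
- have K0 : 0 <= K by have := bf 0; have := nm_ge0 (f 0); rewrite nm0 addr0 expr1n; lra.
  have [p [hp fE _]] := @division R f 0 1 ltr01 (fun z _ => df z).
  have dp z : cdiff p z.
    have [->|z0] := eqVneq z 0; first by apply: hp; rewrite subrr nm0.
    exact: (car_diff fE z0 (df z)).
  have big z : 1 <= nm z -> nm (p z) <= 4 * K * (1 + nm z) ^+ N.
    move=> hz; have z0 : z != 0 by rewrite -nm_gt0; lra.
    rewrite (car_quot fE z0) subr0 nmM nmV ler_pdivrMr ?nm_gt0 //.
    apply: le_trans (nmD _ _) _; rewrite nmN.
    have := bf z; have := bf 0; rewrite nm0 addr0 expr1n mulr1 exprS.
    have X1 : 1 <= (1 + nm z) ^+ N by apply: exprn_ege1; lra.
    set X := (1 + nm z) ^+ N in X1 *.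
    have : K <= K * X by rewrite ler_peMr.
    have KX0 : 0 <= K * X by rewrite mulr_ge0 //; lra.
    have -> : 4 * K * X * nm z = 4 * (K * X * nm z) by ring.
    have -> : K * ((1 + nm z) * X) = K * X + K * X * nm z by ring.
    have : K * X <= K * X * nm z by rewrite ler_peMr.
    lra.
  have [P HP] : exists P : {poly C}, forall z, p z = P.[z].
    apply: (IH p (4 * K + 8 * (4 * K * 6 ^+ N))) => // z.
    have X1 : 1 <= (1 + nm z) ^+ N by apply: exprn_ege1; have := nm_ge0 z; lra.
    have Y0 : 0 <= 8 * (4 * K * 6 ^+ N) by rewrite !mulr_ge0 // exprn_ge0.
    have [hz|hz] := leP 1 (nm z).
      apply: le_trans (big z hz) _; rewrite [leRHS]mulrDl lerDl mulr_ge0 //; lra.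
    have B : nm (p z) <= 8 * (4 * K * 6 ^+ N).
      apply: (@center_bound R p z 2 _ (ltr0Sn _ 1) (fun z _ => dp z)) => x [h1 h2].
      have x1 : 1 <= nm x by have := nm_tri 0 x z; rewrite subr0 sub0r nmN; lra.
      have x2 : nm x <= 5 by have := nm_tri z x 0; rewrite !subr0; lra.
      apply: le_trans (big x x1) _; rewrite ler_wpM2l ?mulr_ge0 //.
      by apply: lerXn2r; rewrite ?nnegrE; lra.
    apply: le_trans B _; rewrite [leRHS]mulrDl; set Y := 8 * _ in Y0 *.
    have : Y <= Y * (1 + nm z) ^+ N by rewrite ler_peMr.
    have : 0 <= 4 * K * (1 + nm z) ^+ N by rewrite mulr_ge0 ?mulr_ge0 //; lra.
    lra.
  exists ((f 0)%:P + 'X * P) => z.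
  by rewrite hornerD hornerC hornerM hornerX -HP fE subr0.
Qed.

Definition mero_at f z := exists m, exists2 g, hol g z & pnbh z (fun w => f w = g w / (w - z) ^+ m).

Lemma mero_mero_at f z : meromorphic f -> mero_at f z.
Proof.
move=> /meroP /(_ z) [hf|[m /poleP [m0 [g [hg _ H]]]]]; last by exists m, g.
by exists 0%N, f => //; exists 1 => // w _ _; rewrite expr0 divr1.
Qed.

Lemma pnbh_sub0 z n : pnbh z (fun w => (w - z) ^+ n != 0).
Proof. by exists 1 => // w wz _; rewrite expf_neq0 // subr_eq0. Qed.

Lemma mero_dich f g z : mero_at f z -> mero_at g z ->
  pnbh z (fun w => f w = g w) \/ pnbh z (fun w => f w != g w).
Proof.
move=> [m [F hF fE]] [k [G hG gE]].
have hH : hol (fun w => F w * (w - z) ^+ k - G w * (w - z) ^+ m) z.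
  by apply: holB; apply: holM => //; apply: holX; exact: hol_sub.
have P := pnbhI (pnbhI fE gE) (pnbhI (pnbh_sub0 z m) (pnbh_sub0 z k)).
case: (hol_order hH) => [H0|[n [h [hh h0 hE]]]].
- left; apply: pnbh_mono (pnbhI P (nbh_pnbh H0)) => w wz [[[-> ->] [m0 k0]] /eqP].
  by rewrite subr_eq0 => /eqP E; apply/eqP; rewrite eqr_div // E.
- right; apply: pnbh_mono (pnbhI (pnbhI P (pnbh_sub0 z n)) (nbh_pnbh (hol_neq0 hh h0))).
  move=> w wz [[[[-> ->] [m0 k0]] n0] hw].
  by rewrite eqr_div // -subr_eq0 hE mulf_neq0.
Qed.

(** By [mero_dich] coincidence near a point is an open and closed condition;
    a segment from a point of coincidence to one of non-coincidence could be
    halved for ever. *)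
Lemma identity_thm f g a : meromorphic f -> meromorphic g ->
  pnbh a (fun w => f w = g w) -> mero_eq f g.
Proof.
move=> mf mg Ea; apply/mero_eqP => b; apply: contrapT => nEb.
pose E z := pnbh z (fun w => f w = g w).
have [||z Hz] := @bisection R (fun x y => E x /\ ~ E y) a b.
- by split.
- move=> x y [Ex Ey].
  by have [Em|Em] := pselect (E ((x + y) / 2)); [right|left].
- case: (mero_dich (mero_mero_at z mf) (mero_mero_at z mg)) => H.
    have [e e0 He] : nbh z E.
      apply: pnbh_nbh_at => //; apply: pnbh_mono (pnbh_nbh H) => w _; exact: nbh_pnbh.
    have [u [v [[_ nEv] h1 h2]]] := Hz (e / 6) (divr_gt0 e0 (ltr0Sn _ 5)).
    by apply: nEv; apply: He; have := nm_tri u v z; lra.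
  have [e e0 He] : pnbh z (fun w => ~ E w).
    apply: pnbh_mono (pnbh_nbh H) => w _ /nbh_pnbh Hw Ew.
    by have [v _ [v1]] := pnbh_ex (pnbhI Ew Hw); rewrite v1 eqxx.
  have [u [v [[Eu _] h1 h2]]] := Hz (e / 6) (divr_gt0 e0 (ltr0Sn _ 5)).
  have [uz|uz] := eqVneq u z.
    by have [x _ [x1]] := pnbh_ex (pnbhI (eq_ind u E Eu z uz) H); rewrite x1 eqxx.
  by apply: (He u uz) Eu; lra.
Qed.

Lemma mero_eq_sym f g : mero_eq f g -> mero_eq g f.
Proof. by move=> /mero_eqP H; apply/mero_eqP => z; apply: pnbh_mono (H z). Qed.
Lemma mero_eq_trans f g h : mero_eq f g -> mero_eq g h -> mero_eq f h.
Proof.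
move=> /mero_eqP H /mero_eqP H'; apply/mero_eqP => z.
by apply: pnbh_mono (pnbhI (H z) (H' z)) => w _ [-> ->].
Qed.
Lemma pnbh_aff a b z P : a != 0 -> pnbh (a * z + b) P -> pnbh z (fun w => P (a * w + b)).
Proof.
move=> a0 [e e0 He]; have na : 0 < nm a by rewrite nm_gt0.
exists (e / nm a); first by rewrite divr_gt0.
move=> w wz; rewrite ltr_pdivlMr // => hw; apply: He.
  by rewrite (inj_eq (addIr _)) (inj_eq (mulfI a0)).
have -> : a * w + b - (a * z + b) = (w - z) * a by ring.
by rewrite nmM.
Qed.
Lemma nbh_aff a b z P : a != 0 -> nbh (a * z + b) P -> nbh z (fun w => P (a * w + b)).
Proof.
move=> a0 H; have := pnbh_aff a0 (nbh_pnbh H) => H'; apply: pnbh_nbh_at H' _; exact: nbh_at H.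
Qed.
Lemma mero_eq_aff f g a b : a != 0 -> mero_eq f g ->
  mero_eq (fun z => f (a * z + b)) (fun z => g (a * z + b)).
Proof. by move=> a0 /mero_eqP H; apply/mero_eqP => z; exact: pnbh_aff (H _). Qed.
Lemma mero_eq_scale c f g : mero_eq f g -> mero_eq (fun z => c * f z) (fun z => c * g z).
Proof. by move=> /mero_eqP H; apply/mero_eqP => z; apply: pnbh_mono (H z) => w _ ->. Qed.

Lemma pole_notin f b m : pole_of_order f b m -> ~ hol f b.
Proof.
move=> /poleP [m0 [g [hg g0 H]]] hf; move/eqP: g0; apply.
have -> : 0 = f b * (b - b) ^+ m :> C by rewrite subrr expr0n gtn_eqF // mulr0.
apply: (ccont_eq (g := fun w => f w * (w - b) ^+ m) (hol_cont hg)).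
  by apply: hol_cont; apply: holM => //; apply: holX; exact: hol_sub.
have [e e0 He] := pnbhI H (pnbh_sub0 b m); exists e => // w wb hw.
by have [-> w0] := He w wb hw; rewrite divfK.
Qed.
Lemma pole_eq f g b m : mero_eq f g -> pole_of_order f b m -> pole_of_order g b m.
Proof.
move=> /mero_eqP E /poleP [m0 [h [hh h0 H]]]; apply/poleP; split=> //; exists h; split=> //.
by apply: pnbh_mono (pnbhI (E b) H) => w _ [<-].
Qed.
Lemma pole_aff f a b c z m : c != 0 -> a != 0 -> pole_of_order f (a * z + b) m ->
  pole_of_order (fun w => c * f (a * w + b)) z m.
Proof.
move=> c0 a0 /poleP [m0 [h [hh h0 H]]]; apply/poleP; split=> //.
exists (fun w => c / a ^+ m * h (a * w + b)); split.
- by apply: holM; [exact: hol_cst|apply: (@hol_comp (fun w => a * w + b)) => //; exact: hol_aff].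
- by rewrite !mulf_neq0 // invr_eq0 expf_neq0.
apply: pnbh_mono (pnbhI (pnbh_aff a0 H) (pnbh_sub0 z m)) => w wz [-> w0].
have -> : a * w + b - (a * z + b) = a * (w - z) by ring.
by rewrite exprMn invfM; ring.
Qed.
Lemma mero_aff f a b c : c != 0 -> a != 0 -> meromorphic f ->
  meromorphic (fun w => c * f (a * w + b)).
Proof.
move=> c0 a0 /meroP mf; apply/meroP => z; case: (mf (a * z + b)) => [hf|[m hm]].
  left; apply: holM; first exact: hol_cst.
  by apply: (@hol_comp (fun w => a * w + b)) => //; exact: hol_aff.
by right; exists m; exact: pole_aff.
Qed.
Lemma hol_mero_eq f g b : meromorphic f -> mero_eq f g -> hol g b -> hol f b.
Proof.
move=> /meroP mf E hg; case: (mf b) => // -[m hm].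
by case: (pole_notin (pole_eq E hm) hg).
Qed.
Lemma mero_eq_at f g b : mero_eq f g -> hol f b -> hol g b -> f b = g b.
Proof. by move=> /mero_eqP E hf hg; exact: ccont_eq (hol_cont hf) (hol_cont hg) (E b). Qed.
Lemma mero_pnbh f z : meromorphic f -> pnbh z (hol f).
Proof.
move=> /meroP /(_ z) [hf|[m /poleP [m0 [g [hg _ H]]]]]; first exact: nbh_pnbh (hol_nbh hf).
apply: pnbh_mono (pnbhI (pnbh_nbh H) (pnbhI (nbh_pnbh (hol_nbh hg)) (pnbh_sub0 z m))) => w wz [Hw [hw w0]].
apply: (@hol_ext (fun v => g v / (v - z) ^+ m)).
  by apply: nbh_mono Hw => v ->.
by apply: holM => //; apply: holV => //; apply: holX; exact: hol_sub.
Qed.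
(** The local extensions agree off the singularities, hence on overlaps by
    continuity; each point takes its value from its own extension. *)
Lemma removable f : (forall z, exists2 g, hol g z & pnbh z (fun w => f w = g w)) ->
  exists2 F, (forall z, cdiff F z) & mero_eq f F.
Proof.
move=> H; have /boolp.choice [G HG] : forall z, exists g, hol g z /\ pnbh z (fun w => f w = g w).
  by move=> z; have [g ? ?] := H z; exists g.
pose F z := G z z.
have FE z : nbh z (fun w => F w = G z w).
  apply: pnbh_nbh_at => //; have [hG E] := HG z.
  apply: pnbh_mono (pnbhI (pnbh_nbh E) (nbh_pnbh (hol_nbh hG))) => w _ [E1 hw].
  have [hw' E2] := HG w.
  apply: (ccont_eq (hol_cont hw') (hol_cont hw)).
  have [e e0 He] := pnbhI E2 (nbh_pnbh E1); exists e => // v vw hv.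
  by have [<- <-] := He v vw hv.
exists F.
  move=> z; have [hG _] := HG z; apply: hol_cdiff; apply: hol_ext hG.
  by apply: nbh_mono (FE z) => w ->.
apply/mero_eqP => z; have [_ E] := HG z.
by apply: pnbh_mono (pnbhI E (nbh_pnbh (FE z))) => w _ [-> ->].
Qed.
End Germs.

(** * Laurent expansions of a solution at a pole *)
Section Poles.
Variable R : realType.
Notation C := (Cplx R).
Implicit Types (f g h s : C -> C) (z w a b c l x : C).

Lemma ffallSr (A : comNzRingType) (x : A) n : ffall x n.+1 = ffall x n * (x - n%:R).
Proof. by rewrite /ffall big_ord_recr. Qed.
Lemma ffall0 (A : comNzRingType) (x : A) : ffall x 0 = 1.
Proof. by rewrite /ffall big_ord0. Qed.
Lemma ffallSl (A : comNzRingType) (x : A) n : ffall x n.+1 = x * ffall (x - 1) n.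
Proof.
rewrite /ffall big_ord_recl /= subr0; congr (_ * _); apply: eq_bigr => i _.
by rewrite /bump leq0n add1n -natr1; ring.
Qed.
(** The derivatives of [z^-m] have falling factorials of [- m] as coefficients;
    this relation turns their quotients into the coefficients of the associated
    polynomial. *)
Lemma ffall_neg_split (A : comNzRingType) m n t :
  ffall (- m%:R : A) (n + t) =
  ffall (- m%:R) n * ((-1) ^+ t * ffall ((n + t)%:R + m%:R - 1) t).
Proof.
elim: t => [|t IH]; first by rewrite addn0 ffall0 !mulr1.
rewrite addnS ffallSr IH ffallSl -natr1.
have -> : (n + t)%:R + 1 + m%:R - 1 = (n + t)%:R + m%:R :> A by ring.
rewrite exprS; ring.
Qed.
Lemma ffall_neg_neq0 m n : (0 < m)%N -> ffall (- m%:R : C) n != 0.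
Proof.
move=> m0; rewrite /ffall; apply/prodf_neq0 => i _.
by rewrite -opprD oppr_eq0 -natrD pnatr_eq0 -lt0n addn_gt0 m0.
Qed.

Lemma rmorph_ffall (A B : comNzRingType) (phi : {rmorphism A -> B}) (x : A) n :
  phi (ffall x n) = ffall (phi x) n.
Proof. by rewrite /ffall rmorph_prod; apply: eq_bigr => i _; rewrite rmorphB rmorph_nat. Qed.

Lemma assoc_poly_root k d (j : 'I_d -> nat) m n :
  ffall (n%:R - m%:R : C) k =
   \sum_(i < d) (-1) ^+ (k - j i) * ffall (k%:R + m%:R - 1) (k - j i) * ffall (n%:R - m%:R) (j i) ->
  root (assoc_poly k j m) n%:Z.
Proof.
move=> H; rewrite /root /assoc_poly hornerD hornerN horner_sum.
have hf t : (ffall ('X - (m%:R)%:P) t : {poly int}).[n%:Z] = ffall (n%:Z - m%:R) t.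
  rewrite /ffall horner_prod; apply: eq_bigr => i _.
  by rewrite !hornerE -polyC_natr hornerC.
rewrite hf -(intr_eq0 C) rmorphB rmorph_sum subr_eq0; apply/eqP.
have hi t : (ffall (n%:Z - m%:R) t)%:~R = ffall (n%:R - m%:R) t :> C.
  by rewrite rmorph_ffall rmorphB rmorph_nat /=.
rewrite /= hi H; apply: eq_bigr => i _.
rewrite hornerM hornerC hf rmorphM /= hi; congr (_ * _).
by rewrite rmorphM rmorphXn rmorphN rmorph1 rmorph_ffall rmorphB rmorphD !rmorph_nat rmorph1.
Qed.

(** The numerators of the derivatives: if [f = g / (z - b)^m] then
    [f^(n) = lnum g b m n / (z - b)^(m + n)] (see [lnum_deriv]). *)
Fixpoint lnum g b m n : C -> C := if n is n'.+1 then
    fun z => (z - b) * (lnum g b m n')^`()%classic z - (m + n')%:R * lnum g b m n' z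
  else g.

Lemma lnum_hol g b m n : hol g b -> hol (lnum g b m n) b.
Proof.
move=> hg; elim: n => [|n IH] //=.
apply: holB; apply: holM => //; [exact: hol_sub|exact: hol_derive|exact: hol_cst].
Qed.

Lemma lnum_at g b m n : lnum g b m n b = ffall (- m%:R) n * g b.
Proof.
elim: n => [|n IH] /=; first by rewrite ffall0 mul1r.
by rewrite IH subrr mul0r sub0r ffallSr natrD; ring.
Qed.

Lemma lnum_deriv f g b m : hol g b -> pnbh b (fun w => f w = g w / (w - b) ^+ m) ->
  forall n, pnbh b (fun w => (f^`(n))%classic w = lnum g b m n w / (w - b) ^+ (m + n)).
Proof.
move=> hg H; elim=> [|n IH]; first by rewrite addn0.
have := pnbhI (pnbh_nbh IH) (nbh_pnbh (hol_nbh (lnum_hol m n hg))).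
apply: pnbh_mono => w wb [E hw]; rewrite derive1nS.
have w0 : w - b != 0 by rewrite subr_eq0.
have wn : (w - b) ^+ (m + n) != 0 by rewrite expf_neq0.
have D1 := is_cderM (hol_cder hw) (@is_cderV _ (fun v => (v - b) ^+ (m + n)) w _ wn (is_cderX (m + n) (is_cder_subid b w))).
have D2 := is_cder_ext (nbh_mono (fun v (e : _ = _) => esym e) E) D1.
rewrite (is_cder_derive1 D2) /= addnS.
case: (m + n)%N wn => [|N] wn; first by rewrite !expr0 !expr1 /=; field.
by rewrite /= [(w - b) ^+ N.+2]exprS [(w - b) ^+ N.+1]exprS; field; rewrite w0 /= expf_neq0.
Qed.

Lemma order_match G P b A B : hol G b -> hol P b -> G b != 0 -> P b != 0 ->
  pnbh b (fun w => G w / (w - b) ^+ A = P w / (w - b) ^+ B) -> A = B /\ nbh b (fun w => G w = P w).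
Proof.
have aux G' P' A' B' : hol G' b -> hol P' b -> P' b != 0 ->
    pnbh b (fun w => G' w / (w - b) ^+ A' = P' w / (w - b) ^+ B') -> (B' <= A')%N.
  move=> hG hP P0 H; rewrite leqNgt; apply/negP => lt; move/eqP: P0; apply.
  have -> : 0 = G' b * (b - b) ^+ (B' - A') :> C.
    by rewrite subrr expr0n gtn_eqF ?subn_gt0 // mulr0.
  apply: (ccont_eq (g := fun w => G' w * (w - b) ^+ (B' - A')) (hol_cont hP)).
    by apply: hol_cont; apply: holM => //; apply: holX; exact: hol_sub.
  apply: pnbh_mono (pnbhI H (pnbh_sub0 b 1)) => w wb [E w0]; rewrite expr1 in w0.
  have wB : (w - b) ^+ B' != 0 by rewrite expf_neq0.
  have -> : P' w = G' w / (w - b) ^+ A' * (w - b) ^+ B' by rewrite E divfK.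
  have wA : (w - b) ^+ A' != 0 by rewrite expf_neq0.
  by rewrite -{1}(subnK (ltnW lt)) exprD; field.
move=> hG hP G0 P0 H.
have le1 := aux _ _ _ _ hG hP P0 H.
have le2 : (A <= B)%N by apply: (aux P G B A) => //; apply: pnbh_mono H => w _ ->.
have AB : A = B by apply/eqP; rewrite eqn_leq le1 le2.
split=> //; have E : pnbh b (fun w => G w = P w).
  apply: pnbh_mono (pnbhI H (pnbh_sub0 b A)) => w wb [+ w0].
  by rewrite -AB => /(congr1 (fun x => x * (w - b) ^+ A)); rewrite !divfK.
by apply: pnbh_nbh_at (E) _; exact: ccont_eq (hol_cont hG) (hol_cont hP) E.
Qed.

Section Ode.
Variables (k d : nat) (j : 'I_d -> nat) (f : C -> C).
Hypothesis (f_mero : meromorphic f) (f_sol : is_ode_solution k j f).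

(** The equation in terms of numerators; the powers of [z - b] on both sides must
    agree because no numerator vanishes at [b]. *)
Lemma pole_ode b m g : (0 < m)%N -> hol g b -> g b != 0 ->
  pnbh b (fun w => f w = g w / (w - b) ^+ m) ->
  (m + k = \sum_(i < d) (m + j i))%N /\
  nbh b (fun w => lnum g b m k w = \prod_(i < d) lnum g b m (j i) w).
Proof.
move=> m0 hg g0 H; have dv := lnum_deriv hg H.
apply: order_match.
- exact: lnum_hol.
- by apply: hol_prod => i; exact: lnum_hol.
- by rewrite lnum_at mulf_neq0 // ffall_neg_neq0.
- by apply/prodf_neq0 => i _; rewrite lnum_at mulf_neq0 // ffall_neg_neq0.
have all_i : pnbh b (fun w => forall i, (f^`(j i))%classic w = lnum g b m (j i) w / (w - b) ^+ (m + j i)).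
  have : forall s : seq 'I_d, pnbh b (fun w => forall i, i \in s ->
     (f^`(j i))%classic w = lnum g b m (j i) w / (w - b) ^+ (m + j i)).
    elim=> [|i s IH]; first by exists 1.
    apply: pnbh_mono (pnbhI (dv (j i)) IH) => w _ [E1 E2] i'.
    by rewrite inE => /orP[/eqP ->|/E2].
  by move=> /(_ (index_enum 'I_d)); apply: pnbh_mono => w _ E i; apply: E; rewrite mem_index_enum.
have ode := proj1 (mero_eqP _ _) f_sol b.
apply: pnbh_mono (pnbhI ode (pnbhI (dv k) all_i)) => w _ [E [<- Ei]].
by rewrite E (eq_bigr _ (fun i _ => Ei i)) big_split /= prodfV prodrXr.
Qed.

Lemma pole_order_uniq b m b' m' : (1 < d)%N ->
  pole_of_order f b m -> pole_of_order f b' m' -> m = m'.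
Proof.
move=> d1 /poleP [m0 [g [hg g0 H]]] /poleP [m0' [g' [hg' g0' H']]].
have [E _] := pole_ode m0 hg g0 H; have [E' _] := pole_ode m0' hg' g0' H'.
move: E E'; rewrite !big_split /= !sum_nat_const card_ord => E E'.
have : ((d - 1) * m = (d - 1) * m')%N by rewrite !mulnBl !mul1n; lia.
by move/eqP; rewrite eqn_pmul2l ?subn_gt0 // => /eqP.
Qed.

(** The difference of two products whose factors agree up to order [e], to leading
    order: the logarithmic derivative of the product. *)
Lemma prod_expand n (A B s : 'I_n -> C -> C) e :
  (forall i, ccont (A i) 0) -> (forall i, ccont (B i) 0) -> (forall i, ccont (s i) 0) ->
  (forall i, A i 0 = B i 0) -> (forall i, A i 0 != 0) ->
  nbh 0 (fun z => forall i, A i z - B i z = z ^+ e * s i z) ->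
  exists S, [/\ ccont S 0, S 0 = (\prod_i A i 0) * \sum_i (s i 0 / A i 0) &
    nbh 0 (fun z => \prod_i A i z - \prod_i B i z = z ^+ e * S z)].
Proof.
elim: n A B s => [|n IH] A B s cA cB cs AB A0 H.
  exists (fun=> 0); split; [exact: ccont_cst|by rewrite !big_ord0 mulr0|].
  by exists 1 => // z _; rewrite !big_ord0 subrr mulr0.
have [||||||S [cS S0 SE]] := IH (fun i => A (widen_ord (leqnSn n) i))
  (fun i => B (widen_ord (leqnSn n) i)) (fun i => s (widen_ord (leqnSn n) i)) => //.
  by apply: nbh_mono H => z Hz i; exact: Hz.
exists (fun z => S z * A ord_max z + (\prod_(i < n) B (widen_ord (leqnSn n) i) z) * s ord_max z); split.
- apply: ccontD; apply: ccontM => //.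
  by apply: ccont_prod => i; exact: cB.
- have <- : \prod_(i < n) A (widen_ord (leqnSn n) i) 0 = \prod_(i < n) B (widen_ord (leqnSn n) i) 0.
    by apply: eq_bigr => i _.
  rewrite S0 !big_ord_recr /=.
  have := A0 ord_max => h; field; exact: h.
- apply: nbh_mono (nbhI SE H) => z [Sz Hz]; rewrite !big_ord_recr /=.
  set PA := \prod_(i < n) A _ z in Sz *; set PB := \prod_(i < n) B _ z in Sz *.
  have -> : PA * A ord_max z - PB * B ord_max z = (PA - PB) * A ord_max z + PB * (A ord_max z - B ord_max z) by ring.
  by rewrite Sz Hz; ring.
Qed.

(** The linearised equation: the first exponent at which [g] fails to be invariant
    under [z |-> c z] is a root of the associated polynomial.  If the numerators of
    [f] differ by [z^n sg_e z] under the dilation, then [sg_e 0] is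
    [(n - m)_e * s 0], and both sides of the equation yield the coefficient of
    [z^n]. *)
Lemma resonance b m g c n s : (0 < m)%N -> (forall i, (j i < k)%N) ->
  hol g b -> g b != 0 -> pnbh b (fun w => f w = g w / (w - b) ^+ m) -> c != 0 ->
  hol s 0 -> s 0 != 0 -> (forall z, g (1 * z + b) - g (c * z + b) = z ^+ n * s z) ->
  pos_int_root (assoc_poly k j m) n.
Proof.
move=> m0 hj hg g0 H c0 hs s0 E0.
have [_ gE] := pole_ode m0 hg g0 H.
have aff0 x : x * 0 + b = b by rewrite mulr0 add0r.
have hgd e x : hol (fun z => lnum g b m e (x * z + b)) 0.
  by apply: (@hol_comp _ (fun z => x * z + b)); [exact: hol_aff|rewrite aff0; exact: lnum_hol].
pose U e z := lnum g b m e (1 * z + b) - lnum g b m e (c * z + b).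
have US e : nbh 0 (fun z => U e.+1 z = z * (U e)^`()%classic z - (m + e)%:R * U e z).
  have hn x : x != 0 -> nbh 0 (fun z => hol (lnum g b m e) (x * z + b)).
    by move=> x0; apply: nbh_aff => //; rewrite aff0; exact: hol_nbh (lnum_hol m e hg).
  apply: nbh_mono (nbhI (hn 1 (oner_neq0 _)) (hn c c0)) => z [h1 hc].
  have dd x : hol (lnum g b m e) (x * z + b) ->
      is_cder (fun v => lnum g b m e (x * v + b)) z ((lnum g b m e)^`()%classic (x * z + b) * x).
    move=> hx; apply: (@is_cder_comp _ (fun v => x * v + b)); last exact: hol_cder.
    have := is_cderD (is_cderM (is_cder_cst x z) (is_cder_id z)) (is_cder_cst b z).
    by rewrite mul0r add0r mulr1 addr0.
  have := is_cder_derive1 (is_cderD (dd _ h1) (is_cderN (dd _ hc))).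
  rewrite /U /= => ->.
  move: ((lnum g b m e)^`()%classic (1 * z + b)) ((lnum g b m e)^`()%classic (c * z + b)).
  by move: (lnum g b m e (1 * z + b)) (lnum g b m e (c * z + b)) => x1 x2 x3 x4; ring.
have [sg [hsg sg0 sgE]] : exists sg : nat -> C -> C, [/\ forall e, hol (sg e) 0,
    forall e, sg e 0 = ffall (n%:R - m%:R) e * s 0 & forall e, nbh 0 (fun z => U e z = z ^+ n * sg e z)].
  pose sg := fix sg e : C -> C := if e is e'.+1 then
     fun z => z * (sg e')^`()%classic z + (n%:R - m%:R - e'%:R) * sg e' z else s.
  have hsg e : hol (sg e) 0.
    elim: e => [|e IH] //=; apply: holD; apply: holM => //; [exact: hol_id|exact: hol_derive|exact: hol_cst].
  exists sg; split=> //.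
    elim=> [|e IH] /=; first by rewrite ffall0 mul1r.
    by rewrite IH mul0r add0r ffallSr; ring.
  elim=> [|e IH]; first by exists 1 => // z _; exact: E0.
  apply: nbh_mono (nbhI (US e) (nbhI (nbh_nbh IH) (hol_nbh (hsg e)))) => z [-> [Ez hz]].
  have D1 := is_cderM (is_cderX n (is_cder_id z)) (hol_cder hz).
  have D2 := is_cder_ext (nbh_mono (fun v (e : _ = _) => esym e) Ez) D1.
  rewrite (is_cder_derive1 D2) (nbh_at Ez) /= natrD.
  move: ((sg e)^`()%classic z) (sg e z) => y1 y2.
  have -> : z * (n%:R * z ^+ n.-1 * 1 * y2 + z ^+ n * y1)
     = n%:R * (z * z ^+ n.-1) * y2 + z ^+ n * (z * y1) by ring.
  have -> : n%:R * (z * z ^+ n.-1) = n%:R * z ^+ n by case: (n) => [|n']; rewrite ?mul0r // -exprS.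
  ring.
split.
  rewrite lt0n; apply/negP => /eqP n0; move: (E0 0); rewrite !aff0 subrr n0 expr0 mul1r => /esym/eqP.
  by rewrite (negbTE s0).
have [||||||S [cS S0 SE]] := @prod_expand d (fun i z => lnum g b m (j i) (1 * z + b))
  (fun i z => lnum g b m (j i) (c * z + b)) (fun i => sg (j i)) n.
- by move=> i; exact: hol_cont.
- by move=> i; exact: hol_cont.
- by move=> i; exact: hol_cont.
- by move=> i; rewrite !aff0.
- by move=> i; rewrite aff0 lnum_at mulf_neq0 // ffall_neg_neq0.
- have : forall t : seq 'I_d, nbh 0 (fun z => forall i, i \in t ->
     lnum g b m (j i) (1 * z + b) - lnum g b m (j i) (c * z + b) = z ^+ n * sg (j i) z).
    elim=> [|i t IH]; first by exists 1.
    apply: nbh_mono (nbhI (sgE (j i)) IH) => w [E1 E2] i'.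
    by rewrite inE => /orP[/eqP ->|/E2].
  by move=> /(_ (index_enum 'I_d)); apply: nbh_mono => w E i; apply: E; rewrite mem_index_enum.
have key : sg k 0 = S 0.
  apply: (ccont_eq (hol_cont (hsg k)) cS).
  have g1 : nbh 0 (fun z => lnum g b m k (1 * z + b) = \prod_(i < d) lnum g b m (j i) (1 * z + b)).
    by apply: (@nbh_aff _ 1 b 0 (fun w => lnum g b m k w = \prod_(i < d) lnum g b m (j i) w)); [exact: oner_neq0|rewrite aff0].
  have g2 : nbh 0 (fun z => lnum g b m k (c * z + b) = \prod_(i < d) lnum g b m (j i) (c * z + b)).
    by apply: (@nbh_aff _ c b 0 (fun w => lnum g b m k w = \prod_(i < d) lnum g b m (j i) w)); [|rewrite aff0].
  apply: pnbh_mono (nbh_pnbh (nbhI (nbhI g1 g2) (nbhI (sgE k) SE))) => z z0 [[e1 e2] [e3 e4]].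
  have zn : z ^+ n != 0 by rewrite expf_neq0.
  by apply: (mulfI zn); rewrite -e3 -e4 /U e1 e2.
apply: assoc_poly_root.
move: key; rewrite sg0 S0.
have -> : \prod_(i < d) lnum g b m (j i) (1 * 0 + b) = ffall (- m%:R) k * g b.
  by rewrite -lnum_at (nbh_at gE); apply: eq_bigr => i _; rewrite aff0.
move=> key; apply: (mulIf s0); rewrite key mulr_sumr mulr_suml; apply: eq_bigr => i _.
rewrite sg0 aff0 lnum_at.
have := ffall_neg_split C m (j i) (k - j i); rewrite subnKC ?(ltnW (hj i)) // => ->.
have F0 := ffall_neg_neq0 (j i) m0.
by field; rewrite F0 g0.
Qed.

(** The hypothesis on [c] is empty if there are no positive integer roots; [q] may
    depend on the root [n] that is to be excluded. *)
Lemma scaling_invariance b m g c : (0 < m)%N -> (forall i, (j i < k)%N) ->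
  hol g b -> g b != 0 -> pnbh b (fun w => f w = g w / (w - b) ^+ m) -> c != 0 ->
  (forall n, pos_int_root (assoc_poly k j m) n -> exists2 q, (0 < q)%N & c ^+ q = 1 /\ c ^+ n = 1) ->
  nbh 0 (fun z => g (1 * z + b) = g (c * z + b)).
Proof.
move=> m0 hj hg g0 H c0 Hroot.
have aff0 x : x * 0 + b = b by rewrite mulr0 add0r.
have hgx x : hol (fun z => g (x * z + b)) 0.
  by apply: (@hol_comp _ (fun z => x * z + b)); [exact: hol_aff|rewrite aff0].
case: (hol_order (holB (hgx 1) (hgx c))) => [|[n [s [hs s0 sE]]]].
  by apply: nbh_mono => z /eqP; rewrite subr_eq0 => /eqP.
have sE' z : g (1 * z + b) - g (c * z + b) = z ^+ n * s z by rewrite sE subr0.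
have := resonance m0 hj hg g0 H c0 hs s0 sE' => /Hroot [q q0 [cq cn]].
exfalso; move/eqP: s0; apply.
have hsum : ccont (fun z => \sum_(i < q) s (c ^+ i * z)) 0.
  have : forall N, ccont (fun z => \sum_(i < N) s (c ^+ i * z)) 0.
    elim=> [|N IH]; first by under [X in ccont X]eq_fun do rewrite big_ord0; exact: ccont_cst.
    under [X in ccont X]eq_fun do rewrite big_ord_recr; apply: ccontD => //.
    apply: (@ccont_comp _ (fun z => c ^+ N * z)); last by rewrite mulr0; exact: hol_cont.
    by apply: ccontM; [exact: ccont_cst|exact: ccont_id].
  exact.
have : \sum_(i < q) s (c ^+ i * 0) = 0.
  apply: (ccont_eq hsum (ccont_cst 0 0)).
  exists 1 => // z z0 _; have zn : z ^+ n != 0 by rewrite expf_neq0.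
  apply: (mulfI zn); rewrite mulr0 mulr_sumr.
  (* [c^n = 1] gives all terms the same factor [z^n]; the differences of [g]
     telescope because [c^q = 1]. *)
  transitivity (\sum_(i < q) (g (c ^+ i * z + b) - g (c ^+ i.+1 * z + b))).
    apply: eq_bigr => i _; have := sE' (c ^+ i * z).
    rewrite exprMn -exprM mulnC exprM cn expr1n !mul1r => <-.
    by rewrite mulrA -exprS.
  rewrite -(big_mkord xpredT (fun i => g (c ^+ i * z + b) - g (c ^+ i.+1 * z + b))).
  have -> : \sum_(0 <= i < q) (g (c ^+ i * z + b) - g (c ^+ i.+1 * z + b)) =
     - \sum_(0 <= i < q) (g (c ^+ i.+1 * z + b) - g (c ^+ i * z + b)).
    by rewrite -sumrN; apply: eq_bigr => i _; rewrite opprB.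
  by rewrite (telescope_sumr (fun i => g (c ^+ i * z + b))) // cq expr0 subrr oppr0.
under eq_bigr do rewrite mulr0; rewrite sumr_const card_ord -mulr_natl => /eqP.
by rewrite mulf_eq0 pnatr_eq0 gtn_eqF //= => /eqP.
Qed.

(** Invariance under the dilation of ratio 2 makes [g] constant near the pole. *)
Lemma no_root_rational b m : (forall i, (j i < k)%N) -> pole_of_order f b m ->
  (forall n, ~ pos_int_root (assoc_poly k j m) n) -> rational_fun f.
Proof.
move=> hj /poleP [m0 [g [hg g0 H]]] nr_.
have two0 : (2 : C) != 0 by rewrite pnatr_eq0.
have [e e0 He] := scaling_invariance m0 hj hg g0 H two0 (fun n rn => False_ind _ (nr_ n rn)).
have hc : nbh b (fun w => g w = g b).
  exists e => // w hw; apply/eqP; rewrite -subr_eq0; apply/eqP/nm_eps0 => x x0.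
  have [/(_ x x0) [y y0 Hy]] := hol_cont hg.
  have [n hn] := geo_small (nm (w - b)) y0.
  have E i : g w = g ((w - b) / 2 ^+ i + b) /\ nm ((w - b) / 2 ^+ i) < e.
    elim: i => [|i [-> IH]]; first by rewrite expr0 divr1 subrK.
    have hlt : nm ((w - b) / 2 ^+ i.+1) < e.
      apply: le_lt_trans IH; have -> : (w - b) / 2 ^+ i.+1 = (w - b) / 2 ^+ i / 2.
        by rewrite exprSr invfM mulrA.
      by rewrite nm_half; have := nm_ge0 ((w - b) / 2 ^+ i); lra.
    have := He ((w - b) / 2 ^+ i.+1); rewrite subr0 => /(_ hlt) E1; split=> //.
    rewrite mul1r in E1; rewrite E1; congr (g (_ + b)).
    by rewrite exprS; field; rewrite expf_neq0.
  have [-> _] := E n; apply/ltW/Hy; rewrite addrK nmM nmV nmX nm2 //.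
have mr : meromorphic (fun z => g b / (z - b) ^+ m).
  apply/meroP => z; have [->|zb] := eqVneq z b.
    right; exists m; apply/poleP; split=> //; exists (fun=> g b); split=> //; first exact: hol_cst.
    by exists 1.
  left; apply: holM; first exact: hol_cst.
  by apply: holV; [rewrite expf_neq0 // subr_eq0|apply: holX; exact: hol_sub].
exists (g b)%:P, (('X - b%:P) ^+ m); split; first by rewrite expf_neq0 // polyXsubC_eq0.
have -> : (fun z => (g b)%:P.[z] / (('X - b%:P) ^+ m).[z]) = (fun z => g b / (z - b) ^+ m).
  by apply/funext => z; rewrite hornerC horner_exp hornerXsubC.
apply: (@identity_thm _ _ _ b) => //.
by apply: pnbh_mono (pnbhI H (nbh_pnbh hc)) => w _ [-> ->].
Qed.

(** The invariance of the germ [g], read for [f] and continued analytically. *)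
Lemma rotation b m c q : (forall i, (j i < k)%N) -> pole_of_order f b m ->
  (0 < q)%N -> c ^+ q = 1 -> (forall n, pos_int_root (assoc_poly k j m) n -> c ^+ n = 1) ->
  mero_eq (fun z => c ^+ m * f (c * z + (b - c * b))) f.
Proof.
move=> hj pf q0 cq Hc.
have c0 : c != 0.
  by apply/negP => /eqP c0; move: cq; rewrite c0 expr0n gtn_eqF // => /esym/eqP; rewrite oner_eq0.
have cm : c ^+ m != 0 by rewrite expf_neq0.
have := pf => /poleP [m0 [g [hg g0 H]]].
have inv := scaling_invariance m0 hj hg g0 H c0 (fun n rn => ex_intro2 _ _ q q0 (conj cq (Hc n rn))).
apply: (@identity_thm _ _ _ b) => //; first exact: mero_aff.
have cb : c * b + (b - c * b) = b by ring.
have H1 := @pnbh_aff _ c (b - c * b) b _ c0; rewrite cb in H1.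
have I1 := @nbh_aff _ 1 (- b) b _ (oner_neq0 _); rewrite mul1r subrr in I1.
apply: pnbh_mono (pnbhI (pnbhI H (H1 _ H)) (pnbhI (nbh_pnbh (I1 _ inv)) (pnbh_sub0 b m))) => w wb [[-> ->] [E w0]].
have -> : c * w + (b - c * b) - b = c * (w - b) by ring.
have -> : c * w + (b - c * b) = c * (1 * w - b) + b by ring.
rewrite -E !mul1r subrK exprMn; field; rewrite w0; exact: cm.
Qed.
End Ode.
End Poles.

(** * The complex exponential *)
(* The comparison with the coordinates in the definition of [cexp]. *)
Transparent Cplx rc Rez Imz.
Section Cexp0.
Variable R : realType.
Notation C := (Cplx R).

Lemma cexpE (z : C) : cexp z = rc (expR (Rez z)) * (rc (cos (Imz z)) + 'i * rc (sin (Imz z))).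
Proof.
rewrite /cexp /rc /Rez /Imz; congr (_ * _); rewrite -complexiE.
by apply/eqP; rewrite eq_complex /=; apply/andP; split; apply/eqP; ring.
Qed.
(** A sealed copy of [cexp]: rewriting never looks for products inside it. *)
Definition ce (z : C) : C := locked (cexp z).
Lemma ceE z : ce z = cexp z. Proof. by rewrite /ce -lock. Qed.
Lemma Rez_ce (z : C) : Rez (ce z) = expR (Rez z) * cos (Imz z).
Proof. by rewrite ceE cexpE RezM Rez_r Imz_r mul0r subr0 Rez_rc. Qed.
Lemma Imz_ce (z : C) : Imz (ce z) = expR (Rez z) * sin (Imz z).
Proof. by rewrite ceE cexpE ImzM Rez_r Imz_r mul0r addr0 Imz_rc. Qed.
Lemma C_eq (z w : C) : Rez z = Rez w -> Imz z = Imz w -> z = w.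
Proof. by rewrite (CE z) (CE w) !Rez_rc !Imz_rc => -> ->. Qed.
End Cexp0.
Opaque Cplx rc Rez Imz cexp.

Section Cexp.
Variable R : realType.
Notation C := (Cplx R).
Implicit Types (f g h : C -> C) (z w a b c l : C) (x y e r : R).

Lemma ceD z w : ce (z + w) = ce z * ce w.
Proof.
by apply: C_eq; [rewrite RezM|rewrite ImzM]; rewrite !Rez_ce !Imz_ce RezD ImzD expRD; [rewrite cosD; ring|rewrite sinD; ring].
Qed.
Lemma ce0 : ce (0 : C) = 1.
Proof.
by apply: C_eq; rewrite ?Rez_ce ?Imz_ce -rc0 -rc1 !Rez_r !Imz_r expR0 ?cos0 ?sin0 ?mulr1 ?mulr0.
Qed.
Lemma nm_ce z : nm (ce z) = expR (Rez z).
Proof.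
apply/eqP; rewrite -(@eqrXn2 _ 2) ?nm_ge0 ?expR_ge0 // nm_sqr Rez_ce Imz_ce !exprMn -mulrDr.
by rewrite cos2Dsin2 mulr1.
Qed.
Lemma ce_neq0 z : ce z != 0.
Proof. by rewrite -nm_gt0 nm_ce expR_gt0. Qed.
Lemma ceN z : ce (- z) = (ce z)^-1.
Proof. by apply: (mulfI (ce_neq0 z)); rewrite -ceD subrr ce0 divff // ce_neq0. Qed.
Lemma ceMn n z : ce (n%:R * z) = ce z ^+ n.
Proof.
elim: n => [|n IH]; first by rewrite mul0r ce0.
by rewrite -natr1 mulrDl mul1r ceD IH exprSr.
Qed.

Lemma real_derive_eps (f : R -> R) x (l : R) e : is_derive x 1 f l -> 0 < e ->
  exists2 d, 0 < d & forall h : R, `|h| < d -> `|f (x + h) - f x - h * l| <= e * `|h|.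
Proof.
move=> [df dl] e0; have H : ((fun h : R => h^-1 *: (f (h + x) - f x)) @ 0^' --> l)%classic.
  rewrite -dl; have := df; rewrite /derivable /derive; under eq_fun do rewrite /= [_ *: 1]mulr1.
  by move=> K; exact: K.
move: H => /cvgrPdist_le /(_ e e0) /nbhs_ballP [d /= d0 Hd].
exists d => // h hd; have [->|h0] := eqVneq h 0.
  by rewrite addr0 subrr mul0r subrr normr0 mulr0.
have := Hd h; rewrite /ball /= sub0r normrN => /(_ hd h0).
have -> : f (x + h) - f x - h * l = - (h * (l - h^-1 *: (f (h + x) - f x))).
  by rewrite /GRing.scale /= [h + x]addrC; field.
by rewrite normrN normrM mulrC => H; rewrite ler_wpM2r.
Qed.

(** At the origin this reduces to the real derivatives of the exponential, sine and
    cosine; [d4] bounds the factor [expR x]. *)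
Lemma ce_cder0 : is_cder (@ce R) 0 1.
Proof.
split=> e e0; have e10 : 0 < e / 10 by rewrite divr_gt0.
have [d1 d10 H1] := real_derive_eps (@is_derive_expR R 0) e10.
have [d2 d20 H2] := real_derive_eps (@is_derive_sin R 0) e10.
have [d3 d30 H3] := real_derive_eps (@is_derive_cos R 0) e10.
have [d4 d40 H4] := real_derive_eps (@is_derive_expR R 0) (@ltr01 R).
pose d := Num.min (Num.min d1 d2) (Num.min (Num.min d3 d4) (Num.min (1 / 2) (e / 10))).
exists d; first by rewrite !lt_min d10 d20 d30 d40 e10 divr_gt0.
move=> h; rewrite /d !lt_min => /andP[/andP[h1 h2] /andP[/andP[h3 h4] /andP[h5 h6]]].
set x := Rez h; set y := Imz h.
have xh : `|x| <= nm h := Re_le_nm h; have yh : `|y| <= nm h := Im_le_nm h.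
have k1 : `|expR x - 1 - x| <= e / 10 * `|x|.
  by have := H1 x (le_lt_trans xh h1); rewrite add0r expR0 mulr1.
have k2 : `|sin y - y| <= e / 10 * `|y|.
  by have := H2 y (le_lt_trans yh h2); rewrite add0r sin0 cos0 mulr1 subr0.
have k3 : `|cos y - 1| <= e / 10 * `|y|.
  by have := H3 y (le_lt_trans yh h3); rewrite add0r sin0 cos0 oppr0 mulr0 subr0.
have k4 : `|expR x - 1 - x| <= `|x|.
  by have := H4 x (le_lt_trans xh h4); rewrite add0r expR0 mulr1 mul1r.
rewrite ce0 add0r mulr1.
apply: le_trans (nm_le_ReIm _) _.
rewrite !RezD !ImzD !RezN !ImzN Rez_ce Imz_ce -rc1 Rez_r Imz_r -/x -/y.
have E2 : expR x <= 2.
  have := ler_norm (expR x - 1 - x); have := ler_norm x; lra.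
have Ex1 : `|expR x - 1| <= 2 * `|x|.
  have -> : expR x - 1 = (expR x - 1 - x) + x by ring.
  by apply: le_trans (ler_normD _ _) _; lra.
have E0 : 0 <= expR x by exact: expR_ge0.
have A1 : `|expR x * cos y - 1 - x| <= e / 10 * `|x| + 2 * (e / 10 * `|y|).
  have -> : expR x * cos y - 1 - x = (expR x - 1 - x) + expR x * (cos y - 1) by ring.
  apply: le_trans (ler_normD _ _) _; rewrite normrM (ger0_norm E0); apply: lerD => //.
  by apply: ler_pM.
have A2 : `|expR x * sin y - 0 - y| <= 2 * (e / 10 * `|y|) + 2 * `|x| * `|y|.
  have -> : expR x * sin y - 0 - y = expR x * (sin y - y) + (expR x - 1) * y by ring.
  apply: le_trans (ler_normD _ _) _; rewrite !normrM (ger0_norm E0); apply: lerD.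
    by apply: ler_pM.
  by rewrite ler_wpM2r.
have N0 := nm_ge0 h.
have B1 := ler_wpM2l (ltW e10) xh; have B2 := ler_wpM2l (ltW e10) yh.
have B3 : `|x| * `|y| <= e / 10 * nm h by apply: ler_pM => //; lra.
have EN : 0 <= e * nm h by rewrite mulr_ge0 // ltW.
have : e / 10 * nm h = (e * nm h) / 10 by field.
move=> EE; apply: le_trans (lerD A1 A2) _; rewrite -[2 * `|x| * _]mulrA.
rewrite EE in B1 B2 B3.
apply: le_trans (_ : e * nm h / 10 + 2 * (e * nm h / 10) + (2 * (e * nm h / 10) + 2 * (e * nm h / 10)) <= _); last by lra.
by rewrite !lerD // ler_pM2l.
Qed.

Lemma is_cder_ce z : is_cder (@ce R) z (ce z).
Proof.
have [H] := ce_cder0; split=> e e0; have c0 : 0 < nm (ce z) by rewrite nm_gt0 ce_neq0.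
have [d d0 Hd] := H _ (divr_gt0 e0 c0); exists d => // h /Hd; rewrite add0r ce0 mulr1 => Hh.
have -> : ce (z + h) - ce z - h * ce z = ce z * (ce h - 1 - h) by rewrite ceD; ring.
by rewrite nmM; move: Hh; rewrite mulrAC ler_pdivlMr // mulrC.
Qed.
End Cexp.

(** * Growth of solutions *)
Section Growth.
Variable R : realType.
Notation C := (Cplx R).
Implicit Types (f g : C -> C) (z w a b c l : C) (x y r : R).

(** The radius on which Cauchy's estimate (derivative at most [16 * 3 / (1/4)]) keeps
    a power of the function within [1/2] of its value at the centre. *)
Definition rho0 : R := 1 / 384.
(** A function bounded by almost one with value one at the centre is almost
    constant near the centre: its [n]-th power has a derivative bounded
    independently of [n], and that derivative contains the factor [n]. *)
Lemma near_one (H : C -> C) n : (0 < n)%N -> cdiff_ball H 0 1 -> H 0 = 1 ->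
  (forall w, nm w <= 1 -> nm (H w) ^+ n <= 3) ->
  forall w, nm w <= rho0 -> nm (H w - 1) <= 3 / n%:R.
Proof.
move=> n0 hH H1 bH; pose v w := H w ^+ n.
have hv : cdiff_ball v 0 1 by move=> w /hH; exact: cdiffX.
have n0' : 0 < n%:R :> R by rewrite ltr0n.
have dv w l : nm w <= 1 / 2 -> is_cder v w l -> nm l <= 192.
  move=> hw hl; have -> : (192 : R) = 16 * 3 / (1 / 4) by field.
  have q4 : (0 : R) < 1 / 4 by rewrite divr_gt0.
  apply: (@cauchy_est _ v w (1 / 4) 3 l q4) => //.
    by move=> z hz; apply: hv; rewrite subr0; have := nm_tri w z 0; rewrite !subr0; lra.
  move=> z hz; rewrite /v nmX; apply: bH; have := nm_tri w z 0; rewrite !subr0; lra.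
have ball_in (r : R) : r <= 1 / 2 -> forall w, nm (w - 0) <= r -> nm w <= 1 / 2.
  by move=> hr w; rewrite subr0; lra.
have rr : rho0 <= 1 / 2 by rewrite /rho0; lra.
have r0 : 0 <= rho0 by rewrite /rho0; lra.
have v1 w : nm w <= rho0 -> nm (v w - 1) <= 1 / 2.
  move=> hw; have v0 : v 0 = 1 by rewrite /v H1 expr1n.
  rewrite -v0; apply: le_trans (_ : 192 * nm (w - 0) <= _); last by rewrite subr0 /rho0 in hw *; lra.
  apply: (@mean_value _ (fun z => nm (z - 0) <= rho0)); first exact: region_ball.
  - move=> z hz; have hz2 := ball_in _ rr z hz.
    have [l hl] := hv z ltac:(rewrite subr0; lra).
    by exists l => //; exact: dv hl.
  - by rewrite subrr nm0.
  - by rewrite subr0.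
have dH w l : nm w <= rho0 -> is_cder H w l -> nm l <= 1152 / n%:R.
  move=> hw hl; have hvl : is_cder v w (n%:R * H w ^+ n.-1 * l) by exact: is_cderX.
  have hw2 : nm w <= 1 / 2 by lra.
  have := dv w _ hw2 hvl; have := v1 w hw.
  have vE : H w ^+ n.-1 * H w = v w by rewrite /v -exprSr prednK.
  have h3 : nm (H w) <= 3.
    rewrite leNgt; apply/negP => h; have := bH w ltac:(lra).
    have : nm (H w) <= nm (H w) ^+ n by apply: ler_eXnr => //; lra.
    lra.
  move=> a1 a2; have vh : 1 / 2 <= nm (v w).
    by have := nm_subr 1 (1 - v w); rewrite nm1 subKr nmB; lra.
  have E : n%:R * nm (v w) * nm l <= 576.
    have -> : n%:R * nm (v w) * nm l = nm (n%:R * H w ^+ n.-1 * l) * nm (H w).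
      by rewrite -vE !nmM nm_nat; ring.
    have -> : (576 : R) = 192 * 3 by ring.
    by apply: ler_pM; rewrite ?nm_ge0.
  rewrite ler_pdivlMr // mulrC.
  have : n%:R * (1 / 2) * nm l <= n%:R * nm (v w) * nm l.
    by rewrite ler_wpM2r ?nm_ge0 // ler_pM2l.
  lra.
move=> w hw; rewrite -H1; apply: le_trans (_ : 1152 / n%:R * nm (w - 0) <= _).
  apply: (@mean_value _ (fun z => nm (z - 0) <= rho0)); first exact: region_ball.
  - move=> z hz; have hz2 := ball_in _ rr z hz.
    have [l hl] := hH z ltac:(rewrite subr0; lra).
    by exists l => //; apply: dH hl; rewrite subr0 in hz.
  - by rewrite subrr nm0.
  - by rewrite subr0.
have -> : 3 / n%:R = 1152 / n%:R * rho0 :> R by rewrite /rho0; field; rewrite gt_eqF.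
rewrite subr0; apply: ler_wpM2l; last exact: hw.
by apply: divr_ge0; [lra|exact: ltW].
Qed.

(** The operator [h |-> h' + h] preserves closeness to 1, on smaller discs.  For
    [H_0 w = f (a + lam w) e^-w / f a] it produces the normalised derivatives
    [H_i w = lam^i f^(i) (a + lam w) e^-w / f a]. *)
Lemma near_one_chain i : exists2 rho, 0 < rho <= 1 & forall eta, 0 < eta -> exists n0, forall n,
  (n0 <= n)%N -> forall Hs : nat -> C -> C,
  (forall e w, nm w <= 1 -> is_cder (Hs e) w (Hs e.+1 w - Hs e w)) ->
  Hs 0%N 0 = 1 -> (forall w, nm w <= 1 -> nm (Hs 0%N w) ^+ n <= 3) ->
  forall w, nm w <= rho -> nm (Hs i w - 1) <= eta.
Proof.
elim: i => [|i [rho /andP[rho_gt rho_le] IH]].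
  exists rho0; first by rewrite /rho0; lra.
  move=> eta eta0; exists (Num.bound (3 / eta)).+1 => n hn Hs dH H1 bH w hw.
  have n0 : (0 < n)%N by exact: leq_trans hn.
  apply: le_trans (near_one n0 _ H1 bH hw) _.
    by move=> z hz; rewrite subr0 in hz; eexists; exact: dH.
  rewrite ler_pdivrMr ?ltr0n // mulrC -ler_pdivrMr //; apply: ltW.
  apply: lt_le_trans (archi_boundP _) _; first by rewrite divr_ge0 // ltW.
  by rewrite ler_nat ltnW.
exists (rho / 2); first by rewrite divr_gt0 //=; lra.
move=> eta eta0; pose q := 64 / rho + 1; have q0 : 0 < q by have : 0 < 64 / rho by [rewrite divr_gt0]; rewrite /q; lra.
have [n0 Hn0] := IH (eta / q) (divr_gt0 eta0 q0).
exists n0 => n hn Hs dH H1 bH w hw.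
have B := Hn0 n hn Hs dH H1 bH.
have w1 : nm w <= 1 by lra.
have D1 := is_cderD (dH i w w1) (is_cder_cst (-1) w).
have : nm (Hs i.+1 w - Hs i w + 0) <= 16 * (eta / q) / (rho / 4).
  apply: (cauchy_est (f := fun w => Hs i w + -1) (a := w)) => //; first by rewrite divr_gt0.
    move=> z hz; have z1 : nm z <= 1 by have := nm_tri w z 0; rewrite !subr0; lra.
    by apply: cdiffD; [eexists; exact: dH|exact: cdiff_cst].
  by move=> z hz; apply: B; have := nm_tri w z 0; rewrite !subr0; lra.
have -> : 16 * (eta / q) / (rho / 4) = 64 / rho * (eta / q) by field; rewrite !gt_eqF.
have Bw := B w ltac:(lra); rewrite addr0 => A.
have -> : Hs i.+1 w - 1 = (Hs i.+1 w - Hs i w) + (Hs i w - 1) by ring.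
apply: le_trans (nmD _ _) _; have : (64 / rho + 1) * (eta / q) = eta by rewrite -/q mulrC divfK // gt_eqF.
lra.
Qed.

Lemma near_one_all k : exists n0, forall n, (n0 <= n)%N -> forall Hs : nat -> C -> C,
  (forall e w, nm w <= 1 -> is_cder (Hs e) w (Hs e.+1 w - Hs e w)) ->
  Hs 0%N 0 = 1 -> (forall w, nm w <= 1 -> nm (Hs 0%N w) ^+ n <= 3) ->
  forall i, (i <= k)%N -> nm (Hs i 0 - 1) <= 1 / 2.
Proof.
have h2 : (0 : R) < 1 / 2 by rewrite divr_gt0.
have at0 i : exists n0, forall n, (n0 <= n)%N -> forall Hs : nat -> C -> C,
  (forall e w, nm w <= 1 -> is_cder (Hs e) w (Hs e.+1 w - Hs e w)) ->
  Hs 0%N 0 = 1 -> (forall w, nm w <= 1 -> nm (Hs 0%N w) ^+ n <= 3) ->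
  nm (Hs i 0 - 1) <= 1 / 2.
  have [rho /andP[r0 _] /(_ _ h2) [n0 H]] := near_one_chain i.
  by exists n0 => n hn Hs h1 h3 h4; apply: (H n hn Hs) => //; rewrite nm0 ltW.
elim: k => [|k [n0 IH]].
  have [n0 H0] := at0 0%N; exists n0 => n hn Hs h1 h3 h4 i; rewrite leqn0 => /eqP ->.
  exact: (H0 n).
have [n1 H1] := at0 k.+1; exists (maxn n0 n1) => n; rewrite geq_max => /andP[hn0 hn1] Hs h1 h3 h4 i.
by rewrite leq_eqVlt => /orP[/eqP ->|]; [exact: (H1 n)|rewrite ltnS; exact: (IH n)].
Qed.

Section Core.
Variables (k d : nat) (j : 'I_d -> nat) (m : nat).
Hypothesis (hd : (1 < d)%N) (hj : forall i, (j i < k)%N).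
Hypothesis weights : (m + k = \sum_(i < d) (m + j i))%N.

Lemma hol_deriv_n f z n : hol f z -> hol (f^`(n)%classic) z.
Proof. by move=> hf; elim: n => [|n IH] //; rewrite derive1nS; exact: hol_derive. Qed.

(** Where [f] looks like an exponential of rate [1 / lam], its derivatives up to
    order [k] at [a] are within a factor of [1/2] to [3/2] of [f a / lam^i].  With
    [X = |f a| |lam|^m] the equation becomes [(X / 2)^d <= 3 / 2 * X], by
    [weights]. *)
Lemma growth_core : exists2 n, (0 < n)%N & forall f a lam,
  (forall w, nm w <= 1 -> hol f (a + lam * w)) -> f a != 0 -> lam != 0 ->
  (f^`(k))%classic a = \prod_(i < d) (f^`(j i))%classic a ->
  (forall w, nm w <= 1 -> nm (f (a + lam * w)) ^+ n <= 3 * (nm (f a) * expR (Rez w)) ^+ n) ->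
  nm (f a) * nm lam ^+ m <= 2 ^+ d.+1.
Proof.
have [n0 Hn0] := near_one_all k; exists n0.+1 => // f a lam hf fa lam0 ode B.
pose Hs e w : C := lam ^+ e / f a * ((f^`(e))%classic (a + lam * w) * ce (- w)).
have dH e w : nm w <= 1 -> is_cder (Hs e) w (Hs e.+1 w - Hs e w).
  move=> /hf hw; have hwe := hol_deriv_n e hw.
  have D0 := is_cderD (is_cder_cst a w) (is_cderM (is_cder_cst lam w) (is_cder_id w)).
  have D1 := is_cder_comp D0 (hol_cder hwe).
  have D2 := is_cder_comp (is_cderN (is_cder_id w)) (is_cder_ce (- w)).
  have := is_cderM (is_cder_cst (lam ^+ e / f a) w) (is_cderM D1 D2).
  rewrite /Hs derive1nS exprS /=.
  move: ((f^`(e)%classic)^`()%classic (a + lam * w)) (f^`(e)%classic (a + lam * w)) (ce (- w)) => y1 y2 y3.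
  by congr is_cder; ring.
have H1 : Hs 0%N 0 = 1.
  by rewrite /Hs expr0 mulr0 addr0 oppr0 ce0 mulr1 /= mul1r mulVf.
have bH w : nm w <= 1 -> nm (Hs 0%N w) ^+ n0.+1 <= 3.
  move=> hw; have := B w hw; rewrite /Hs expr0 !nmM nmV nm1 nm_ce RezN expRN mul1r /=.
  have F0 : 0 < nm (f a) by rewrite nm_gt0.
  set X := nm (f (a + lam * w)); set E := expR _; have E0 : 0 < E by exact: expR_gt0.
  have -> : (nm (f a))^-1 * (X / E) = X / (nm (f a) * E) by field; rewrite !gt_eqF.
  by rewrite expr_div_n ler_pdivrMr // exprn_gt0 // mulr_gt0.
have key := Hn0 n0.+1 (leqnSn n0) Hs dH H1 bH.
have F0 : 0 < nm (f a) by rewrite nm_gt0.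
have L0 : 0 < nm lam by rewrite nm_gt0.
have HsE e : nm (Hs e 0) = nm lam ^+ e * nm ((f^`(e))%classic a) / nm (f a).
  by rewrite /Hs mulr0 addr0 oppr0 ce0 mulr1 !nmM nmV nmX; ring.
have lo e : (e <= k)%N -> nm (f a) / 2 <= nm lam ^+ e * nm ((f^`(e))%classic a).
  move=> /key h; have : 1 / 2 <= nm (Hs e 0) by have := nm_subr 1 (1 - Hs e 0); rewrite nm1 subKr nmB; lra.
  by rewrite HsE ler_pdivlMr // mulrC mul1r.
have up : nm lam ^+ k * nm ((f^`(k))%classic a) <= 3 / 2 * nm (f a).
  have := key k (leqnn k) => h; have : nm (Hs k 0) <= 3 / 2 by have := nm_subr (Hs k 0) 1; rewrite nm1; lra.
  by rewrite HsE ler_pdivrMr.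
set X := nm (f a) * nm lam ^+ m.
have X0 : 0 < X by rewrite mulr_gt0 // exprn_gt0.
have XX : (X / 2) ^+ d <= 3 / 2 * X.
  have -> : (X / 2) ^+ d = \prod_(i < d) (X / 2) by rewrite prodr_const card_ord.
  apply: le_trans (_ : \prod_(i < d) (nm lam ^+ (m + j i) * nm ((f^`(j i))%classic a)) <= _).
    apply: ler_prod => i _; apply/andP; split; first by apply: divr_ge0 => //; exact: ltW.
    have := ler_wpM2l (exprn_ge0 m (ltW L0)) (lo (j i) (ltnW (hj i))).
    move=> low; have -> : X / 2 = nm lam ^+ m * (nm (f a) / 2) by rewrite /X; field.
    by rewrite exprD -mulrA.
  rewrite big_split /= prodrXr -weights -nm_prod -ode exprD -mulrA.
  by have := ler_wpM2l (exprn_ge0 m (ltW L0)) up; congr (_ <= _); rewrite /X; ring.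
rewrite leNgt; apply/negP => big.
have d2 : (2 : R) ^+ d > 0 by rewrite exprn_gt0.
have X1 : 1 <= X by apply: ltW; apply: le_lt_trans big; apply: exprn_ege1; lra.
move: XX; rewrite expr_div_n ler_pdivrMr //.
have dE : d = d.-2.+2 by rewrite -[in LHS](prednK (ltnW hd)) -[in LHS](@prednK d.-1) // -ltnS prednK // ltnW.
have Xd : X * X <= X ^+ d.
  rewrite dE !exprS mulrA; apply: ler_peMr; last exact: exprn_ege1.
  by apply: mulr_ge0; exact: ltW.
have := ler_pM2r X0; move: big; rewrite exprS => big _ h.
have : 2 * 2 ^+ d * X < X * X by rewrite ltr_pM2r.
have : 0 < 2 ^+ d * X by rewrite mulr_gt0.
lra.
Qed.
End Core.
End Growth.

(** * Solutions without poles far away have moderate growth *)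
Section Moderate.
Variable R : realType.
Notation C := (Cplx R).
Implicit Types (f g : C -> C) (z w a b c l : C) (x y r s : R).

(** Squares rather than discs, since a square is the union of four of half its
    size. *)
Definition square c s z := `|Rez (z - c)| <= s /\ `|Imz (z - c)| <= s.

(** Boundedness of continuous functions on closed bounded sets, by quartering. *)
Lemma bounded_on (D : C -> Prop) f : cclosed D -> (forall z, D z -> ccont f z) ->
  forall c s, exists M, forall z, D z -> square c s z -> nm (f z) <= M.
Proof.
move=> cD cf c0 s0; apply: contrapT => bad.
have s0_ge : 0 <= s0.
  rewrite leNgt; apply/negP => h; apply: bad; exists 0 => z _ [h1 _].
  by have := normr_ge0 (Rez (z - c0)); lra.
pose good (q : C * R) := exists M, forall z, D z -> square q.1 q.2 z -> nm (f z) <= M.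
pose sub c s (p q : bool) : C := c + (rc ((if p then 1 else -1) * (s / 2)) + 'i * rc ((if q then 1 else -1) * (s / 2))).
have [||z Hz] := @nested_cells R (C * R)%type (fun q => 0 <= q.2 /\ ~ good q) fst snd (c0, s0).
- by [].
- move=> [c s] [/= s_ge nG].
  have [p [q npq]] : exists p q, ~ good (sub c s p q, s / 2).
    apply: contrapT => H; apply: nG.
    have G p q : good (sub c s p q, s / 2).
      by apply: contrapT => h; apply: H; exists p, q.
    have [M1 H1] := G true true; have [M2 H2] := G true false.
    have [M3 H3] := G false true; have [M4 H4] := G false false.
    exists (Num.max (Num.max M1 M2) (Num.max M3 M4)) => z Dz [h1 h2] /=.
    have hit p q : `|Rez (z - c) - (if p then 1 else -1) * (s / 2)| <= s / 2 ->
        `|Imz (z - c) - (if q then 1 else -1) * (s / 2)| <= s / 2 -> square (sub c s p q) (s / 2) z.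
      move=> k1 k2; rewrite /square /sub opprD addrA RezD [Imz (_ - _ - _)]ImzD RezN ImzN Rez_rc Imz_rc.
      by split.
    move: h1 h2; rewrite /= !ler_norml => /andP[a1 a2] /andP[a3 a4].
    have [u|u] := leP 0 (Rez (z - c)); have [v|v] := leP 0 (Imz (z - c)); rewrite !le_max.
    + by rewrite H1 ?orbT //=; apply: hit; rewrite ler_norml; lra.
    + by rewrite (H2 z) ?orbT //=; apply: hit; rewrite ler_norml; lra.
    + by rewrite (H3 z) ?orbT //=; apply: hit; rewrite ler_norml; lra.
    + by rewrite (H4 z) ?orbT //=; apply: hit; rewrite ler_norml; lra.
  exists (sub c s p q, s / 2); split=> //=; first by split => //; rewrite divr_ge0.
  rewrite /sub addrC addKr; apply: le_trans (nm_le_ReIm _) _; rewrite Rez_rc Imz_rc.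
  have n1 (t : bool) : `|(if t then 1 else -1) * (s / 2)| = s / 2.
    by case: t; rewrite ?mul1r ?mulN1r ?normrN ger0_norm //; lra.
  by rewrite !n1; lra.
have near_D e : 0 < e -> exists T, [/\ ~ good T, 0 <= T.2, T.2 < e & nm (T.1 - z) <= 4 * T.2].
  by move=> /Hz [T [[h1 h2] h3 h4]]; exists T.
have inSq c s w : square c s w -> nm (w - c) <= 2 * s.
  by move=> [h1 h2]; apply: le_trans (nm_le_ReIm _) _; lra.
have Dz : D z.
  apply: cD => e e0; have [[c s] [/= nG s_ge hs hc]] := near_D (e / 6) (divr_gt0 e0 (ltr0Sn _ 5)).
  have [[w [Dw Sw]]|no] := pselect (exists w, D w /\ square c s w).
    by exists w => //; have := inSq _ _ _ Sw; have := nm_tri c w z; lra.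
  by case: nG; exists 0 => w Dw Sw; case: no; exists w.
have [/(_ 1 ltr01) [e e0 He]] := cf z Dz.
have [[c s] [/= nG s_ge hs hc]] := near_D (e / 6) (divr_gt0 e0 (ltr0Sn _ 5)).
apply: nG; exists (nm (f z) + 1) => w Dw /= Sw.
have : nm (f w - f z) < 1 by apply: He; have := inSq _ _ _ Sw; have := nm_tri c w z; lra.
by have := nm_subr (f w) (f z); lra.
Qed.

Lemma square_ball c s z : nm (z - c) <= s -> square c s z.
Proof. by move=> h; split; [apply: le_trans (Re_le_nm _) h|apply: le_trans (Im_le_nm _) h]. Qed.

(** Points where [phi] is maximal up to a factor [theta] are enough; this avoids
    attaining the supremum. *)
Lemma near_max (D : C -> Prop) (phi : C -> R) M theta z1 : 1 < theta ->
  (forall z, D z -> phi z <= M) -> D z1 -> 0 < phi z1 ->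
  exists2 a, D a & 0 < phi a /\ forall z, D z -> phi z <= theta * phi a.
Proof.
move=> th H D1 p1; pose A := [set phi z | z in D]%classic.
have sA : has_sup A by split; [exists (phi z1); exists z1|exists M => _ [z Dz <-]; exact: H].
have ub z : D z -> phi z <= sup A by move=> Dz; apply: ub_le_sup; [exact: (proj2 sA)|exists z].
have S0 : 0 < sup A by apply: lt_le_trans p1 (ub _ D1).
have th0 : 0 < theta by lra.
have e0 : 0 < sup A - sup A / theta.
  by rewrite subr_gt0 ltr_pdivrMr // ltr_pMr.
have [_ [a Da <-]] := sup_adherent e0 sA; rewrite subKr => ha.
exists a => //; split; first by apply: lt_trans ha; rewrite divr_gt0.
move=> z Dz; apply: le_trans (ub z Dz) _.
by move: ha; rewrite ltr_pdivrMr // mulrC => /ltW.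
Qed.

Lemma pnbh_neq z b : pnbh z (fun w => w != b).
Proof.
have [<-|zb] := eqVneq z b; first by exists 1.
exists (nm (z - b)); first by rewrite nm_gt0 subr_eq0.
by move=> w _; apply: contraTneq => ->; rewrite nmB ltxx.
Qed.

(** Moving by [t w] from radius [rho], the modulus grows by [t Rez w] up to an error
    of second order in [t], here at most [3 t / n]. *)
Lemma modulus_step (rho t n : R) w : 0 < t -> 1 <= n -> nm w <= 1 -> t * n <= 6 * (rho - t) ->
  nm (rc rho + rc t * w) <= rho + t * (Rez w + 3 / n).
Proof.
move=> t0 n1 hw tn.
have /andP[w1 w2] : -1 <= Rez w <= 1 by rewrite -ler_norml; apply: le_trans (Re_le_nm _) hw.
have /andP[w3 w4] : -1 <= Imz w <= 1 by rewrite -ler_norml; apply: le_trans (Im_le_nm _) hw.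
have n0 : 0 < n by lra.
have tn0 : 0 < t / n by rewrite divr_gt0.
pose P := rho + t * Rez w.
have Pb : rho - t <= P.
  have : t * (-1) <= t * Rez w by rewrite ler_pM2l.
  by rewrite /P; lra.
have tnn : 0 < t * n by rewrite mulr_gt0.
have E : rho + t * (Rez w + 3 / n) = P + 3 * (t / n) by rewrite /P; field; rewrite gt_eqF.
have pos : 0 <= P + 3 * (t / n) by lra.
rewrite E -(@ler_pXn2r _ 2) ?nnegrE ?nm_ge0 // nm_sqr RezD ImzD RezM ImzM !Rez_r !Imz_r !mul0r add0r addr0 subr0 -/P.
have i2 : Imz w ^+ 2 <= 1 by rewrite expr2; nra.
have -> : (P + 3 * (t / n)) ^+ 2 = P ^+ 2 + (6 * (t / n) * P + (3 * (t / n)) ^+ 2) by ring.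
rewrite lerD2l exprMn.
have s1 : 0 <= (3 * (t / n)) ^+ 2 by exact: sqr_ge0.
have s2 : t ^+ 2 * Imz w ^+ 2 <= t ^+ 2 by rewrite ler_piMr // sqr_ge0.
have s3 : t ^+ 2 <= 6 * (t / n) * P.
  have tP : t * n <= 6 * P by lra.
  have -> : t ^+ 2 = t / n * (t * n) by field; rewrite gt_eqF.
  have -> : 6 * (t / n) * P = t / n * (6 * P) by ring.
  by rewrite ler_pM2l.
by apply: le_trans s2 _; apply: le_trans s3 _; rewrite lerDl.
Qed.

Lemma expR_half : expR (1 / 2) <= 2 :> R.
Proof.
have h : 1 / 2 <= expR (- (1 / 2)) :> R by apply: le_trans (expR_ge1Dx _); lra.
have : expR (1 / 2) * expR (- (1 / 2)) = 1 :> R by rewrite -expRD subrr expR0.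
have := expR_gt0 (1 / 2 : R); set E := expR (1 / 2); set F := expR _ in h *; nra.
Qed.

(** The second order error in [(1 - x)^-1 = e^x]; with [x] of order [1 / N] it is
    absorbed when the [N]-th power is taken. *)
Lemma inv_expR x : `|x| <= 1 / 2 -> (1 - x)^-1 <= expR (x + 2 * x ^+ 2).
Proof.
rewrite ler_norml => /andP[x1 x2]; have h : 0 < 1 - x by lra.
have -> : (1 - x)^-1 = 1 + x / (1 - x) by field; rewrite gt_eqF.
apply: le_trans (expR_ge1Dx _) _; rewrite ler_expR ler_pdivrMr //.
have : 0 <= x ^+ 2 by exact: sqr_ge0.
have : (x + 2 * x ^+ 2) * (1 - x) = x + x ^+ 2 * (1 - 2 * x) by ring.
move=> -> s0; rewrite lerDl mulr_ge0 //; lra.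
Qed.

Section Ode.
Variables (k d : nat) (j : 'I_d -> nat) (m : nat) (f : C -> C).
Hypothesis (hd : (1 < d)%N) (hj : forall i, (j i < k)%N).
Hypothesis weights : (m + k = \sum_(i < d) (m + j i))%N.
Hypothesis f_sol : is_ode_solution k j f.

Lemma ode_at z : hol f z -> (f^`(k))%classic z = \prod_(i < d) (f^`(j i))%classic z.
Proof.
move=> hf; have [e e0 He] := proj1 (mero_eqP _ _) f_sol z.
apply: (ccont_eq (hol_cont (hol_deriv_n k hf)) (g := fun z => \prod_(i < d) (f^`(j i))%classic z)).
  by apply: ccont_prod => i; apply: hol_cont; exact: hol_deriv_n.
by exists e.
Qed.

(** [growth_core] at an almost maximal point [a] of [nm f * (distance)^N], [dl] being
    the distance of [a] to the outer boundary and [lam] an outward step that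
    shortens it by about [dl / N].  Along that step the distance factor changes like
    [(1 - Re w / N)^N], that is like [e^(- Re w)].  The errors [O(1 / N)] have to be
    small compared to the exponent [1 / n] of [growth_core], whence the choice of
    [N]. *)
Lemma growth_max : exists2 N, (24 <= N)%N && (m <= N)%N & forall a lam (dl : R),
  0 < dl -> f a != 0 -> lam != 0 -> (forall w, nm w <= 1 -> hol f (a + lam * w)) ->
  (forall w, nm w <= 1 -> nm (f (a + lam * w)) * (dl - dl / N%:R * (Rez w + 3 / N%:R)) ^+ N
      <= expR (1 / N%:R) * (nm (f a) * dl ^+ N)) ->
  nm (f a) * nm lam ^+ m <= 2 ^+ d.+1.
Proof.
have [n n0 core] := growth_core R hd hj weights.
pose N := (24 * (n * m.+1))%N; exists N.
  apply/andP; split; rewrite /N; nia.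
move=> a lam dl dl0 fa lam0 hf H; apply: core => //.
  by have := hf 0; rewrite nm0 mulr0 addr0 => /(_ ler01) /ode_at.
move=> w hw; have {}H := H w hw.
have Npos : (0 < N)%N by rewrite /N; nia.
have N24 : 24 <= N%:R :> R by rewrite ler_nat /N; nia.
have N0 : 0 < N%:R :> R by rewrite ltr0n.
have Nn : 24 * n%:R <= N%:R :> R by rewrite -natrM ler_nat /N; nia.
have iN : 0 < N%:R^-1 :> R by rewrite invr_gt0.
have iN24 : N%:R^-1 <= 24^-1 :> R by rewrite lef_pV2 // posrE; lra.
set y := Rez w + 3 / N%:R in H.
have /andP[w1 w2] : -1 <= Rez w <= 1 by rewrite -ler_norml; apply: le_trans (Re_le_nm _) hw.
have y2 : `|y| <= 2 by rewrite ler_norml /y; lra.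
pose x := y / N%:R.
have x2 : `|x| <= 1 / 2.
  by rewrite /x normrM [`|_^-1|]gtr0_norm //; have := ler_pM (normr_ge0 y) (ltW iN) y2 iN24; lra.
have x1 : 0 < 1 - x by move: x2; rewrite ler_norml; lra.
have E : dl - dl / N%:R * y = dl * (1 - x) by rewrite /x; field; rewrite gt_eqF.
rewrite E exprMn in H.
have F0 : 0 < nm (f a) by rewrite nm_gt0.
have dN : 0 < dl ^+ N by rewrite exprn_gt0.
have H1 : nm (f (a + lam * w)) <= nm (f a) * (expR (1 / N%:R) * ((1 - x)^-1) ^+ N).
  have xN : 0 < (1 - x) ^+ N by rewrite exprn_gt0.
  rewrite exprVn mulrA ler_pdivlMr // -(ler_pM2r dN).
  by apply: le_trans (_ : _ <= expR (1 / N%:R) * (nm (f a) * dl ^+ N)) _;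
    [move: H; congr (_ <= _); ring|rewrite le_eqVlt; apply/orP; left; apply/eqP; ring].
have H2 : expR (1 / N%:R) * ((1 - x)^-1) ^+ N <= expR (Rez w + 12 / N%:R).
  have e1 : ((1 - x)^-1) ^+ N <= expR (N%:R * (x + 2 * x ^+ 2)).
    rewrite mulrC expRM_natr; apply: lerXn2r.
    - by rewrite nnegrE invr_ge0 ltW.
    - by rewrite nnegrE expR_ge0.
    - exact: inv_expR.
  apply: le_trans (ler_wpM2l (expR_ge0 _) e1) _; rewrite -expRD ler_expR.
  have -> : N%:R * (x + 2 * x ^+ 2) = y + 2 * (y ^+ 2 * N%:R^-1) by rewrite /x; field; rewrite gt_eqF.
  have yy : y ^+ 2 <= 4.
    by move: y2; rewrite ler_norml => /andP[a1 a2]; rewrite expr2; nra.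
  have := ler_wpM2r (ltW iN) yy; rewrite /y; lra.
apply: le_trans (_ : (nm (f a) * expR (Rez w + 12 / N%:R)) ^+ n <= _).
  apply: lerXn2r; rewrite ?nnegrE ?nm_ge0 //; first by rewrite mulr_ge0 ?nm_ge0 ?expR_ge0.
  by apply: le_trans H1 _; rewrite ler_pM2l.
rewrite expRD mulrA [leLHS]exprMn mulrC; apply: ler_wpM2r.
  by apply: exprn_ge0; rewrite mulr_ge0 ?nm_ge0 ?expR_ge0.
rewrite -expRM_natr; apply: le_trans (_ : expR (1 / 2) <= _); last by have := expR_half; lra.
by rewrite ler_expR mulrAC ler_pdivrMr //; lra.
Qed.

Section Plane.
Variable b : C.
Hypothesis f_hol : forall z, z != b -> hol f z.

(** Maximise [nm f * (2 r - nm (z - b))^N] on an annulus about [z1].  Near the inner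
    half the maximum compares [z1] with a point at most half as far from [b];
    further out [growth_max] bounds it.  As [2^N] is fixed, repeated halving
    costs a power of the distance (see [plane_growth]). *)
Lemma plane_step : exists N, exists B, 0 <= B /\ forall z1, 4 <= nm (z1 - b) ->
  nm (f z1) <= B \/ exists a, [/\ 1 <= nm (a - b), nm (a - b) <= nm (z1 - b) / 2 &
     nm (f z1) <= 2 ^+ N * nm (f a)].
Proof.
have [N /andP[N24 mN] gm] := growth_max.
have N0 : 0 < N%:R :> R by rewrite ltr0n; lia.
have N24' : 24 <= N%:R :> R by rewrite ler_nat.
have iN : 0 < N%:R^-1 :> R by rewrite invr_gt0.
have iN24 : N%:R^-1 <= 24^-1 :> R by rewrite lef_pV2 // posrE; lra.
pose K : R := 2 ^+ d.+1; pose th := expR (1 / N%:R) : R.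
have th1 : 1 < th by rewrite /th expR_gt1 mul1r.
have th2 : th <= 2.
  apply: le_trans (_ : expR (1 / 2) <= _); last exact: expR_half.
  by rewrite ler_expR; lra.
pose B := 2 * K * N%:R ^+ m * 2 ^+ N.
have B0 : 0 <= B by rewrite /B !mulr_ge0 ?exprn_ge0 //; lra.
exists N.+1, B; split=> // z1; set r := nm (z1 - b) => r4.
have [fz1|fz1] := eqVneq (f z1) 0; first by left; rewrite fz1 nm0.
pose D z := r / 4 <= nm (z - b) /\ nm (z - b) <= 2 * r.
pose phi z := nm (f z) * (2 * r - nm (z - b)) ^+ N.
have cD : cclosed D.
  move=> z H; split; rewrite leNgt; apply/negP => h.
    have [w [w1 _] hw] := H (r / 4 - nm (z - b)) ltac:(by rewrite subr_gt0).
    by have := nm_tri z w b; lra.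
  have [w [_ w1] hw] := H (nm (z - b) - 2 * r) ltac:(by rewrite subr_gt0).
  by have := nm_tri w z b; rewrite (nmB z w); lra.
have Dnb z : D z -> z != b.
  by move=> [h _]; apply/negP => /eqP zb; move: h; rewrite zb subrr nm0; lra.
have [M HM] := bounded_on cD (fun z Dz => hol_cont (f_hol (Dnb z Dz))) b (2 * r).
have phiM z : D z -> phi z <= M * (2 * r) ^+ N.
  move=> Dz; have [h1 h2] := Dz; apply: ler_pM; rewrite ?nm_ge0 ?exprn_ge0 //; try lra.
    by apply: HM => //; exact: square_ball.
  by apply: lerXn2r; rewrite ?nnegrE; have := nm_ge0 (z - b); lra.
have D1 : D z1 by rewrite /D -/r; lra.
have phi1E : phi z1 = nm (f z1) * r ^+ N by rewrite /phi -/r; congr (_ * _ ^+ _); ring.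
have rN : 0 < r ^+ N by rewrite exprn_gt0 //; lra.
have phi1 : 0 < phi z1 by rewrite phi1E mulr_gt0 // nm_gt0.
have [a Da [pa Ha]] := near_max th1 phiM D1 phi1.
have [a1 a2] := Da; have H1 := Ha z1 D1; rewrite phi1E in H1.
have fa : f a != 0 by apply/negP => /eqP fa; move: pa; rewrite /phi fa nm0 mul0r ltxx.
have [near|far] := leP (nm (a - b)) (r / 2).
  right; exists a; split=> //; first by lra.
  rewrite -(ler_pM2r rN); apply: le_trans H1 _.
  have e1 : (2 * r - nm (a - b)) ^+ N <= (2 * r) ^+ N.
    by apply: lerXn2r; rewrite ?nnegrE; have := nm_ge0 (a - b); lra.
  have -> : 2 ^+ N.+1 * nm (f a) * r ^+ N = 2 * (nm (f a) * (2 * r) ^+ N) by rewrite exprMn exprS; ring.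
  apply: ler_pM; rewrite ?(ltW pa) //; first by lra.
  by rewrite /phi ler_wpM2l ?nm_ge0.
left; pose dl := 2 * r - nm (a - b).
have dl0 : 0 < dl.
  rewrite lt_def /dl subr_ge0 a2 andbT; apply/negP => /eqP dl0; move: pa.
  have N0n : (N == 0)%N = false by apply/eqP => N0'; move: N24; rewrite N0'.
  by rewrite /phi dl0 expr0n N0n mulr0 ltxx.
have ab0 : a - b != 0 by rewrite -nm_gt0; lra.
pose rho := nm (a - b); have rho0 : 0 < rho by rewrite /rho; lra.
pose t := dl / N%:R; have t0 : 0 < t by rewrite divr_gt0.
have t16 : t <= r / 16.
  rewrite /t; have dl2 : dl <= 3 / 2 * r by rewrite /dl; lra.
  by have := ler_pM (ltW dl0) (ltW iN) dl2 iN24; lra.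
pose lam := rc (t / rho) * (a - b).
have nlam : nm lam = t.
  by rewrite /lam nmM nm_real gtr0_norm ?divr_gt0 // -/rho divfK // gt_eqF.
have lam0 : lam != 0 by rewrite -nm_gt0 nlam.
have tw w : nm w <= 1 -> nm (lam * w) <= t.
  by move=> hw; rewrite nmM nlam ler_piMr // ltW.
have Dw w : nm w <= 1 -> D (a + lam * w).
  move=> /tw hw; have := nmD (a - b) (lam * w); have := nm_subr (a - b) (- (lam * w)).
  rewrite nmN opprK.
  have -> : a - b + lam * w = a + lam * w - b by ring.
  rewrite /D -/rho => h1 h2; have : rho + dl = 2 * r by rewrite /rho /dl; ring.
  have : t <= dl by rewrite /t ler_piMr ?(ltW dl0) //; lra.
  by rewrite /rho in h1 h2 *; lra.
have core := gm a lam dl dl0 fa lam0 (fun w hw => f_hol (Dnb _ (Dw w hw))).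
have {}core : nm (f a) * t ^+ m <= K.
  rewrite -nlam; apply: core => w hw.
  apply: le_trans (Ha _ (Dw w hw)); rewrite /phi ler_wpM2l ?nm_ge0 //.
  have /andP[w1 w2] : -1 <= Rez w <= 1 by rewrite -ler_norml; apply: le_trans (Re_le_nm _) hw.
  rewrite -/t.
  have tb : t * (Rez w + 3 / N%:R) <= t * 2.
    by rewrite ler_pM2l //; lra.
  have key : nm (a + lam * w - b) <= rho + t * (Rez w + 3 / N%:R).
    have rc0' : rc rho != 0 by rewrite -nm_eq0 nm_real gtr0_norm // gt_eqF.
    have -> : a + lam * w - b = (a - b) * rc rho^-1 * (rc rho + rc t * w).
      by rewrite /lam rcM rcV; field; exact: rc0'.
    rewrite nmM nmM nm_real gtr0_norm ?invr_gt0 // -/rho divff ?gt_eqF // mul1r.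
    apply: modulus_step => //; first by lra.
    have -> : t * N%:R = dl by rewrite /t divfK ?gt_eqF.
    have farr : r / 2 < rho := far.
    have : dl + rho = 2 * r by rewrite /dl /rho; ring.
    by lra.
  have : 0 <= dl - t * (Rez w + 3 / N%:R).
    have : t <= dl / 24 by rewrite /t ler_pM2l.
    by lra.
  move=> pos; apply: lerXn2r; rewrite ?nnegrE //.
    have := Dw w hw; rewrite /D => -[_]; lra.
  by move: key; rewrite /dl /rho; lra.
rewrite -(ler_pM2r rN); apply: le_trans H1 _.
have -> : phi a = nm (f a) * t ^+ m * (N%:R ^+ m * dl ^+ (N - m)).
  rewrite /phi -/dl -{1}(subnKC mN) exprD /t expr_div_n.
  by field; rewrite expf_neq0 // gt_eqF.
have r1 : 1 <= r by lra.
have e1 : N%:R ^+ m * dl ^+ (N - m) <= N%:R ^+ m * (2 ^+ N * r ^+ N).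
  rewrite ler_pM2l ?exprn_gt0 // -exprMn; apply: le_trans (_ : (2 * r) ^+ (N - m) <= _).
    by apply: lerXn2r; rewrite ?nnegrE; have := nm_ge0 (a - b); rewrite /dl; lra.
  by apply: ler_weXn2l; [lra|exact: leq_subr].
have -> : B * r ^+ N = 2 * (K * (N%:R ^+ m * (2 ^+ N * r ^+ N))) by rewrite /B; ring.
have q0 : 0 <= nm (f a) * t ^+ m by rewrite mulr_ge0 ?nm_ge0 // exprn_ge0 // ltW.
have q1 : 0 <= N%:R ^+ m * dl ^+ (N - m) by rewrite mulr_ge0 ?exprn_ge0 // ltW.
apply: ler_pM => //; [by lra|by rewrite mulr_ge0|exact: ler_pM].
Qed.

Lemma plane_growth : exists M L, forall z, 1 <= nm (z - b) -> nm (f z) <= M * nm (z - b) ^+ L.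
Proof.
have [N [B [B0 step]]] := plane_step.
pose D z := 1 <= nm (z - b).
have cD : cclosed D.
  move=> z H; rewrite /D leNgt; apply/negP => h.
  have [w w1 hw] := H (1 - nm (z - b)) ltac:(by rewrite subr_gt0).
  by rewrite /D in w1; have := nm_tri z w b; lra.
have Dnb z : D z -> z != b.
  by move=> h; apply/negP => /eqP zb; move: h; rewrite /D zb subrr nm0; lra.
have [M0 HM0] := bounded_on cD (fun z Dz => hol_cont (f_hol (Dnb z Dz))) b 4.
pose M := `|M0| + B; exists M, N.
have M0' : 0 <= M by rewrite addr_ge0.
suff H n z : 1 <= nm (z - b) -> nm (z - b) <= 4 * 2 ^+ n -> nm (f z) <= M * nm (z - b) ^+ N.
  move=> z hz; pose n := Num.bound (nm (z - b)); apply: (H n) => //.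
  apply: ltW; apply: lt_le_trans (archi_boundP (nm_ge0 _)) _.
  apply: le_trans (_ : 1 * 2 ^+ n <= _); last by rewrite ler_pM2r ?exprn_gt0 //; lra.
  by rewrite mul1r -natrX ler_nat ltnW // ltn_expl.
elim: n z => [|n IH] z z1 z2.
  have X1 : 1 <= nm (z - b) ^+ N by exact: exprn_ege1.
  apply: le_trans (_ : M <= _); last by rewrite ler_peMr.
  apply: le_trans (HM0 z z1 _) _; last by rewrite /M; have := ler_norm M0; lra.
  by apply: square_ball; rewrite expr0 mulr1 in z2.
have [small|big] := leP (nm (z - b)) (4 * 2 ^+ n); first exact: IH.
have z4 : 4 <= nm (z - b).
  by have : 1 <= (2 : R) ^+ n; [apply: exprn_ege1; lra|lra].
case: (step z z4) => [h|[a [a1 a2 h]]].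
  have X1 : 1 <= nm (z - b) ^+ N by exact: exprn_ege1.
  apply: le_trans (_ : M <= _); last by rewrite ler_peMr.
  by rewrite /M; have := normr_ge0 M0; lra.
apply: le_trans h _.
have := IH a a1 ltac:(by move: z2; rewrite exprS; lra).
move=> /(ler_wpM2l (exprn_ge0 N (ler0n _ 2))) h; apply: le_trans h _.
rewrite mulrCA ler_wpM2l // -exprMn; apply: lerXn2r; rewrite ?nnegrE ?mulr_ge0 ?nm_ge0 //.
by lra.
Qed.

Lemma one_pole_rational : pole_of_order f b m -> rational_fun f.
Proof.
move=> /poleP [m0 [g [hg g0 H]]].
have [F dF FE] : exists2 F, (forall z, cdiff F z) & mero_eq (fun z => (z - b) ^+ m * f z) F.
  apply: removable => z; have [->|zb] := eqVneq z b.
    exists g => //; apply: pnbh_mono (pnbhI H (pnbh_sub0 b m)) => w wb [-> w0].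
    by rewrite mulrC divfK.
  exists (fun z => (z - b) ^+ m * f z); last by exists 1.
  by apply: holM; [apply: holX; exact: hol_sub|exact: f_hol].
have [M [L HM]] := plane_growth.
have FEz z : z != b -> (z - b) ^+ m * f z = F z.
  move=> zb; apply: (mero_eq_at FE); last exact: entire_hol.
  by apply: holM; [apply: holX; exact: hol_sub|exact: f_hol].
have cl : cclosed (fun z => nm (z - b) <= 1) by have [] := @region_ball R b 1.
have [M1 HM1] := bounded_on cl (fun z _ => cdiff_cont (dF z)) b 1.
have [P HP] : exists P : {poly C}, forall z, F z = P.[z].
  apply: (liouville (K := (`|M| + `|M1|) * (1 + nm b) ^+ (m + L)) (N := (m + L)%N)) => // z.
  have X1 : 1 <= (1 + nm b) * (1 + nm z).
    by have := nm_ge0 b; have := nm_ge0 z => h1 h2; have : 0 <= nm b * nm z by [rewrite mulr_ge0]; lra.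
  rewrite -mulrA -exprMn; have Y1 : 1 <= ((1 + nm b) * (1 + nm z)) ^+ (m + L) by exact: exprn_ege1.
  set Y := _ ^+ (m + L) in Y1 *.
  have [z1|z1] := leP (nm (z - b)) 1.
    apply: le_trans (HM1 z z1 (square_ball z1)) _.
    apply: le_trans (_ : (`|M| + `|M1|) * 1 <= _); last by rewrite ler_wpM2l // addr_ge0.
    by have := ler_norm M1; have := normr_ge0 M; lra.
  have zb : z != b by apply/negP => /eqP zb; move: z1; rewrite zb subrr nm0; lra.
  rewrite -(FEz z zb) nmM nmX.
  apply: le_trans (ler_wpM2l (exprn_ge0 m (nm_ge0 (z - b))) (HM z (ltW z1))) _.
  have -> : nm (z - b) ^+ m * (M * nm (z - b) ^+ L) = M * nm (z - b) ^+ (m + L) by rewrite exprD; ring.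
  have hp : 0 < nm (z - b) ^+ L by apply: exprn_gt0; lra.
  apply: ler_pM.
  - by rewrite -(pmulr_lge0 _ hp) (le_trans (nm_ge0 _) (HM z (ltW z1))).
  - by apply: exprn_ge0; exact: nm_ge0.
  - by have := ler_norm M; have := normr_ge0 M1; lra.
  - apply: lerXn2r; rewrite ?nnegrE ?nm_ge0 //; first by lra.
    apply: le_trans (nmD _ _) _; rewrite nmN.
    by have : 0 <= nm b * nm z by [rewrite mulr_ge0 ?nm_ge0]; lra.
exists P, (('X - b%:P) ^+ m); split; first by rewrite expf_neq0 // polyXsubC_eq0.
apply/mero_eqP => z; apply: pnbh_mono (pnbh_neq z b) => w _ wb.
have w0 : (w - b) ^+ m != 0 by rewrite expf_neq0 // subr_eq0.
by rewrite -HP -FEz // horner_exp hornerXsubC mulrC mulKf.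
Qed.
End Plane.
End Ode.
End Moderate.

(** * Simply periodic solutions: growth in a half-plane *)
Section Strip.
Variable R : realType.
Notation C := (Cplx R).
Implicit Types (f g : C -> C) (z w a b c l om : C) (x y r s : R) (n : int).

Lemma rc_int n : rc n%:~R = n%:~R :> C.
Proof. by case: n => n; rewrite ?NegzE ?mulrNz ?rcN rc_nat. Qed.

Section Period.
Variables (b c om : C).
Hypothesis (c0 : c != 0) (om0 : om != 0) (Re_com : Rez (c * om) = 0).
(** For [c * om] imaginary, [level] is constant in the direction of the period [om]
    and measures the distance from the line [b + R om]. *)
Definition level z : R := Rez (c * (z - b)).

Lemma level_add z w : level (z + w) = level z + Rez (c * w).
Proof. by rewrite /level -RezD -mulrDr; congr (Rez (_ * _)); ring. Qed.
Lemma level_int n z : level (z + n%:~R * om) = level z.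
Proof.
rewrite level_add; have -> : c * (n%:~R * om) = rc n%:~R * (c * om) by rewrite rc_int; ring.
by rewrite RezM Rez_r Imz_r Re_com mulr0 mul0r subr0 addr0.
Qed.
Lemma per_int (p : R -> Prop) f : (forall z, p (level z) -> f (z + om) = f z) ->
  forall n z, p (level z) -> f (z + n%:~R * om) = f z.
Proof.
move=> H; have nat_ (k : nat) z : p (level z) -> f (z + k%:~R * om) = f z.
  elim: k => [|k IH] pz; first by rewrite mul0r addr0.
  have -> : z + k.+1%:~R * om = z + k%:~R * om + om by rewrite -addn1 PoszD rmorphD /=; ring.
  by rewrite H ?level_int // IH.
case=> n z pz; first exact: nat_.
rewrite NegzE; set u := z + _; have pu : p (level u) by rewrite level_int.
by rewrite -(nat_ n.+1 u pu) /u; congr f; rewrite mulrNz; ring.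
Qed.

Lemma reduce z : exists n, `|Imz (c * (z + n%:~R * om - b))| <= `|Imz (c * om)|.
Proof.
have T0 : Imz (c * om) != 0.
  apply/eqP => T0; have : c * om = 0 by apply: C_eq; rewrite ?Re_com ?T0 -rc0 ?Rez_r ?Imz_r.
  by move/eqP; rewrite mulf_eq0 (negbTE c0) (negbTE om0).
pose T := Imz (c * om); pose y := Imz (c * (z - b)).
exists (- Num.floor (y / T)).
have -> : c * (z + (- Num.floor (y / T))%:~R * om - b) = c * (z - b) + - (rc (Num.floor (y / T))%:~R * (c * om)).
  by rewrite rc_int mulrNz; ring.
rewrite ImzD ImzN [Imz (rc _ * _)]ImzM Rez_r Imz_r mul0r addr0 -/T -/y.
have -> : y + - ((Num.floor (y / T))%:~R * T) = (y / T - (Num.floor (y / T))%:~R) * T by field.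
rewrite normrM ler_piMl //; have /andP[h1 h2] := floor_itv (y / T).
by rewrite rmorphD /= in h2; rewrite ler_norml; lra.
Qed.

(** Periodicity reduces a strip to a bounded part of it. *)
Lemma strip_bounded f x y : (forall z, x <= level z -> level z <= y -> f (z + om) = f z) ->
  (forall z, x <= level z -> level z <= y -> ccont f z) ->
  exists M, forall z, x <= level z -> level z <= y -> nm (f z) <= M.
Proof.
move=> fper fc; have nc : 0 < nm c by rewrite nm_gt0.
pose D z := x <= level z /\ level z <= y.
have cD : cclosed D.
  have E w z : level w = level z + Rez (c * (w - z)) by rewrite -level_add addrC subrK.
  have B z w e : nm (w - z) < e / nm c -> `|Rez (c * (w - z))| < e.
    rewrite ltr_pdivlMr // mulrC -nmM => h; exact: le_lt_trans (Re_le_nm _) h.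
  move=> z H; split; rewrite leNgt; apply/negP => h.
    have [|w [w1 _] hw] := H ((x - level z) / nm c); first by rewrite divr_gt0 // subr_gt0.
    by have := B _ _ _ hw; move: w1; rewrite (E w z) ltr_norml; lra.
  have [|w [_ w1] hw] := H ((level z - y) / nm c); first by rewrite divr_gt0 // subr_gt0.
  by have := B _ _ _ hw; move: w1; rewrite (E w z) ltr_norml; lra.
have [M HM] := bounded_on cD (fun z Dz => fc z (proj1 Dz) (proj2 Dz)) b
  ((`|x| + `|y| + `|Imz (c * om)|) / nm c).
exists M => z z1 z2; have [n hn] := reduce z.
rewrite -(@per_int (fun t => x <= t /\ t <= y) f _ n z) //; last by move=> w [? ?]; exact: fper.
apply: HM; first by rewrite /D level_int.
apply: square_ball; rewrite ler_pdivlMr // mulrC -nmM; apply: le_trans (nm_le_ReIm _) _.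
apply: lerD => //; have := level_int n z; rewrite {1}/level => ->.
rewrite ler_norml; have := ler_norm y; have := ler_norm (- x); rewrite normrN.
have := normr_ge0 x; have := normr_ge0 y; lra.
Qed.

Section Ode.
Variables (k d : nat) (j : 'I_d -> nat) (m : nat) (f : C -> C).
Hypothesis (hd : (1 < d)%N) (hj : forall i, (j i < k)%N).
Hypothesis weights : (m + k = \sum_(i < d) (m + j i))%N.
Hypothesis f_sol : is_ode_solution k j f.
Hypothesis f_hol : forall z, 1 <= level z -> hol f z.
Hypothesis f_per : forall z, 1 <= level z -> f (z + om) = f z.

(** As [plane_step], with the level in place of the modulus; the point of comparison
    is lower by one. *)
Lemma strip_step : exists N, exists B, 0 <= B /\ forall z1, 3 <= level z1 ->
  nm (f z1) <= B \/ exists a, [/\ 1 <= level a, level a <= level z1 - 1 & nm (f z1) <= 3 ^+ N * nm (f a)].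
Proof.
have nc : 0 < nm c by rewrite nm_gt0.
have [N /andP[N24 mN] gm] := growth_max hd hj weights f_sol.
have N0 : 0 < N%:R :> R by rewrite ltr0n; lia.
have N24' : 24 <= N%:R :> R by rewrite ler_nat.
have iN : 0 < N%:R^-1 :> R by rewrite invr_gt0.
have iN24 : N%:R^-1 <= 24^-1 :> R by rewrite lef_pV2 // posrE; lra.
pose K : R := 2 ^+ d.+1; pose th := expR (1 / N%:R) : R.
have th1 : 1 < th by rewrite /th expR_gt1 mul1r.
have th2 : th <= 2.
  apply: le_trans (_ : expR (1 / 2) <= _); last exact: expR_half.
  by rewrite ler_expR; lra.
pose B := 2 * K * (N%:R * nm c) ^+ m * 2 ^+ N.
have B0 : 0 <= B by rewrite /B !mulr_ge0 ?exprn_ge0 ?mulr_ge0 ?nm_ge0.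
exists N.+1, B; split=> // z1; set x := level z1 => x3.
have [fz1|fz1] := eqVneq (f z1) 0; first by left; rewrite fz1 nm0.
pose D z := x - 2 <= level z /\ level z <= x + 1.
pose phi z := nm (f z) * (x + 1 - level z) ^+ N.
have D1z z : D z -> 1 <= level z by move=> [h _]; lra.
have [||M HM] := @strip_bounded f (x - 2) (x + 1).
- by move=> z h _; apply: f_per; lra.
- by move=> z h _; apply/hol_cont/f_hol; lra.
have phiM z : D z -> phi z <= M * 3 ^+ N.
  move=> [h1 h2]; apply: ler_pM; rewrite ?nm_ge0 ?exprn_ge0 ?HM //; first by lra.
  by apply: lerXn2r; rewrite ?nnegrE; lra.
have D1 : D z1 by rewrite /D -/x; lra.
have phi1E : phi z1 = nm (f z1).
  by rewrite /phi -/x (_ : x + 1 - x = 1) ?expr1n ?mulr1 //; ring.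
have phi1 : 0 < phi z1 by rewrite phi1E nm_gt0.
have [a Da [pa Ha]] := near_max th1 phiM D1 phi1.
have [a1 a2] := Da; have H1 := Ha z1 D1; rewrite phi1E in H1.
have fa : f a != 0 by apply/negP => /eqP fa; move: pa; rewrite /phi fa nm0 mul0r ltxx.
have [near|far] := leP (level a) (x - 1).
  right; exists a; split=> //; first exact: D1z.
  apply: le_trans H1 _; rewrite exprS -mulrA.
  apply: ler_pM; rewrite ?(ltW pa) //; [by lra|by lra|].
  rewrite /phi mulrC ler_wpM2r ?nm_ge0 //.
  by apply: lerXn2r; rewrite ?nnegrE; lra.
left; pose dl := x + 1 - level a.
have dl0 : 0 < dl.
  rewrite lt_def /dl subr_ge0 a2 andbT; apply/negP => /eqP dl0; move: pa.
  have N0n : (N == 0)%N = false by apply/eqP => N0'; move: N24; rewrite N0'.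
  by rewrite /phi dl0 expr0n N0n mulr0 ltxx.
have dl2 : dl <= 2 by rewrite /dl; lra.
pose t := dl / N%:R; have t0 : 0 < t by rewrite divr_gt0.
have t12 : t <= 1 / 12.
  by rewrite /t; have := ler_pM (ltW dl0) (ltW iN) dl2 iN24; lra.
have tdl : t <= dl by rewrite /t ler_piMr ?(ltW dl0) //; lra.
pose lam := rc t / c.
have nlam : nm lam = t / nm c by rewrite /lam nmM nmV nm_real gtr0_norm.
have lam0 : lam != 0 by rewrite -nm_gt0 nlam divr_gt0.
have lvw w : level (a + lam * w) = level a + t * Rez w.
  rewrite level_add; have -> : c * (lam * w) = rc t * w by rewrite /lam; field.
  by rewrite RezM Rez_r Imz_r mul0r subr0.
have rw w : nm w <= 1 -> -1 <= Rez w <= 1.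
  by move=> hw; rewrite -ler_norml; apply: le_trans (Re_le_nm _) hw.
have tw w : nm w <= 1 -> - t <= t * Rez w <= t.
  move=> /rw /andP[h1 h2]; have := ler_wpM2l (ltW t0) h1; have := ler_wpM2l (ltW t0) h2.
  by rewrite mulrN1 mulr1 => -> ->.
have Dw w : nm w <= 1 -> D (a + lam * w).
  by move=> /tw /andP[h1 h2]; rewrite /D lvw; have : level a + dl = x + 1 by [rewrite /dl; ring]; lra.
have core : nm (f a) * nm lam ^+ m <= K.
  apply: (gm a lam dl dl0 fa lam0); first by move=> w hw; apply: f_hol; exact: D1z (Dw w hw).
  move=> w hw; apply: le_trans (Ha _ (Dw w hw)); rewrite /phi ler_wpM2l ?nm_ge0 //.
  have /andP[h1 h2] := tw w hw; rewrite -/t lvw.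
  have t3 : 0 <= t * (3 / N%:R) by rewrite mulr_ge0 ?(ltW t0) // divr_ge0 // ltW.
  have t4 : t * (3 / N%:R) <= t by rewrite ler_piMr ?(ltW t0) // ler_pdivrMr //; lra.
  have t5 : 2 * t <= dl by rewrite /t; have := ler_wpM2l (ltW dl0) iN24; lra.
  rewrite mulrDr; apply: lerXn2r; rewrite ?nnegrE; first by lra.
    by have : level a + dl = x + 1 by [rewrite /dl; ring]; lra.
  by have : level a + dl = x + 1 by [rewrite /dl; ring]; lra.
apply: le_trans H1 _.
have -> : phi a = nm (f a) * nm lam ^+ m * ((N%:R * nm c) ^+ m * dl ^+ (N - m)).
  rewrite /phi -/dl -{1}(subnKC mN) exprD nlam /t.
  have -> : dl / N%:R / nm c = dl / (N%:R * nm c) by rewrite invfM mulrA.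
  rewrite expr_div_n; have : (N%:R * nm c) ^+ m != 0 by rewrite expf_neq0 // gt_eqF // mulr_gt0.
  by move: ((N%:R * nm c) ^+ m) => V V0; field.
have e1 : (N%:R * nm c) ^+ m * dl ^+ (N - m) <= (N%:R * nm c) ^+ m * 2 ^+ N.
  rewrite ler_pM2l ?exprn_gt0 ?mulr_gt0 //; apply: le_trans (_ : 2 ^+ (N - m) <= _).
    by apply: lerXn2r; rewrite ?nnegrE //; lra.
  by apply: ler_weXn2l; [lra|exact: leq_subr].
have -> : B = 2 * (K * ((N%:R * nm c) ^+ m * 2 ^+ N)) by rewrite /B; ring.
have q0 : 0 <= nm (f a) * nm lam ^+ m by rewrite mulr_ge0 ?nm_ge0 // exprn_ge0 // nm_ge0.
have q1 : 0 <= (N%:R * nm c) ^+ m * dl ^+ (N - m).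
  by rewrite mulr_ge0 ?exprn_ge0 ?mulr_ge0 ?nm_ge0 // ltW.
by apply: ler_pM; [lra|exact: mulr_ge0|exact: th2|exact: ler_pM].
Qed.

(** Each unit of the level costs the factor [3^N], which is at most [e^(3^N)]. *)
Lemma strip_growth : exists M (L : nat), forall z, 1 <= level z -> nm (f z) <= M * expR (L%:R * level z).
Proof.
have [N [B [B0 step]]] := strip_step.
have [||M0 HM0] := @strip_bounded f 1 3.
- by move=> z h _; apply: f_per.
- by move=> z h _; apply/hol_cont/f_hol.
pose M := `|M0| + B; have M0' : 0 <= M by rewrite addr_ge0.
pose L := (3 ^ N)%N; exists M, L.
have L0 : 0 <= L%:R :> R by [].
have eL : 3 ^+ N <= expR L%:R :> R.
  by apply: le_trans (expR_ge1Dx _); rewrite /L natrX lerDr.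
have e1 y : 1 <= y -> 1 <= expR (L%:R * y) by move=> hy; rewrite -expR0 ler_expR mulr_ge0 //; lra.
suff H (n : nat) z : 1 <= level z -> level z <= 3 + n%:R -> nm (f z) <= M * expR (L%:R * level z).
  move=> z hz; apply: (H (Num.bound (level z))) => //.
  by have := archi_boundP (le_trans ler01 hz); lra.
elim: n z => [|n IH] z z1 z2.
  apply: le_trans (_ : M <= _); last by rewrite ler_peMr // e1.
  by apply: le_trans (HM0 z z1 _) _; [lra|rewrite /M; have := ler_norm M0; lra].
have [small|big] := leP (level z) 3.
  apply: le_trans (_ : M <= _); last by rewrite ler_peMr // e1.
  by apply: le_trans (HM0 z z1 small) _; rewrite /M; have := ler_norm M0; lra.
case: (step z (ltW big)) => [h|[a [a1 a2 h]]].
  apply: le_trans (_ : M <= _); last by rewrite ler_peMr // e1.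
  by rewrite /M; have := normr_ge0 M0; lra.
apply: le_trans h _.
have Ia := IH a a1 ltac:(by move: z2; rewrite -natr1; lra).
apply: le_trans (_ : expR L%:R * (M * expR (L%:R * level a)) <= _).
  by apply: ler_pM; rewrite ?nm_ge0 ?exprn_ge0.
rewrite mulrCA ler_wpM2l // -expRD ler_expR -[X in X + _]mulr1 -mulrDr ler_wpM2l //; lra.
Qed.
End Ode.
End Period.
End Strip.

(** * Inverting the exponential *)
Section ExpInv.
Variable R : realType.
Notation C := (Cplx R).
Implicit Types (f g : C -> C) (z w a b c l om u v : C) (x y r : R) (n : int).

Lemma real_cont_eps (F : R -> R) x r : {for x, continuous F}%classic -> 0 < r ->
  exists2 d, 0 < d & forall y, `|y - x| < d -> `|F y - F x| < r.
Proof.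
move=> /cvgrPdist_lt H r0; have /nbhs_ballP [d /= d0 Hd] := H r r0.
by exists d => // y hy; have := Hd y; rewrite /ball /= distrC => /(_ hy); rewrite distrC.
Qed.

Lemma ce_polar v : 0 < Rez v -> ce (rc (ln (nm v)) + 'i * rc (asin (Imz v / nm v))) = v.
Proof.
move=> v0; have r0 : 0 < nm v by apply: lt_le_trans v0 _; apply: le_trans (ler_norm _) (Re_le_nm v).
have s1 : -1 <= Imz v / nm v <= 1.
  by rewrite -ler_norml normrM normfV (gtr0_norm r0) ler_pdivrMr // mul1r Im_le_nm.
have E : expR (ln (nm v)) = nm v by rewrite lnK.
apply: C_eq; rewrite ?Rez_ce ?Imz_ce Rez_rc Imz_rc E.
- rewrite cos_asin //; have -> : 1 - (Imz v / nm v) ^+ 2 = (Rez v / nm v) ^+ 2.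
    have := nm_sqr v => h; rewrite !expr_div_n; have n0 : nm v ^+ 2 != 0 by rewrite expf_neq0 // gt_eqF.
    by rewrite -{1}(divff n0) -mulrBl h addrK.
  by rewrite sqrtr_sqr normrM normfV !gtr0_norm // mulrC divfK // gt_eqF.
- by rewrite asinK ?in_itv //= mulrC divfK // gt_eqF.
Qed.

(** A local logarithm at 1, by [ln] and [asin]; its value can be kept in any
    prescribed disc. *)
Lemma ce_local r : 0 < r -> exists2 d, 0 < d & forall v, nm (v - 1) < d -> exists2 z, nm z < r & ce z = v.
Proof.
move=> r0; have r2 : 0 < r / 2 by rewrite divr_gt0.
have [d1 d10 H1] := real_cont_eps (continuous_ln (@ltr01 R)) r2.
have i0 : -1 < (0 : R) < 1 by rewrite ltr01 andbT; lra.
have [d2 d20 H2] := real_cont_eps (continuous_asin i0) r2.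
exists (Num.min (Num.min d1 (d2 / 2)) (1 / 2)); first by rewrite !lt_min d10 !divr_gt0.
move=> v; rewrite !lt_min => /andP[/andP[v1 v2] v3].
have R1 : 0 < Rez v.
  have := Re_le_nm (v - 1); rewrite RezD RezN -rc1 Rez_r ler_norml => /andP[h _].
  by move: v3; rewrite -rc1; lra.
have nv : 1 / 2 <= nm v by have := nm_subr 1 (1 - v); rewrite nm1 subKr nmB; lra.
exists (rc (ln (nm v)) + 'i * rc (asin (Imz v / nm v))); last exact: ce_polar.
apply: le_lt_trans (nm_le_ReIm _) _; rewrite Rez_rc Imz_rc.
have a1 : `|ln (nm v)| < r / 2.
  have := H1 (nm v); rewrite ln1 subr0; apply; apply: le_lt_trans v1.
  by rewrite ler_norml; have := nm_subr v 1; have := nm_subr 1 v; rewrite nm1 nmB; lra.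
have a2 : `|asin (Imz v / nm v)| < r / 2.
  have a0 : asin 0 = 0 :> R.
    rewrite -[X in asin X]sin0 sinK // in_itv /=; have := @pi_gt0 R; lra.
  have := H2 (Imz v / nm v); rewrite a0 !subr0; apply.
  have n0 : 0 < nm v by lra.
  rewrite normrM normfV (gtr0_norm n0) ltr_pdivrMr //.
  have := Im_le_nm (v - 1); rewrite ImzD ImzN -rc1 Imz_r oppr0 addr0 => h.
  apply: le_lt_trans h _; rewrite -rc1 in v2; apply: lt_le_trans v2 _.
  by rewrite ler_pM2l //; lra.
lra.
Qed.

(** The fundamental period [2 pi i] of the exponential. *)
Definition tau : C := 'i * rc (pi *+ 2).
Lemma Rez_tau : Rez tau = 0. Proof. by rewrite /tau -[_ * _]add0r -rc0 Rez_rc. Qed.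
Lemma Imz_tau : Imz tau = pi *+ 2. Proof. by rewrite /tau -[_ * _]add0r -rc0 Imz_rc. Qed.
Lemma ce_i y : ce ('i * rc y) = rc (cos y) + 'i * rc (sin y).
Proof.
have R0 : Rez ('i * rc y) = 0 by rewrite RezM Rezi Imzi Rez_r Imz_r; ring.
have I0 : Imz ('i * rc y) = y by rewrite ImzM Rezi Imzi Rez_r Imz_r; ring.
by apply: C_eq; rewrite ?Rez_ce ?Imz_ce R0 I0 expR0 mul1r ?Rez_rc ?Imz_rc.
Qed.
Lemma ce_tau : ce tau = 1.
Proof. by rewrite ce_i cos2pi sin2pi rc0 rc1 mulr0 addr0. Qed.
Lemma tau_neq0 : tau != 0.
Proof.
apply/eqP => h; have := Imz_tau; rewrite h -rc0 Imz_r => /esym/eqP.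
by rewrite gt_eqF // mulr2n addr_gt0 // pi_gt0.
Qed.
Lemma ce_tau_int n : ce (n%:~R * tau) = 1.
Proof.
case: n => n; first by rewrite ceMn ce_tau expr1n.
by rewrite NegzE mulrNz mulNr ceN ceMn ce_tau expr1n invr1.
Qed.

Lemma ce_surj v : v != 0 -> exists z, ce z = v.
Proof.
have half w : Rez w != 0 -> exists z, ce z = w.
  move=> w0; have [neg|pos] := leP (Rez w) 0; last by eexists; exact: ce_polar.
  have p : 0 < Rez (- w) by rewrite RezN oppr_gt0 lt_def eq_sym w0.
  exists (rc (ln (nm (- w))) + 'i * rc (asin (Imz (- w) / nm (- w))) + 'i * rc pi).
  by rewrite ceD ce_polar // ce_i cospi sinpi rc0 mulr0 addr0 rcN rc1 mulrN1 opprK.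
move=> v0; have [h|/half//] := eqVneq (Rez v) 0.
have [|z hz] := half (v * (- 'i)).
  rewrite RezM RezN ImzN Rezi Imzi oppr0 mulr0 sub0r mulrN1 opprK.
  apply: contraNneq v0 => h'; apply/eqP; apply: C_eq; rewrite -rc0 ?Rez_r ?Imz_r //.
exists (z + 'i * rc (pi / 2)).
by rewrite ceD hz ce_i cos_pihalf sin_pihalf rc0 rc1 add0r mulr1 -mulrA mulNr -expr2 sqrCi opprK mulr1.
Qed.

Lemma ce_eq1 u : ce u = 1 -> exists n, u = n%:~R * tau.
Proof.
move=> hu; pose T := pi *+ 2 : R; have T0 : 0 < T by rewrite /T mulr2n addr_gt0 // pi_gt0.
pose n := Num.floor (Imz u / T); exists n.
pose u' := u - n%:~R * tau.
have h' : ce u' = 1 by rewrite /u' ceD hu ceN ce_tau_int invr1 mulr1.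
have R0 : Rez u' = 0.
  by apply: expR_inj; rewrite -nm_ce h' nm1 expR0.
have c1 : cos (Imz u') = 1.
  by have := Rez_ce u'; rewrite h' R0 expR0 mul1r -rc1 Rez_r => <-.
have I1 : Imz u' = (Imz u / T - n%:~R) * T.
  rewrite /u' -rc_int ImzD ImzN ImzM Rez_r Imz_r mul0r addr0 Imz_tau -/T.
  by rewrite mulrBl divfK // gt_eqF.
have /andP[f1 f2] := floor_itv (Imz u / T); rewrite rmorphD /= -/n in f1 f2.
have y0 : 0 <= Imz u' by rewrite I1 mulr_ge0 ?subr_ge0 ?(ltW T0).
have y1 : Imz u' < T by rewrite I1 -[ltRHS]mul1r ltr_pM2r //; lra.
have ET : T = pi + pi by rewrite /T mulr2n.
have P0 := @pi_gt0 R.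
have I0 : Imz u' = 0.
  have [small|big] := leP (Imz u') pi.
    by apply: cos_inj; rewrite ?in_itv /= ?y0 ?lexx ?(ltW P0) // c1 cos0.
  have : T - Imz u' = 0.
    apply: cos_inj; rewrite ?in_itv /= ?lexx ?(ltW P0) //; first by lra.
    by rewrite cos0 -cosN opprB -(cosD2pi (Imz u' - T)) -/T subrK.
  lra.
apply/eqP; rewrite -subr_eq0; apply/eqP; apply: C_eq; rewrite -rc0 ?Rez_r ?Imz_r //.
Qed.

Lemma poly_growth (P : {poly C}) : exists K, exists L, 0 <= K /\
  forall w, nm P.[w] <= K * (1 + nm w) ^+ L.
Proof.
elim/poly_ind: P => [|P c [K [L [K0 H]]]].
  by exists 0, 0%N; split=> // w; rewrite horner0 nm0 mul0r.
exists (K + nm c), L.+1; split; first by rewrite addr_ge0 ?nm_ge0.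
move=> w; rewrite hornerMXaddC; apply: le_trans (nmD _ _) _; rewrite nmM.
have w0 := nm_ge0 w; have X1 : 1 <= (1 + nm w) ^+ L.+1 by apply: exprn_ege1; lra.
rewrite mulrDl lerD //; last by rewrite ler_peMr // nm_ge0.
rewrite exprSr mulrA; apply: ler_pM; rewrite ?nm_ge0 //; lra.
Qed.
Lemma hol_horner (P : {poly C}) f z : hol f z -> hol (fun w => P.[f w]) z.
Proof.
move=> hf; elim/poly_ind: P => [|P c IH].
  by under [X in hol X]eq_fun do rewrite horner0; exact: hol_cst.
under [X in hol X]eq_fun do rewrite hornerMXaddC.
by apply: holD; [exact: holM|exact: hol_cst].
Qed.

Section Laurent.
Variables (b c om : C).
Hypothesis (c0 : c != 0) (com : c * om = tau).
Definition ez z : C := ce (c * (z - b)).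

Lemma Rez_com : Rez (c * om) = 0. Proof. by rewrite com Rez_tau. Qed.
Lemma nm_ez z : nm (ez z) = expR (level b c z).
Proof. exact: nm_ce. Qed.
Lemma ez_neq0 z : ez z != 0. Proof. exact: ce_neq0. Qed.
Lemma ez_per n z : ez (z + n%:~R * om) = ez z.
Proof.
rewrite /ez; have -> : c * (z + n%:~R * om - b) = c * (z - b) + n%:~R * (c * om) by ring.
by rewrite ceD com ce_tau_int mulr1.
Qed.
Lemma ez_inj z w : ez z = ez w -> exists n, z = w + n%:~R * om.
Proof.
move=> h; have [|n hn] := @ce_eq1 (c * (z - w)).
  have -> : c * (z - w) = c * (z - b) - c * (w - b) by ring.
  by rewrite ceD ceN -/(ez z) h divff // ez_neq0.
exists n; apply: (mulfI c0); have -> : c * (w + n%:~R * om) = c * w + n%:~R * (c * om) by ring.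
by rewrite com -hn; ring.
Qed.
Lemma ez_surj w : w != 0 -> exists z, ez z = w.
Proof.
move=> /ce_surj [u hu]; exists (u / c + b).
by rewrite /ez -hu; congr ce; field.
Qed.
Lemma ez_cder z : is_cder ez z (c * ez z).
Proof.
have h := is_cderM (is_cder_cst c z) (is_cder_subid b z).
have := is_cder_comp h (is_cder_ce (c * (z - b))).
by rewrite mul0r add0r mulr1 mulrC.
Qed.
Lemma ez_hol z : hol ez z.
Proof. by apply: entire_hol => w; eexists; exact: ez_cder. Qed.
Lemma ez_local z0 r : 0 < r -> exists2 d, 0 < d &
  forall w, nm (w - ez z0) < d -> exists2 z, nm (z - z0) < r & ez z = w.
Proof.
move=> r0; have nc : 0 < nm c by rewrite nm_gt0.
have [d d0 Hd] := ce_local (mulr_gt0 nc r0).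
have w0 : 0 < nm (ez z0) by rewrite nm_gt0 ez_neq0.
exists (d * nm (ez z0)); first by rewrite mulr_gt0.
move=> w hw; have [|u hu ue] := Hd (w / ez z0).
  have -> : w / ez z0 - 1 = (w - ez z0) / ez z0 by field; exact: ez_neq0.
  by rewrite nmM nmV ltr_pdivrMr.
exists (z0 + u / c).
  by rewrite addrC addKr nmM nmV ltr_pdivrMr // mulrC.
rewrite /ez; have -> : c * (z0 + u / c - b) = c * (z0 - b) + u by field.
by rewrite ceD ue -/(ez z0) mulrC divfK // ez_neq0.
Qed.

(** A periodic entire function of exponential growth is a Laurent polynomial in the
    exponential: it factors through a function on the punctured plane, whose
    singularity at the origin is removed by multiplication with a power.  The
    product has polynomial growth. *)
Lemma periodic_laurent (H : C -> C) (M : R) (L : nat) : (forall z, cdiff H z) ->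
  (forall z, H (z + om) = H z) -> (forall z, nm (H z) <= M * expR (L%:R * `|level b c z|)) ->
  exists P : {poly C}, forall z, H z = P.[ez z] / ez z ^+ L.+2.
Proof.
move=> dH pH bH.
have M0 : 0 <= M.
  by have := le_trans (nm_ge0 _) (bH 0); rewrite pmulr_lge0 // expR_gt0.
have pHn n z : H (z + n%:~R * om) = H z.
  by apply: (@per_int _ b c om Rez_com (fun=> True)) => // w _; exact: pH.
have /boolp.choice [lg Hlg] : forall w, exists z, w != 0 -> ez z = w.
  move=> w; have [->|w0] := eqVneq w 0; first by exists 0 => /eqP.
  by have [z hz] := ez_surj w0; exists z.
(* [w^L] would make the product bounded near the origin; two more factors make
   its derivative there exist and vanish. *)
pose E w := if w == 0 then 0 else w ^+ L.+2 * H (lg w).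
have EE z : E (ez z) = ez z ^+ L.+2 * H z.
  rewrite /E (negbTE (ez_neq0 z)).
  by have [n ->] := ez_inj (Hlg _ (ez_neq0 z)); rewrite pHn.
have eL y : expR (L%:R * y) = expR y ^+ L by rewrite mulrC expRM_natr.
have cancelX y : 0 < y -> y ^+ L.+2 * y^-1 ^+ L = y ^+ 2 :> R.
  by move=> y0; rewrite -[L.+2]addn2 exprD mulrAC -exprMn divff ?gt_eqF // expr1n mul1r.
have bE w : nm (E w) <= M * (1 + nm w) ^+ (L.+2 + L).
  have w1 : 0 <= nm w := nm_ge0 w.
  have [->|w0] := eqVneq w 0.
    by rewrite /E eqxx nm0 addr0 expr1n mulr1.
  have [z <-] := ez_surj w0; rewrite EE nmM nmX nm_ez.
  have h := bH z; have e0 := expR_gt0 (level b c z); set x := level b c z in h e0 *.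
  have [x0|x0] := leP 0 x.
    rewrite (ger0_norm x0) eL in h.
    apply: le_trans (ler_wpM2l (exprn_ge0 L.+2 (ltW e0)) h) _.
    rewrite mulrCA -exprD ler_wpM2l //.
    by apply: lerXn2r; rewrite ?nnegrE; lra.
  rewrite (ltr0_norm x0) eL expRN in h.
  apply: le_trans (ler_wpM2l (exprn_ge0 L.+2 (ltW e0)) h) _.
  have ex1 : expR x <= 1 by rewrite -expR0 ler_expR ltW.
  rewrite mulrCA ler_wpM2l // cancelX //; apply: le_trans (_ : 1 <= _).
    by rewrite expr_le1 // ltW.
  by apply: exprn_ege1; lra.
have small w : nm w <= 1 -> nm (E w) <= M * nm w ^+ 2.
  have [->|w0] := eqVneq w 0; first by rewrite /E eqxx nm0 expr0n mulr0.
  have [z <-] := ez_surj w0; rewrite EE nmM nmX nm_ez => w1.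
  have h := bH z; have e0 := expR_gt0 (level b c z); set x := level b c z in h e0 w1 *.
  have x0 : x <= 0 by rewrite -ler_expR expR0.
  rewrite (ler0_norm x0) eL expRN in h.
  apply: le_trans (ler_wpM2l (exprn_ge0 L.+2 (ltW e0)) h) _.
  by rewrite mulrCA ler_wpM2l // cancelX.
have dE w : cdiff E w.
  have [->|w0] := eqVneq w 0.
    exists 0; split=> e e0; exists (Num.min 1 (e / (M + 1))).
      by rewrite lt_min ltr01 divr_gt0 //; lra.
    move=> h; rewrite lt_min => /andP[h1 h2].
    rewrite add0r mulr0 subr0 {2}/E eqxx subr0; apply: le_trans (small h (ltW h1)) _.
    rewrite expr2 mulrA ler_wpM2r ?nm_ge0 //.
    rewrite ltr_pdivlMr in h2; last by lra.
    by have := nm_ge0 h; lra.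
  have [z0 z0E] := ez_surj w0; rewrite -z0E.
  (* Differentiability of [E] at [ez z0]: divide the Caratheodory quotients of
     [E \o ez] and of [ez], and use that [ez] is open. *)
  pose K z := ez z ^+ L.+2 * H z.
  have [lK hK] : cdiff K z0.
    by apply: cdiffM => //; apply: cdiffX; eexists; exact: ez_cder.
  have /is_cder_car [pK [cK _ KE]] := hK.
  have /is_cder_car [pe [cp pe0 eE]] := ez_cder z0.
  have pe_neq : pe z0 != 0 by rewrite pe0 mulf_neq0 // ez_neq0.
  have [cq] : ccont (fun z => pK z / pe z) z0 by apply: ccontM => //; exact: ccontV.
  have [d1 d10 H1] := ccont_neq0 cp pe_neq.
  exists (pK z0 / pe z0); split=> e e0.
  have [d2 d20 H2] := cq e e0.
  have [d d0 Hd] := @ez_local z0 (Num.min d1 d2) ltac:(by rewrite lt_min d10).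
  exists d => // h hd; have [|z zz0 zE] := Hd (ez z0 + h); first by rewrite addrC addKr.
  move: zz0; rewrite lt_min => /andP[z1 z2].
  have hE : h = (z - z0) * pe z by rewrite -(addrK (ez z0) h) [h + _]addrC -zE eE; ring.
  rewrite -zE !EE -!/(K _) KE.
  have P1 := H1 z z1.
  have -> : K z0 + (z - z0) * pK z - K z0 - h * (pK z0 / pe z0) = h * (pK z / pe z - pK z0 / pe z0).
    have -> : (z - z0) * pK z = h * (pK z / pe z) by rewrite hE -mulrA (mulrC (pe z)) divfK.
    rewrite mulrBr; move: (h * _) (h * _) => s t; ring.
  by rewrite nmM mulrC ler_wpM2r ?nm_ge0 // ltW // H2.
have [P HP] := liouville dE bE.
by exists P => z; rewrite -HP EE mulrC mulKf // expf_neq0 // ez_neq0.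
Qed.
End Laurent.
End ExpInv.

(** * Periods of meromorphic functions *)
Section Periods.
Variable R : realType.
Notation C := (Cplx R).
Implicit Types (f g : C -> C) (z w a b c u v : C) (x y r t : R) (n : int).

Lemma mero_eq_refl f : mero_eq f f.
Proof. by apply/mero_eqP => z; exists 1. Qed.
Lemma mero_eq_shift f g u : mero_eq f g -> mero_eq (fun z => f (z + u)) (fun z => g (z + u)).
Proof.
move=> /mero_eqP H; apply/mero_eqP => z.
apply: pnbh_mono (@pnbh_aff R 1 u z _ (oner_neq0 C) (H (1 * z + u))) => w _ /=.
by rewrite mul1r.
Qed.
Lemma mero_shift f u : meromorphic f -> meromorphic (fun z => f (z + u)).
Proof.
by move=> /(mero_aff u (oner_neq0 C) (oner_neq0 C)); under eq_fun do rewrite !mul1r.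
Qed.
Lemma hol_shift f u z : hol f (z + u) -> hol (fun w => f (w + u)) z.
Proof.
by move=> h; apply: (@hol_comp R (fun w => w + u) f) => //; apply: holD; [exact: hol_id|exact: hol_cst].
Qed.

Lemma is_period0 f : is_period f 0.
Proof. by rewrite /is_period; under eq_fun do rewrite addr0; exact: mero_eq_refl. Qed.
Lemma is_periodD f u v : is_period f u -> is_period f v -> is_period f (u + v).
Proof.
move=> pu pv; have := mero_eq_trans (mero_eq_shift u pv) pu.
by rewrite /is_period; under eq_fun do rewrite -addrA.
Qed.
Lemma is_periodN f u : is_period f u -> is_period f (- u).
Proof.
move=> pu; have := mero_eq_sym (mero_eq_shift (- u) pu).
by rewrite /is_period; under [X in mero_eq _ X]eq_fun do rewrite subrK.
Qed.
Lemma is_period_int f u n : is_period f u -> is_period f (n%:~R * u).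
Proof.
move=> pu; have nat_ (k : nat) : is_period f (k%:~R * u).
  elim: k => [|k IH]; first by rewrite mul0r; exact: is_period0.
  by rewrite -addn1 PoszD rmorphD /= mulrDl mul1r; exact: is_periodD.
by case: n => k; rewrite ?NegzE ?mulrNz ?mulNr; [|apply: is_periodN]; exact: nat_.
Qed.
Lemma period_hol f u z : meromorphic f -> is_period f u -> hol f z -> hol f (z + u).
Proof.
move=> fm pu hz; have := hol_mero_eq (mero_shift u fm) pu hz.
have {1}-> : z = z + u + (- u) by rewrite addrK.
by move/hol_shift; under [X in hol X]eq_fun do rewrite subrK.
Qed.
Lemma period_at f u z : meromorphic f -> is_period f u -> hol f z -> f (z + u) = f z.
Proof.
move=> fm pu hz; apply: (@mero_eq_at R (fun w => f (w + u)) f) => //.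
by apply: hol_shift; exact: period_hol.
Qed.
Lemma hol_or_pole f z m : meromorphic f -> (forall a m', pole_of_order f a m' -> m' = m) ->
  hol f z \/ pole_of_order f z m.
Proof. by move=> /meroP /(_ z) [|[m' h]] H; [left|right; rewrite -(H _ _ h)]. Qed.

(** Compactness of a segment: the points where a meromorphic function is not
    holomorphic are isolated. *)
Lemma segment_poles f u v : meromorphic f -> exists s : seq C,
  (forall z, z \in s -> ~ hol f z) /\
  forall t, 0 <= t <= 1 -> ~ hol f (u + rc t * (v - u)) -> u + rc t * (v - u) \in s.
Proof.
move=> fm.
pose good (x y : C) := exists s : seq C, forall t, 0 <= t <= 1 ->
  ~ hol f (x + rc t * (y - x)) -> x + rc t * (y - x) \in s.
suff [s Hs] : good u v.
  exists [seq z <- s | `[<~ hol f z>]]; split=> [z|t ht nh].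
    by rewrite mem_filter => /andP[/asboolP].
  by rewrite mem_filter (Hs t ht nh) andbT; apply/asboolP.
apply: contrapT => bad.
have [|z Hz] := @bisection R (fun x y : C => ~ good x y) u v bad.
  move=> x y nG; set c := (x + y) / 2.
  have [[s0 g0]|g0] := pselect (good x c); last by left.
  have [[s1 g1]|g1] := pselect (good c y); last by right.
  case: nG; exists (s0 ++ s1) => t /andP[t0 t1] nh; rewrite mem_cat.
  have two0 : (2 : C) != 0 by rewrite pnatr_eq0.
  have r2 : rc 2 = 2 :> C by rewrite rc_nat.
  have [t2|t2] := leP t (1 / 2).
    have E : x + rc t * (y - x) = x + rc (2 * t) * (c - x) by rewrite /c rcM r2; field.
    by rewrite E in nh *; rewrite (g0 (2 * t)) //; lra.
  have E : x + rc t * (y - x) = c + rc (2 * t - 1) * (y - c).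
    by rewrite /c rcB rcM r2 rc1; field.
  by rewrite E in nh *; rewrite (g1 (2 * t - 1)) ?orbT //; lra.
have [e e0 He] := mero_pnbh z fm.
have [x [y [nG h1 h2]]] := Hz (e / 5) ltac:(by rewrite divr_gt0).
apply: nG; exists [:: z] => t /andP[t0 t1] nh; rewrite inE; apply: contrapT => /negP ne.
apply: nh; apply: He => //.
have -> : x + rc t * (y - x) - z = (x - z) + rc t * (y - x) by ring.
apply: le_lt_trans (nmD _ _) _; rewrite nmM nm_real ger0_norm //.
have : t * nm (y - x) <= nm (y - x) by rewrite ler_piMl ?nm_ge0.
by move: h1; rewrite ltr_pdivlMr //; lra.
Qed.
End Periods.

(** * Simply periodic solutions *)
Section Cylinder.
Variable R : realType.
Notation C := (Cplx R).
Implicit Types (z w u v : C) (x y r t : R) (n : int).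
Variables (k d : nat) (j : 'I_d -> nat) (m : nat) (f : C -> C) (b om : C).
Hypothesis (hd : (1 < d)%N) (hj : forall i, (j i < k)%N).
Hypothesis weights : (m + k = \sum_(i < d) (m + j i))%N.
Hypothesis (f_mero : meromorphic f) (f_sol : is_ode_solution k j f).
Hypothesis f_order : forall a m', pole_of_order f a m' -> m' = m.
Hypothesis (om0 : om != 0) (f_per : is_period f om).
(* [cexp (c * z)] has the period [om]. *)
Let c : C := tau R / om.
Hypothesis f_line : forall z, level b c z != 0 -> hol f z.
Hypothesis f_refl : mero_eq (fun z => (-1) ^+ m * f (-1 * z + (b - -1 * b))) f.

Let c0 : c != 0. Proof. by rewrite mulf_neq0 ?invr_neq0 // tau_neq0. Qed.
Let com : c * om = tau R. Proof. by rewrite /c divfK. Qed.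
Let Re_com : Rez (c * om) = 0. Proof. by rewrite com Rez_tau. Qed.

(** The reflection [f_refl] carries the estimate from one side of the line of poles
    to the other. *)
Lemma cylinder_growth : exists M (L : nat), 0 <= M /\ forall z, 1 <= `|level b c z| ->
  nm (f z) <= M * expR (L%:R * `|level b c z|).
Proof.
have hol1 z : 1 <= level b c z -> hol f z by move=> h; apply: f_line; rewrite gt_eqF //; lra.
have [M [L H]] := strip_growth c0 om0 Re_com hd hj weights f_sol hol1
  (fun z hz => period_at f_mero f_per (hol1 z hz)).
exists `|M|, L; split=> // z hz.
have le_M y : M * y <= `|M| * `|y| by rewrite -normrM ler_norm.
have [pos|neg] := leP 0 (level b c z).
  rewrite ger0_norm // in hz *; apply: le_trans (H z hz) (le_trans (le_M _) _).
  by rewrite [X in _ * X]ger0_norm // expR_ge0.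
rewrite ltr0_norm // in hz *.
pose z' := -1 * z + (b - -1 * b).
have lz' : level b c z' = - level b c z.
  by rewrite /level -RezN; congr Rez; rewrite /z'; ring.
have E : (-1) ^+ m * f z' = f z.
  apply: (mero_eq_at f_refl); last by apply: f_line; rewrite lt_eqF.
  apply: holM; first exact: hol_cst.
  apply: (@hol_comp R (fun z => -1 * z + (b - -1 * b)) f); first exact: hol_aff.
  by apply: hol1; rewrite lz'.
rewrite -E nmM nmX nmN nm1 expr1n mul1r -lz'; apply: le_trans (H z' _) (le_trans (le_M _) _).
  by rewrite lz'.
by rewrite [X in _ * X]ger0_norm // expR_ge0.
Qed.

Lemma line_fundamental z : level b c z = 0 -> exists n t, 0 <= t <= 1 /\ z = b + rc t * (b + om - b) + n%:~R * om.
Proof.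
move=> h; pose y := Imz (c * (z - b)) / (pi *+ 2).
have p0 : (pi *+ 2 : R) != 0 by rewrite gt_eqF // mulr2n addr_gt0 // pi_gt0.
have E : c * (z - b) = rc y * tau R.
  apply: C_eq; first by rewrite -/(level b c z) h RezM Rez_r Imz_r Rez_tau; ring.
  by rewrite [Imz (rc y * _)]ImzM Rez_r Imz_r Rez_tau Imz_tau /y mulr0 addr0 ?mul0r ?addr0 divfK.
have Ez : z = b + rc y * om.
  by apply: (addIr (- b)); apply: (mulfI c0); rewrite E -com; ring.
exists (Num.floor y), (y - (Num.floor y)%:~R); split.
  by have /andP[] := floor_itv y; rewrite rmorphD /=; lra.
by rewrite Ez rcB rc_int; ring.
Qed.

(** Modulo [om] there are finitely many poles.  Multiplication by a polynomial in
    the exponential with zeros of order [m] there gives an entire periodic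
    function, which is a Laurent polynomial by [periodic_laurent]. *)
Theorem cylinder_rational : rational_in_exp f.
Proof.
have [M [L [M0 HM]]] := cylinder_growth.
have [s [s_bad s_all]] := segment_poles b (b + om) f_mero.
pose QP := \prod_(p <- s) ('X - (ez b c p)%:P) ^+ m : {poly C}.
have per n := is_period_int n f_per.
have Q0 w : hol f w -> QP.[ez b c w] != 0.
  move=> hw; rewrite /QP horner_prod prodf_seq_neq0; apply/allP => p ps /=.
  rewrite horner_exp hornerXsubC expf_neq0 // subr_eq0; apply/eqP => h.
  have [n pn_] := ez_inj c0 com (esym h); apply: (s_bad p ps); rewrite pn_.
  exact: period_hol.
have ezh z : hol (ez b c) z := ez_hol b c z.
pose h z := f z * QP.[ez b c z].
have hh z : hol f z -> hol h z by move=> hf; apply: holM => //; exact: hol_horner.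
have [z|H dH hH] := @removable R h.
  have [hz|] := hol_or_pole z f_mero f_order; first by exists h; [exact: hh|exists 1].
  move=> pz; have nz := pole_notin pz; have [_ [G [hG _ HG]]] := (proj1 (poleP f z m) pz).
  have lz : level b c z = 0 by apply/eqP; apply: contra_notT nz => /f_line.
  have [n [t [t01 zE]]] := line_fundamental lz; set p := b + rc t * _ in zE.
  have ps : p \in s.
    apply: s_all => // hp; apply: nz; rewrite zE; exact: period_hol.
  have ezp : ez b c p = ez b c z by rewrite zE ez_per.
  (* The factor of [QP] at [p] vanishes like [(w - z)^m]. *)
  have [E [hE EE _]] := hol_division (ezh z).
  exists (fun w => G w * E w ^+ m * (\prod_(p <- rem p s) ('X - (ez b c p)%:P) ^+ m).[ez b c w]).
    by apply: holM; [apply: holM => //; exact: holX|exact: hol_horner].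
  apply: pnbh_mono HG => w wz fw; rewrite /h fw /QP (big_rem p ps) /= hornerM horner_exp hornerXsubC ezp.
  rewrite EE [ez b c z + _]addrC addrK exprMn.
  have : (w - z) ^+ m != 0 by rewrite expf_neq0 // subr_eq0.
  by move: ((w - z) ^+ m) (E w ^+ m) (_.[_]) => x e q x0; field.
have eH z : hol H z := entire_hol z dH.
have pH z : H (z + om) = H z.
  apply: (@mero_eq_at R (fun z => H (z + om)) H) => //; last exact: hol_shift.
  apply: mero_eq_trans (mero_eq_trans _ hH); first exact: mero_eq_shift (mero_eq_sym hH).
  apply/mero_eqP => a; have /mero_eqP/(_ a) := f_per; apply: pnbh_mono => w _ fw.
  by rewrite /h fw -[om]mul1r (ez_per b com 1).
have [K [N [K0 HK]]] := poly_growth QP.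
have [||M1 HM1] := @strip_bounded R b c om c0 om0 Re_com H (-1) 1.
- by move=> z _ _; exact: pH.
- by move=> z _ _; apply/hol_cont.
have bH z : nm (H z) <= (M * (K * 2 ^+ N) + `|M1|) * expR ((L + N)%:R * `|level b c z|).
  have l0 := normr_ge0 (level b c z).
  have E1 : 1 <= expR ((L + N)%:R * `|level b c z|) by rewrite -expR0 ler_expR mulr_ge0.
  have B0 : 0 <= M * (K * 2 ^+ N) by rewrite !mulr_ge0 ?exprn_ge0.
  have [small|big] := leP `|level b c z| 1.
    apply: le_trans (HM1 z _ _) _; try by move: small; rewrite ler_norml => /andP[].
    apply: le_trans (ler_norm _) (le_trans (_ : _ <= M * (K * 2 ^+ N) + `|M1|) _); first by rewrite lerDr.
    by rewrite ler_peMr // addr_ge0.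
  have hz : hol f z by apply: f_line; rewrite -normr_gt0; lra.
  rewrite -(mero_eq_at hH (hh z hz) (eH z)) /h nmM.
  apply: le_trans (_ : M * (K * 2 ^+ N) * expR ((L + N)%:R * `|level b c z|) <= _); last first.
    by rewrite ler_wpM2r ?expR_ge0 // lerDl.
  rewrite natrD mulrDl expRD mulrACA; apply: ler_pM; rewrite ?nm_ge0 //; first exact/HM/ltW.
  apply: le_trans (HK _) _; rewrite -mulrA ler_wpM2l // mulrC mulrC expRM_natl -exprMn.
  apply: lerXn2r; rewrite ?nnegrE ?mulr_ge0 ?expR_ge0 ?addr_ge0 ?nm_ge0 // nm_ez.
  have : expR (level b c z) <= expR `|level b c z| by rewrite ler_expR ler_norm.
  have : 1 <= expR `|level b c z| by rewrite -expR0 ler_expR.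
  lra.
have [P HP] := periodic_laurent c0 com dH pH bH.
(* Passing from [ez b c z = cexp (c * (z - b))] to [cexp (c * z)]. *)
pose gam := ce (- (c * b)).
have ezE z : ez b c z = gam * cexp (c * z).
  by rewrite -ceE /gam -ceD /ez; congr ce; ring.
pose Q : {poly C} := ('X ^+ (L + N).+2 * QP) \Po (gam *: 'X).
have QE z : Q.[cexp (c * z)] = ez b c z ^+ (L + N).+2 * QP.[ez b c z].
  by rewrite /Q horner_comp hornerZ hornerX -ezE hornerM hornerXn.
exists c, (P \Po (gam *: 'X)), Q; split.
  have [w _ hw] := pnbh_ex (mero_pnbh b f_mero).
  have := QE w; apply: contra_eq_neq => ->; rewrite horner0 eq_sym mulf_neq0 ?Q0 //.
  by rewrite expf_neq0 // ez_neq0.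
apply/mero_eqP => z; have /mero_eqP/(_ z) := hH; move/(pnbhI (mero_pnbh z f_mero)).
apply: pnbh_mono => w _ [hw]; rewrite QE horner_comp hornerZ hornerX -ezE HP /h => fE.
have q0 := Q0 w hw; have e0 : ez b c w ^+ (L + N).+2 != 0 by rewrite expf_neq0 // ez_neq0.
apply: (mulIf q0); rewrite fE.
by rewrite [(_ * QP.[_])^-1]invfM mulrA divfK.
Qed.
End Cylinder.

(** * Rotations, periods and the admissible orders *)
Section Symmetry.
Variable R : realType.
Notation C := (Cplx R).
Implicit Types (z w u v eps al : C) (x y r t : R).

(** From [cos (2 x) = - cos x] at [x = pi / 3]. *)
Lemma cos_pi3 : cos (pi / 3) = 1 / 2 :> R.
Proof.
have p0 := @pi_gt0 R.
have c0 : 0 < cos (pi / 3 : R) by apply: cos_gt0_pihalf; lra.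
have E : cos ((pi / 3) *+ 2) = - cos (pi / 3) :> R.
  have -> : (pi / 3 : R) *+ 2 = - (pi / 3) + pi by rewrite mulr2n; lra.
  by rewrite cosDpi cosN.
move: E; rewrite cos_mulr2n mulr2n expr2 => E.
have : (2 * cos (pi / 3) - 1) * (cos (pi / 3) + 1) = 0 :> R by lra.
by move/eqP; rewrite mulf_eq0 => /orP[] /eqP; lra.
Qed.

(** The primitive [q]-th root of unity [e^(2 pi i / q)]. *)
Definition rootq (q : nat) : C := ce (tau R / q%:R).

Lemma rootq_exp q : (0 < q)%N -> rootq q ^+ q = 1.
Proof.
move=> q0; rewrite -ceMn mulrC divfK ?ce_tau //.
by rewrite pnatr_eq0 -lt0n.
Qed.
Lemma tau_div q : tau R / q%:R = 'i * rc (pi *+ 2 / q%:R).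
Proof. by rewrite rcM rcV rc_nat mulrA. Qed.
Lemma Rez_rootq q : Rez (rootq q) = cos (pi *+ 2 / q%:R).
Proof. by rewrite /rootq tau_div ce_i Rez_rc. Qed.
Lemma Imz_rootq q : Imz (rootq q) = sin (pi *+ 2 / q%:R).
Proof. by rewrite /rootq tau_div ce_i Imz_rc. Qed.
Lemma rootq2 : rootq 2 = -1.
Proof.
have e : pi *+ 2 / 2%:R = pi :> R by rewrite mulr2n; field.
by apply: C_eq; rewrite ?Rez_rootq ?Imz_rootq e ?cospi ?sinpi -rc1 -rcN ?Rez_r ?Imz_r.
Qed.
Lemma rootq4 : rootq 4 = 'i.
Proof.
have e : pi *+ 2 / 4%:R = pi / 2 :> R by rewrite mulr2n; field.
by apply: C_eq; rewrite ?Rez_rootq ?Imz_rootq e ?cos_pihalf ?sin_pihalf ?Rezi ?Imzi.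
Qed.
Lemma rootq6 : rootq 6 = cexp (2 * (pi%:C)%C * 'i / 6).
Proof.
rewrite -ceE /rootq; congr ce; congr (_ / _).
by rewrite /tau mulr2n rcD -/(rc pi); ring.
Qed.
(** [x = rootq 6] satisfies [x^3 + 1 = 0] and [x + 1 != 0], hence
    [x^2 - x + 1 = 0]. *)
Lemma rootq3 : 1 + rootq 3 = rootq 6.
Proof.
have n6 : (6%:R : C) != 0 by rewrite pnatr_eq0.
have n3 : (3%:R : C) != 0 by rewrite pnatr_eq0.
have n2 : (2%:R : C) != 0 by rewrite pnatr_eq0.
have E3 : rootq 3 = rootq 6 ^+ 2 by rewrite -ceMn; congr ce; field.
have E2 : rootq 6 ^+ 3 = -1 by rewrite -ceMn -rootq2; congr ce; field.
have ne : rootq 6 + 1 != 0.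
  apply/eqP => h; have := Rez_rootq 6; have -> : rootq 6 = -1 by apply/eqP; rewrite -addr_eq0 h.
  have -> : pi *+ 2 / 6%:R = pi / 3 :> R by rewrite mulr2n; field.
  by rewrite cos_pi3 -rc1 -rcN Rez_r; lra.
apply: (mulIf ne); rewrite E3; move: (rootq 6) E2 => w w3.
have -> : (1 + w ^+ 2) * (w + 1) = w * (w + 1) + (w ^+ 3 + 1) by ring.
by rewrite w3 addNr addr0.
Qed.
Lemma rootq_nonreal q : (2 < q)%N -> rootq q \isn't Num.real.
Proof.
move=> q2; rewrite real_Imz Imz_rootq; apply/eqP => h.
have p0 := @pi_gt0 R; have q0 : 3 <= q%:R :> R by rewrite ler_nat.
have qp : 0 < q%:R :> R by lra.
have : 0 < sin (pi *+ 2 / q%:R : R).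
  apply: sin_gt0_pi; apply/andP; split; first by rewrite divr_gt0 // mulr2n addr_gt0.
  by rewrite ltr_pdivrMr // mulr2n; have := ler_wpM2l (ltW p0) q0; lra.
by rewrite h ltxx.
Qed.

(** For [q = 5] the number [eps + eps^-1 = 2 cos (2 pi / 5)] lies between 0 and 1;
    for [q > 6] already [eps - 1] has modulus less than 1, since
    [2 pi / q < pi / 3]. *)
Lemma contracting5 : 0 < nm (rootq 5 + (rootq 5)^-1) < 1.
Proof.
have p0 := @pi_gt0 R; set th := pi *+ 2 / 5%:R : R.
have th5 : th * 5 = pi *+ 2 by rewrite /th divfK // pnatr_eq0.
have E : rootq 5 + (rootq 5)^-1 = rc (2 * cos th).
  have RT : Rez (tau R / 5%:R) = 0 by rewrite tau_div RezM Rezi Imzi Rez_r Imz_r; ring.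
  have IT : Imz (tau R / 5%:R) = th by rewrite tau_div ImzM Rezi Imzi Rez_r Imz_r -/th; ring.
  rewrite /rootq -ceN; apply: C_eq.
    by rewrite RezD !Rez_ce RezN ImzN RT IT oppr0 expR0 cosN Rez_r; ring.
  by rewrite ImzD !Imz_ce RezN ImzN RT IT oppr0 expR0 sinN Imz_r; ring.
rewrite E nm_real.
have c0 : 0 < cos th by apply: cos_gt0_pihalf; move: th5; rewrite mulr2n; lra.
have c1 : cos th < 1 / 2.
  rewrite -cos_pi3 ltr_cos ?in_itv /=; move: th5; rewrite mulr2n; lra.
by rewrite ger0_norm; lra.
Qed.

Lemma contracting7 q : (6 < q)%N -> 0 < nm (rootq q - 1) < 1.
Proof.
move=> q6; have p0 := @pi_gt0 R; set th := pi *+ 2 / q%:R : R.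
have q7 : 7 <= q%:R :> R by rewrite ler_nat.
have q0 : 0 < q%:R :> R by lra.
have th0 : 0 < th by rewrite /th divr_gt0 // mulr2n addr_gt0.
have th1 : th < pi / 3.
  by rewrite /th ltr_pdivrMr // mulr2n; have := ler_wpM2l (ltW p0) q7; lra.
have c1 : 1 / 2 < cos th by rewrite -cos_pi3 ltr_cos ?in_itv /=; lra.
have c2 : cos th < 1 by rewrite -[ltRHS]cos0 ltr_cos ?in_itv /=; lra.
have E : nm (rootq q - 1) ^+ 2 = 2 - 2 * cos th.
  rewrite nm_sqr -rc1 -rcN RezD ImzD Rez_r Imz_r Rez_rootq Imz_rootq -/th addr0.
  by have := cos2Dsin2 th; rewrite !expr2; lra.
apply/andP; split.
  by rewrite lt_def nm_ge0 andbT; apply/eqP => h; move: E; rewrite h expr2 mul0r; lra.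
by rewrite -(@expr_lt1 _ 2) ?nm_ge0 // E; lra.
Qed.

Section Solution.
Variables (k d : nat) (j : 'I_d -> nat) (m : nat) (f : C -> C) (b : C).
Hypothesis (hd : (1 < d)%N) (hj : forall i, (j i < k)%N).
Hypothesis (f_mero : meromorphic f) (f_sol : is_ode_solution k j f).
Hypothesis f_pole : pole_of_order f b m.

Lemma all_orders a m' : pole_of_order f a m' -> m' = m.
Proof. by move=> h; exact: (pole_order_uniq f_sol hd h f_pole). Qed.

Lemma pole_weights : (m + k = \sum_(i < d) (m + j i))%N.
Proof.
by have /poleP [m0 [g [hg g0 H]]] := f_pole; have [] := pole_ode f_sol m0 hg g0 H.
Qed.

Lemma other_pole : transcendental_fun f -> exists2 b', b' != b & pole_of_order f b' m.
Proof.
move=> tf; apply: contrapT => no; apply: tf.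
apply: (one_pole_rational hd hj pole_weights f_sol _ f_pole) => z zb.
by have [//|pz] := hol_or_pole z f_mero all_orders; case: no; exists z.
Qed.

(** Translation by a small period would put another pole next to [b]. *)
Lemma poles_isolated : exists2 e : R, 0 < e & forall w, is_period f w -> w != 0 -> e <= nm w.
Proof.
have [e e0 He] := mero_pnbh b f_mero; exists e => // w pw w0; rewrite leNgt; apply/negP => we.
apply: (pole_notin f_pole); rewrite -(addrK w b).
apply: period_hol => //; first exact: is_periodN.
apply: He; last by rewrite addrC addKr.
by rewrite -subr_eq0 addrC addKr.
Qed.

(** The iterates of [al] would produce arbitrarily small periods. *)
Lemma no_contraction al (om : C) : 0 < nm al < 1 -> om != 0 -> is_period f om ->
  (forall w, is_period f w -> is_period f (al * w)) -> False.
Proof.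
move=> /andP[al0 al1] om0 pom pal; have [e e0 He] := poles_isolated.
have pn_ n : is_period f (al ^+ n * om).
  by elim: n => [|n IH]; rewrite ?expr0 ?mul1r // exprS -mulrA; exact: pal.
have om_gt : 0 < nm om by rewrite nm_gt0.
have /cvgrPdist_lt/(_ (e / nm om)) := @cvg_expr R (nm al) ltac:(by rewrite ger0_norm // ltW).
case; first by rewrite divr_gt0.
move=> N _ /(_ N (leqnn N)) /=; rewrite sub0r normrN ger0_norm ?exprn_ge0 ?nm_ge0 //.
rewrite ltr_pdivlMr // -nmX -nmM ltNge He //.
by rewrite mulf_neq0 // expf_neq0 // -nm_gt0.
Qed.

Section Rotation.
Variables (eps : C) (q : nat).
Hypothesis (q0 : (0 < q)%N) (epsq : eps ^+ q = 1).
Hypothesis eps_roots : forall n, pos_int_root (assoc_poly k j m) n -> eps ^+ n = 1.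

Let eps0 : eps != 0.
Proof. by apply: contra_eq_neq epsq => ->; rewrite expr0n gtn_eqF // eq_sym oner_neq0. Qed.

Let rot a : pole_of_order f a m ->
  mero_eq (fun z => f (eps * z + (a - eps * a))) (fun z => eps ^- m * f z).
Proof.
move=> pa; have := mero_eq_scale (eps ^- m) (rotation f_mero f_sol hj pa q0 epsq eps_roots).
by under eq_fun do rewrite mulKf ?expf_neq0 //.
Qed.

Let unrot g h u : mero_eq (fun z => g (eps * z + u)) (fun z => h (eps * z + u)) -> mero_eq g h.
Proof.
move=> /(mero_eq_aff (- (eps^-1 * u)) (invr_neq0 eps0)).
have E z : eps * (eps^-1 * z + - (eps^-1 * u)) + u = z by field.
by under eq_fun do rewrite E; under [X in mero_eq _ X]eq_fun do rewrite E.
Qed.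

(** The symmetries about two poles differ by a translation, which is
    therefore a period. *)
Lemma rotation_period a a' : pole_of_order f a m -> pole_of_order f a' m ->
  is_period f ((1 - eps) * (a - a')).
Proof.
move=> pa pa'; apply: (@unrot _ f (a' - eps * a')).
apply: mero_eq_trans (mero_eq_sym (rot pa')).
have E z : eps * z + (a' - eps * a') + (1 - eps) * (a - a') = eps * z + (a - eps * a) by ring.
by under eq_fun do rewrite E; exact: rot.
Qed.

(** The translation is conjugated by the symmetry about [b]. *)
Lemma period_rotation w : is_period f w -> is_period f (eps * w).
Proof.
move=> pw; apply: (@unrot _ f (b - eps * b)).
apply: mero_eq_trans (mero_eq_sym (rot f_pole)).
apply: mero_eq_trans (mero_eq_scale (eps ^- m) pw).
have E z : eps * z + (b - eps * b) + eps * w = eps * (z + w) + (b - eps * b) by ring.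
under eq_fun do rewrite E.
exact: (mero_eq_shift w (rot f_pole)).
Qed.
End Rotation.

Section Transcendental.
Hypothesis tf : transcendental_fun f.
Variable q : nat.
Hypothesis q_gcd : is_gcd_of (pos_int_root (assoc_poly k j m)) q.

(** If there is no root, every number is a common divisor and the gcd is 0; this is
    the case in which [f] is rational. *)
Lemma gcd_gt0 : (0 < q)%N.
Proof.
rewrite lt0n; apply/eqP => q0; apply: tf.
apply: (no_root_rational f_mero f_sol hj f_pole) => n rn.
have [n0 _] := rn; have := (proj1 q_gcd) n rn.
by rewrite q0 dvd0n => /eqP n0'; rewrite n0' in n0.
Qed.

Let epsq : rootq q ^+ q = 1 := rootq_exp gcd_gt0.
Let eps_roots n : pos_int_root (assoc_poly k j m) n -> rootq q ^+ n = 1.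
Proof. by move=> /(proj1 q_gcd) /dvdnP [t ->]; rewrite mulnC exprM epsq expr1n. Qed.

Let period2 a a' := rotation_period gcd_gt0 epsq eps_roots (a := a) (a' := a').
Let turn w := period_rotation gcd_gt0 epsq eps_roots (w := w).

Lemma large_gcd : (2 < q)%N -> exists om, [/\ om != 0, is_period f om & is_period f (rootq q * om)].
Proof.
move=> q2; have [b' bb' pb'] := other_pole tf.
have pom := period2 pb' f_pole.
exists ((1 - rootq q) * (b' - b)); split=> //; last exact: turn.
rewrite mulf_neq0 // subr_eq0 //; apply/eqP => h.
by have := rootq_nonreal q2; rewrite -h real1.
Qed.

Lemma large_gcd_elliptic : (2 < q)%N -> elliptic f /\ has_period_ratio f (rootq q).
Proof.
move=> q2; have [om [om0 p1 p2]] := large_gcd q2.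
have E : rootq q * om / om = rootq q by rewrite mulfK.
split; [split=> //|]; exists om, (rootq q * om); split=> //.
  by rewrite E; exact: rootq_nonreal.
by rewrite mulf_neq0 // ce_neq0.
Qed.

(** The crystallographic restriction: [eps + eps^-1] and [eps - 1] are combinations of
    powers of [eps], so that they act on the periods, and [no_contraction] excludes
    the orders for which they contract. *)
Lemma gcd_restriction : q \in [:: 1; 2; 3; 4; 6]%N.
Proof.
have q0 := gcd_gt0; have [|q2] := leqP q 2; first by case: (q) q0 => [|[|[|]]].
have [om [om0 p1 _]] := large_gcd q2.
have [q5|q5] := eqVneq q 5%N.
  case: (no_contraction contracting5 om0 p1) => w pw; rewrite mulrDl -q5.
  apply: is_periodD; first exact: turn.
  have -> : (rootq q)^-1 = rootq q ^+ 4.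
    apply: (mulfI (ce_neq0 (tau R / q%:R))); rewrite divff ?ce_neq0 // -exprS.
    by have := epsq; rewrite {2}q5 => ->.
  by do 3 rewrite exprS -mulrA; rewrite expr1; do 4 apply: turn.
have [q7|q7] := leqP q 6; first by case: (q) q0 q2 q5 q7 => [|[|[|[|[|[|[|]]]]]]].
case: (no_contraction (contracting7 q7) om0 p1) => w pw; rewrite mulrBl mul1r.
by apply: is_periodD; [exact: turn|exact: is_periodN].
Qed.

(** All differences of poles are half-periods.  If they are all real multiples of one
    of them, the poles lie on a line. *)
Lemma gcd2 : q = 2%N -> elliptic f \/ rational_in_exp f.
Proof.
move=> q2; have [b' bb' pb'] := other_pole tf.
have E : rootq q = -1 by rewrite q2 rootq2.
have two0 : (2 : C) != 0 by rewrite pnatr_eq0.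
have per a a' : pole_of_order f a m -> pole_of_order f a' m -> is_period f (2 * (a - a')).
  by move=> pa pa'; have := period2 pa pa'; rewrite E opprK.
have d0 : b' - b != 0 by rewrite subr_eq0.
have om0 : 2 * (b' - b) != 0 by rewrite mulf_neq0.
have [[a [pa na]]|flat] := pselect (exists a, pole_of_order f a m /\ (a - b) / (b' - b) \isn't Num.real).
  left; split=> //; exists (2 * (b' - b)), (2 * (a - b)); split=> //; try exact: per.
  by have -> : 2 * (a - b) / (2 * (b' - b)) = (a - b) / (b' - b) by field; rewrite d0.
right; apply: (cylinder_rational (b := b) hd hj pole_weights f_mero f_sol all_orders om0 (per _ _ pb' f_pole)); last first.
  by have := rotation f_mero f_sol hj f_pole gcd_gt0 epsq eps_roots; rewrite E.
move=> z lz; have [//|pz] := hol_or_pole z f_mero all_orders.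
have rz : (z - b) / (b' - b) \is Num.real.
  by apply: contrapT => nz; apply: flat; exists z; split=> //; apply/negP.
move: lz; rewrite /level.
have -> : tau R / (2 * (b' - b)) * (z - b) = tau R / 2 * ((z - b) / (b' - b)) by field; rewrite d0.
have Rt : Rez (tau R / 2) = 0 by rewrite tau_div RezM Rezi Imzi Rez_r Imz_r; ring.
move: rz; rewrite real_Imz => /eqP rz.
by rewrite RezM Rt rz mul0r mulr0 subrr eqxx.
Qed.
End Transcendental.
End Solution.
End Symmetry.

Theorem theoremC (R : realType) (k d : nat) (j : 'I_d -> nat)
    (f : Cplx R -> Cplx R) (z0 : Cplx R) (m : nat)
    (hk : (1 <= k)%N) (hd : (1 < d)%N) (hj : forall i, (j i < k)%N)
    (f_mero : meromorphic f) (f_sol : is_ode_solution k j f)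
    (f_pole : pole_of_order f z0 m) :
  ((forall n : nat, ~ pos_int_root (assoc_poly k j m) n) -> rational_fun f) /\
  (transcendental_fun f ->
   forall q : nat, is_gcd_of (pos_int_root (assoc_poly k j m)) q ->
     [/\ q \in [:: 1; 2; 3; 4; 6]%N,
         q = 2%N -> elliptic f \/ rational_in_exp f,
         q = 4%N -> elliptic f /\ has_period_ratio f 'i
       & q = 3%N \/ q = 6%N ->
         elliptic f /\ has_period_ratio f (cexp (2 * (pi%:C)%C * 'i / 6))]).
Proof.
split=> [|tf q q_gcd]; first exact: (no_root_rational f_mero f_sol hj f_pole).
have big := large_gcd_elliptic hd hj f_mero f_sol f_pole tf q_gcd.
split.
- exact: (gcd_restriction hd hj f_mero f_sol f_pole tf q_gcd).
- exact: (gcd2 hd hj f_mero f_sol f_pole tf q_gcd).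
- by move=> q4; have := big; rewrite q4 rootq4; apply.
rewrite -rootq6 => -[q3|q6]; last by have := big; rewrite q6; apply.
have [om [om0 p1 p2]] := large_gcd hd hj f_mero f_sol f_pole tf q_gcd ltac:(by rewrite q3).
split; first by have [] := big ltac:(by rewrite q3).
have E : (om + rootq R q * om) / om = rootq R 6 by rewrite -rootq3 q3; field.
exists om, (om + rootq R q * om); split=> //; first exact: is_periodD.
by apply: contraNneq (ce_neq0 (tau R / 6%:R)) => h; move: E; rewrite h mul0r => /esym/eqP.
Qed.
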